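(* Let $x\ge 0$ be such that $f(x)>0$. Assume: (1) for all $t\in\mathbb{Z}$, the conditional density $f^{\mathcal{F}_{t-1}}$ of $X_t$ given $\mathcal{F}_{t-1}$ exists, $f^{\mathcal{F}_{t-1}}\in C_0(\mathbb{R})$, and $f\in C_0(\mathbb{R})$; (2) $\left\|\frac1n\sum_{t=1}^n f^{\mathcal{F}_{t-1}}-f\right\|_0\to 0$ almost surely as $n\to+\infty$; (3) the second order derivatives of $f$ and $R$ are continuous and bounded on $[0,+\infty[$; (4) $\sup_{y\ge 0}\left\|\sum_{t=1}^n f^{\mathcal{F}_{t-1}}(y)-nf(y)\right\|_2^2=O(n)$; (5) almost surely, the sequence $\left(\frac1n\sum_{t=1}^n\left(f^{\mathcal{F}_{t-1}}\right)^2\right)_{n\in\mathbb{N}}$ converges in $C_0(\mathbb{R})$. a) If $x>0$, $\lim_{n\to+\infty}n\sqrt{h_n}=+\infty$ and $\lim_{n\to+\infty}n\sqrt{h_n^5}=0$, then $$\sqrt{n\sqrt{h_n}}\,\left(D_n(x)-f(x)\right)\ \xrightarrow[n\to+\infty]{\mathcal{D}}\ \mathcal{N}\left(0,\frac{f(x)}{2\sqrt{\pi x}}\right).$$ b) If $x=0$, $\lim_{n\to+\infty}n\,h_n=+\infty$ and $\lim_{n\to+\infty}n\,h_n^3=0$, then $$\sqrt{n\,h_n}\,\left(D_n(0)-f(0)\right)\ \xrightarrow[n\to+\infty]{\mathcal{D}}\ \mathcal{N}\left(0,\frac{f(0)}{2}\right).$$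
   Context: $\{(X_t,Y_t),\,t\in\mathbb{Z}\}$ is a strictly stationary and ergodic $[0,+\infty[^2$-valued stochastic process on a probability space $(\Omega,\mathcal{A},P)$, with absolutely continuous marginal distributions; $f$ is the density of $X_t$. $\Phi:[0,+\infty[\to\mathbb{R}$ is a known measurable function with $E(|\Phi(Y_1)|)<+\infty$, and $R(x)=E(\Phi(Y_1)\mid X_1=x)$ is the regression function (for $x\ge0$ with $f(x)>0$). For $t\in\mathbb{Z}$, $\mathcal{F}_t=\sigma\{(X_s,Y_s),\,s\le t\}$. $C_0(\mathbb{R})$ is the space of continuous functions on $\mathbb{R}$ tending to zero at infinity, with the sup-norm $\|\cdot\|_0$; $\|\cdot\|_2$ is the norm of $L^2(\Omega,\mathcal{A},P)$. $\xrightarrow{\mathcal{D}}$ denotes convergence in distribution and $\mathcal{N}(0,v)$ the normal law with mean $0$ and variance $v$. The bandwidth sequence $(h_n)_{n\in\mathbb{N}}$ consists of positive reals with $\lim_{n\to+\infty}h_n=0$. For $x\ge 0$, $K_{\alpha(n,x),\beta(n)}$ is the density of the gamma distribution with shape $\alpha(n,x)=\frac{x}{h_n}+1$ and scale $\beta(n)=h_n$: $$K_{\alpha(n,x),\beta(n)}(y)=\frac{1}{\Gamma(\alpha(n,x))\,\beta(n)^{\alpha(n,x)}}\,y^{\alpha(n,x)-1}e^{-y/\beta(n)}\,\mathbb{1}_{[0,+\infty[}(y),\quad y\in\mathbb{R}.$$ The gamma kernel density estimator is $D_n(x)=\frac1n\sum_{t=1}^n K_{\alpha(n,x),\beta(n)}(X_t)$.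 *)

(* Defs.v *)
From HB Require Import structures.
From mathcomp Require Import all_boot all_order all_algebra.
From mathcomp Require Import all_classical all_reals all_analysis.

Set Implicit Arguments.
Unset Strict Implicit.
Unset Printing Implicit Defensive.

Import Order.TTheory GRing.Theory Num.Theory.
Import numFieldNormedType.Exports.

Local Open Scope classical_set_scope.
Local Open Scope ring_scope.

Section processes.
Context {d : measure_display} {T : measurableType d} {R : realType}.

(* The product sigma-algebra on the space of bilateral paths, generated by the
   one-coordinate cylinders. *)
Definition path_cylinders : set (set (int -> R * R)) :=
  [set C | exists (t : int) (B : set (R * R)),
    measurable B /\ C = [set z | B (z t)]].

Definition path_measurable : set (set (int -> R * R)) := <<s path_cylinders >>.

Definition path_shift (k : int) (z : int -> R * R) : int -> R * R :=
  fun t => z (t + k).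

Definition path_of (X Y : int -> T -> R) (w : T) : int -> R * R :=
  fun t => (X t w, Y t w).

Definition strictly_stationary (P : probability T R) (X Y : int -> T -> R) :=
  forall (k : int) (A : set (int -> R * R)), path_measurable A ->
    P [set w | A (path_shift k (path_of X Y w))] = P [set w | A (path_of X Y w)].

Definition ergodic (P : probability T R) (X Y : int -> T -> R) :=
  forall A : set (int -> R * R), path_measurable A ->
    path_shift 1 @^-1` A = A ->
    P [set w | A (path_of X Y w)] = 0%E \/ P [set w | A (path_of X Y w)] = 1%E.

(* The sigma-algebra F_t is <<s past X Y t >>. *)
Definition past (X Y : int -> T -> R) (t : int) : set (set T) :=
  [set A | exists (s : int) (B : set (R * R)),
    [/\ s <= t, measurable B & A = (fun w => (X s w, Y s w)) @^-1` B]].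

(* The observed variables take values in [0, +oo[ and their densities are taken
   with respect to the Lebesgue measure on [0, +oo[. A density is still a
   function on R, since it is required to lie in C0(R), but its values on
   ]-oo, 0[ are left free: if they had to be 0, a density in C0(R) would vanish
   at 0. A density on R carried by [0, +oo[ is a special case. *)
Definition is_density (nu : set R -> \bar R) (f : R -> R) :=
  [/\ measurable_fun setT f, forall y : R, 0 <= y -> 0 <= f y &
      forall B : set R, measurable B -> B `<=` `[0, +oo[%classic ->
        nu B = (\int[lebesgue_measure]_(y in B) (f y)%:E)%E].

(* g w is a density of the conditional law of U given the sigma-algebra
   <<s G >>; the first clause is measurability with respect to the product of
   <<s G >> and the Borel sigma-algebra. *)
Definition is_conditional_density (P : probability T R) (G : set (set T))
    (U : T -> R) (g : T -> R -> R) :=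
  [/\ measurable_fun setT (fun z : g_sigma_algebraType G * R => g z.1 z.2),
      forall w (y : R), 0 <= y -> 0 <= g w y &
      forall (A : set T) (B : set R), <<s G >> A -> measurable B ->
        B `<=` `[0, +oo[%classic ->
        P (A `&` U @^-1` B) =
        (\int[P]_(w in A) \int[lebesgue_measure]_(y in B) (g w y)%:E)%E].

(* r x is a version of E(V | U = x): r \o U is a conditional expectation of V
   given the sigma-algebra generated by U. *)
Definition is_regression (P : probability T R) (U V : T -> R) (r : R -> R) :=
  [/\ measurable_fun setT r, P.-integrable setT (EFin \o (r \o U)) &
      forall B : set R, measurable B ->
        (\int[P]_(w in U @^-1` B) (V w)%:E =
         \int[P]_(w in U @^-1` B) (r (U w))%:E)%E].

Definition cvg_in_distribution (P : probability T R) (Z : nat -> T -> R)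
    (nu : probability (measurableTypeR R) R) :=
  (forall n, measurable_fun setT (Z n)) /\
  forall phi : R -> R, continuous phi -> (exists M : R, forall y, `|phi y| <= M) ->
    ('E_P[phi \o Z n] @[n --> \oo] --> \int[nu]_y (phi y)%:E)%E.

End processes.

Section functions.
Context {R : realType}.

Definition C0 (u : R -> R) :=
  [/\ continuous u, u y @[y --> +oo] --> 0 & u y @[y --> -oo] --> 0].

Definition norm0 (u : R -> R) : \bar R :=
  ereal_sup [set (`|u y|)%:E | y in [set: R]].

(* Derivative relative to [0, +oo[, hence one-sided at 0. *)
Definition is_derive_nneg (u : R -> R) (y l : R) :=
  (u z - u y) / (z - y) @[z --> within `[0, +oo[%classic y^'] --> l.

Definition C2_bounded_nneg (u : R -> R) :=
  exists u1 u2 : R -> R,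
    [/\ forall y : R, 0 <= y -> is_derive_nneg u y (u1 y),
        forall y : R, 0 <= y -> is_derive_nneg u1 y (u2 y),
        {within `[0, +oo[%classic, continuous u2} &
        exists M : R, forall y : R, 0 <= y -> `|u2 y| <= M].

Definition Gamma (a : R) : R :=
  \int[lebesgue_measure]_(t in `[0, +oo[) (t `^ (a - 1) * expR (- t)).

(* For a = 1 the factor y `^ (a - 1) is 1 at y = 0, since 0 `^ 0 = 1. *)
Definition gamma_pdf (a b y : R) : R :=
  (Gamma a * b `^ a)^-1 * y `^ (a - 1) * expR (- (y / b)) * \1_`[0, +oo[ y.

Definition gamma_kde {T : Type} (h : nat -> R) (X : int -> T -> R)
    (n : nat) (x : R) (w : T) : R :=
  n%:R^-1 * \sum_(1 <= t < n.+1) gamma_pdf (x / h n + 1) (h n) (X t%:Z w).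

End functions.

(* Main.v *)
(** Write [b n] for [sqrt (h n)] in case a) and for [h n] in case b), and [K n]
    for the gamma kernel at [x]. With [m n k] the conditional mean of
    [K n (X (k + 1))] given the past,
    [sqrt (n b) (D_n x - f x) = \sum_k xi n k + remainder], where
    [xi n k = sqrt (n b) / n * (K n (X (k + 1)) - m n k)] is a martingale
    difference. The remainder is [sqrt (n b)] times the sum of
    [\int K n * (mean conditional density - f)], which is O(n^(-1/2)) in L^1 by
    Tonelli and hypothesis (4), and of the bias of [K n], which is O(h) since
    the gamma law with shape [x / h + 1] and scale [h] has mean [x + h] and
    variance [h (x + h)].

    The conditional variances are computed from [K n ^ 2 = c_n * K'], [K'] being
    the gamma kernel at [x] with bandwidth [h / 2]: by (2) their sum is
    asymptotic to [b n * c_n * f x], the contribution of [m n k ^ 2] being O(b n)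
    by (5), and Stirling's formula gives the limit of [b n * c_n]. The
    characteristic functions of martingale arrays with small increments and
    convergent sums of conditional variances converge to Gaussian ones, by
    comparing [E cos (l S_k + th) exp (l^2 V_k / 2)] for successive [k], [V_k]
    being the sum of the first [k] conditional variances, after stopping before
    [V_k] gets too large.

    Convergence in distribution follows from that of the means of
    [cos (l y + th)]: Gaussian functions are mixtures of cosines, a Gaussian
    smoothing of a compactly supported continuous function is a mixture of
    Gaussians and is uniformly close to it, and tightness comes from testing
    against a plateau function. *)

Require Import Defs.
From HB Require Import structures.
From mathcomp Require Import all_boot all_order all_algebra.
From mathcomp Require Import all_classical all_reals all_analysis.
From mathcomp Require Import measurable_realfun.
From mathcomp Require Import ring lra.

Set Implicit Arguments.
Unset Strict Implicit.
Unset Printing Implicit Defensive.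

Import Order.TTheory GRing.Theory Num.Theory.
Import numFieldNormedType.Exports.
Import HBSimple HBNNSimple.

Local Open Scope classical_set_scope.
Local Open Scope ring_scope.

(** * Bounded measurable functions *)

(** Everything is kept real and bounded. The phase [th] replaces complex exponentials:
    [cos (l * y + th)] covers cosine and sine together, and expanding it produces functions of the
    same kind. Conditional expectations are not abstract classes: the conditional density provides
    an explicit version, [cexp], and only its integrals against bounded adapted functions matter.

    The obstacle is that the kernel concentrates as [n] grows, so information at a fixed point [y]
    does not survive integration against it. As the kernel is itself a probability density in [y],
    it can be read as the weight and the conditional density as the integrand; any bound uniform in
    [y] then passes to the average. This is how the sup-norm limits (2) and (5) give the conditional
    variances. They carry no rate, whereas the centring error is multiplied by [sqrt (n b)]; there
    the L^2 rate (4) is used, at the price of a control in mean only.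

    Both cases follow from one statement with parameters [b] and [L], the limit of
    [b n * kernel_sqr h x n]: boundedness of [kernel_max * b] makes the increments O((n b)^(-1/2)),
    and [n b h^2 -> 0] removes the bias. *)

Section bounded_measurable.
Context {R : realType}.

(** No measure enters and the bound holds everywhere, so the same predicate applies to [T] with a
    smaller sigma-algebra; this is how [bm] expresses adaptedness. *)
Definition bmf {d} {T : measurableType d} (F : T -> R) :=
  measurable_fun setT F /\ exists M, forall w, `|F w| <= M.

Context {d} {T : measurableType d}.
Implicit Types F H : T -> R.

Lemma bmf_bound_gt0 F : bmf F -> exists2 M, 0 < M & forall w, `|F w| <= M.
Proof.
move=> [_ [M FM]]; exists (`|M| + 1); first by rewrite ltr_wpDl.
by move=> w; rewrite (le_trans (FM w))// (le_trans (ler_norm _))// lerDl.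
Qed.

Lemma bmf_cst c : bmf (fun _ : T => c).
Proof. by split; [exact: measurable_cst|exists `|c|]. Qed.

Lemma bmf_indic (A : set T) : measurable A -> bmf (\1_A : T -> R).
Proof.
move=> mA; split; first exact: measurable_indic.
exists 1 => w; rewrite indicE; case: (w \in A); by rewrite ?normr1 ?normr0.
Qed.

Lemma bmfD F H : bmf F -> bmf H -> bmf (fun w => F w + H w).
Proof.
move=> [mF [M FM]] [mH [N HN]]; split; first exact: measurable_funD.
by exists (M + N) => w; rewrite (le_trans (ler_normD _ _))// lerD.
Qed.

Lemma bmfN F : bmf F -> bmf (fun w => - F w).
Proof.
move=> [mF [M FM]]; split; first exact: measurableT_comp.
by exists M => w; rewrite normrN.
Qed.

Lemma bmfB F H : bmf F -> bmf H -> bmf (fun w => F w - H w).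
Proof. by move=> bF bH; apply: bmfD => //; exact: bmfN. Qed.

Lemma bmfM F H : bmf F -> bmf H -> bmf (fun w => F w * H w).
Proof.
move=> [mF [M FM]] [mH [N HN]]; split; first exact: measurable_funM.
by exists (M * N) => w; rewrite normrM ler_pM.
Qed.

Lemma bmfZ c F : bmf F -> bmf (fun w => c * F w).
Proof. by move=> bF; apply: bmfM => //; exact: bmf_cst. Qed.

Lemma bmfX F n : bmf F -> bmf (fun w => F w ^+ n).
Proof.
move=> bF; elim: n => [|n ih]; first exact: bmf_cst.
by under eq_fun do rewrite exprS; exact: bmfM.
Qed.

Lemma bmf_sum (I : Type) (s : seq I) (Q : pred I) (F : I -> T -> R) :
  (forall i, Q i -> bmf (F i)) -> bmf (fun w => \sum_(i <- s | Q i) F i w).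
Proof.
move=> bF; elim: s => [|i s ih].
  by under eq_fun do rewrite big_nil; exact: bmf_cst.
case: (boolP (Q i)) => Qi.
  by under eq_fun do rewrite big_cons Qi; apply: bmfD => //; exact: bF.
by under eq_fun do rewrite big_cons (negbTE Qi).
Qed.

Lemma bmf_cos F : measurable_fun setT F -> bmf (fun w => cos (F w)).
Proof.
move=> mF; split; last by exists 1 => w; rewrite ler_norml cos_geN1 cos_le1.
apply: measurableT_comp mF; apply: continuous_measurable_fun; exact: continuous_cos.
Qed.

Lemma bmf_sin F : measurable_fun setT F -> bmf (fun w => sin (F w)).
Proof.
move=> mF; split; last by exists 1 => w; rewrite ler_norml sin_geN1 sin_le1.
apply: measurableT_comp mF; apply: continuous_measurable_fun; exact: continuous_sin.
Qed.

Lemma bmf_expR F : bmf F -> bmf (fun w => expR (F w)).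
Proof.
move=> [mF [M FM]]; split; first exact: measurableT_comp.
exists (expR M) => w; rewrite ger0_norm ?expR_ge0// ler_expR.
exact: le_trans (ler_norm _) (FM w).
Qed.

(** Functional monotone class argument: sums and multiples of indicators give simple functions,
    bounded pointwise limits give nonnegative functions, and subtracting a constant gives the
    others. *)
Lemma bmf_ind (Q : (T -> R) -> Prop) :
  (forall A, measurable A -> Q \1_A) ->
  (forall F H, bmf F -> bmf H -> Q F -> Q H -> Q (fun w => F w + H w)) ->
  (forall c F, bmf F -> Q F -> Q (fun w => c * F w)) ->
  (forall (u : nat -> T -> R) v (M : R), (forall n, bmf (u n)) -> (forall n, Q (u n)) ->
     (forall n w, `|u n w| <= M) -> bmf v -> (forall w, u n w @[n --> \oo] --> v w) ->
     Q v) ->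
  forall F, bmf F -> Q F.
Proof.
move=> Q1 QD QZ Qlim.
have Qsum (s : seq R) (A : R -> set T) : (forall r, measurable (A r)) ->
    Q (fun w => \sum_(r <- s) r * \1_(A r) w).
  move=> mA; elim: s => [|r s ih].
    rewrite (_ : (fun _ => _) = (fun w => 0 * \1_set0 w)).
      by apply: QZ; [exact: bmf_indic|exact: Q1].
    by apply/funext => w; rewrite big_nil mul0r.
  under eq_fun do rewrite big_cons.
  apply: (QD (fun w => r * \1_(A r) w) _ _ _ _ ih).
  - by apply: bmfZ; exact: bmf_indic.
  - by apply: bmf_sum => i _; apply: bmfZ; exact: bmf_indic.
  - by apply: QZ; [exact: bmf_indic|exact: Q1].
have Qsf (s : {sfun T >-> R}) : Q s.
  rewrite (_ : (s : T -> R) = fun w =>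
      \sum_(y <- finmap.enum_fset (fset_set (range s))) y * \1_(s @^-1` [set y]) w).
    by apply: Qsum => r.
  by apply/funext => w; rewrite fimfunE fsbig_finite.
have Qge0 F : (forall w, 0 <= F w) -> bmf F -> Q F.
  move=> F0 bF; have [mF [M FM]] := bF.
  have mF' : measurable_fun setT (EFin \o F) by exact/measurable_EFinP.
  pose u n : T -> R := nnsfun_approx (@measurableT _ T) mF' n.
  have uF n w : `|u n w| <= F w.
    rewrite ger0_norm//; have := @le_approx _ T R setT (EFin \o F) n w.
    by rewrite -nnsfun_approxE; apply => // x _; rewrite lee_fin.
  apply: (Qlim u F M) => //.
  - move=> n; split; first exact: measurable_funPT.
    by exists M => w; rewrite (le_trans (uF n w))// (le_trans (ler_norm _)).
  - by move=> n; exact: (Qsf (nnsfun_approx (@measurableT _ T) mF' n)).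
  - by move=> n w; rewrite (le_trans (uF n w))// (le_trans (ler_norm _)).
  - move=> w; have H : (EFin \o u ^~ w) n @[n --> \oo] --> (F w)%:E.
      by apply: (@cvg_nnsfun_approx _ T R setT measurableT _ mF') => // x _; rewrite lee_fin.
    exact: (fine_cvg H).
move=> F bF; have [M M0 FM] := bmf_bound_gt0 bF.
have b1 : bmf (fun w => F w + M) by apply: bmfD => //; exact: bmf_cst.
have b2 : bmf (fun w : T => -1 * M) by exact: bmf_cst.
rewrite (_ : F = (fun w => (F w + M) + -1 * M)); last by apply/funext => w; lra.
apply: (QD (fun w => F w + M) _ b1 b2).
  apply: Qge0 => // w; have := FM w; rewrite ler_norml; lra.
by apply: QZ; [exact: bmf_cst|apply: Qge0; [move=> _; exact: ltW|exact: bmf_cst]].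
Qed.

End bounded_measurable.

(** * Taylor bounds for sine, cosine and the exponential *)

Section elementary_inequalities.
Context {R : realType}.
Implicit Types x : R.

(** Each Taylor remainder below has the preceding one as its derivative, so repeated use of this
    lemma raises the order by one each time. *)
Lemma is_derive_ge0 (F F' : R -> R) x : (forall y : R, is_derive y 1 F (F' y)) ->
  (forall y, 0 <= y -> 0 <= F' y) -> 0 <= F 0 -> 0 <= x -> 0 <= F x.
Proof.
move=> dF F'0 F0 x0.
have dF' (y : R) : y \in `]0, x[ -> is_derive y 1 F (F' y) by move=> _; exact: dF.
have cF : {within `[0, x], continuous F}.
  by apply: derivable_within_continuous => y _; have [] := dF y.
have [c] := MVT_segment x0 dF' cF.
rewrite in_itv/= => /andP[c0 _] H; rewrite -(subrK (F 0) (F x)) H.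
by rewrite addr_ge0// mulr_ge0 ?F'0 ?subr0.
Qed.

Lemma sin_le_id x : 0 <= x -> sin x <= x.
Proof.
move=> x0; rewrite -subr_ge0.
apply: (@is_derive_ge0 (fun y : R => y - sin y) (fun y : R => 1 - cos y)) => //.
by rewrite sin0 subr0.
Qed.

Lemma cos_ge_onem_sqr x : 1 - x ^+ 2 / 2 <= cos x.
Proof.
wlog x0 : x / 0 <= x => [H|].
  by have [/H//|/ltW x0] := leP 0 x; have := H (- x); rewrite sqrrN cosN oppr_ge0; exact.
rewrite -subr_ge0.
apply: (@is_derive_ge0 (fun y : R => cos y - (1 - y ^+ 2 / 2)) (fun y : R => y - sin y)) => //.
- move=> y; apply: is_derive_eq; rewrite /GRing.scale/=; lra.
- by move=> y y0; rewrite subr_ge0 sin_le_id.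
- rewrite cos0; lra.
Qed.

Lemma sin_ge_id_cube x : 0 <= x -> x - x ^+ 3 / 6 <= sin x.
Proof.
move=> x0; rewrite -subr_ge0.
apply: (@is_derive_ge0 (fun y : R => sin y - (y - y ^+ 3 / 6)) (fun y : R => cos y - (1 - y ^+ 2 / 2))) => //.
- move=> y; apply: is_derive_eq; rewrite /GRing.scale/=; lra.
- by move=> y y0; rewrite subr_ge0 cos_ge_onem_sqr.
- rewrite sin0; lra.
Qed.

Lemma sin_taylor x : `|sin x - x| <= `|x| ^+ 3.
Proof.
wlog x0 : x / 0 <= x => [H|].
  have [/H//|/ltW x0] := leP 0 x; have := H (- x); rewrite sinN oppr_ge0 normrN.
  by rewrite -opprD normrN; exact.
rewrite (ger0_norm x0) ler_norml; have := sin_le_id x0; have := sin_ge_id_cube x0.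
have : 0 <= x ^+ 3 by rewrite exprn_ge0.
lra.
Qed.

Lemma cos_taylor x : `|cos x - (1 - x ^+ 2 / 2)| <= `|x| ^+ 3.
Proof.
wlog x0 : x / 0 <= x => [H|].
  have [/H//|/ltW x0] := leP 0 x; have := H (- x).
  by rewrite cosN sqrrN oppr_ge0 normrN; exact.
rewrite ger0_norm ?subr_ge0 ?cos_ge_onem_sqr// (ger0_norm x0).
have c1 (y : R) : 0 <= y -> 0 <= y + cos y - 1.
  move=> y0; apply: (@is_derive_ge0 (fun y : R => y + cos y - 1) (fun y : R => 1 - sin y)) => //.
  - move=> z; apply: is_derive_eq; rewrite /GRing.scale/=; lra.
  - rewrite cos0; lra.
have s2 (y : R) : 0 <= y -> 0 <= sin y - y + y ^+ 2 / 2.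
  move=> y0; apply: (@is_derive_ge0 (fun y : R => sin y - y + y ^+ 2 / 2) (fun y : R => y + cos y - 1)) => //.
  - move=> z; apply: is_derive_eq; rewrite /GRing.scale/=; lra.
  - rewrite sin0; lra.
suff : 0 <= 1 - x ^+ 2 / 2 + x ^+ 3 / 6 - cos x.
  have : 0 <= x ^+ 3 by rewrite exprn_ge0.
  lra.
apply: (@is_derive_ge0 (fun y : R => 1 - y ^+ 2 / 2 + y ^+ 3 / 6 - cos y) (fun y : R => sin y - y + y ^+ 2 / 2)) => //.
- move=> z; apply: is_derive_eq; rewrite /GRing.scale/=; lra.
- rewrite cos0; lra.
Qed.

Lemma expRN_taylor x : 0 <= x -> `|expR (- x) - (1 - x)| <= x ^+ 2.
Proof.
move=> x0; have e1 (y : R) : 0 <= expR (- y) - (1 - y).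
  by rewrite subr_ge0; exact: expR_ge1Dx.
rewrite ger0_norm//.
suff : 0 <= 1 - x + x ^+ 2 / 2 - expR (- x).
  have : 0 <= x ^+ 2 by rewrite exprn_ge0.
  lra.
apply: (@is_derive_ge0 (fun y : R => 1 - y + y ^+ 2 / 2 - expR (- y)) (fun y : R => expR (- y) - (1 - y))) => //.
move=> z; apply: is_derive_eq; rewrite /GRing.scale/=; lra.
Qed.

End elementary_inequalities.

Lemma cvg_le_dist {R : realType} {I : Type} {F : set_system I} {FF : Filter F}
    (u : I -> R) l (e : I -> R) :
  (\forall n \near F, `|u n - l| <= e n) -> e n @[n --> F] --> 0 ->
  u n @[n --> F] --> l.
Proof.
move=> ue /cvgrPdist_lt e0; apply/cvgrPdist_lt => eps eps0.
near=> n; rewrite distrC; apply: (@le_lt_trans _ _ (e n)).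
  by near: n.
have : `|0 - e n| < eps by near: n; exact: e0.
by rewrite sub0r normrN; apply: le_lt_trans; exact: ler_norm.
Unshelve. all: by end_near. Qed.

(** * Dominated convergence and expectations with real values *)

Section real_integrals.
Context {R : realType} {d} {T : measurableType d}.

Lemma Rdominated_cvg (mu : {measure set T -> \bar R}) (D : set T)
    (u : nat -> T -> R) (v g : T -> R) :
  measurable D -> (forall n, measurable_fun D (u n)) -> measurable_fun D v ->
  {ae mu, forall x, D x -> u n x @[n --> \oo] --> v x} ->
  mu.-integrable D (EFin \o g) ->
  (forall n x, D x -> `|u n x| <= g x) ->
  \int[mu]_(x in D) u n x @[n --> \oo] --> \int[mu]_(x in D) v x.
Proof.
move=> mD mu_ mv uv ig ug.
have [|||||iv _ cv] := @dominated_convergence _ T R mu D mD (fun n => EFin \o u n) (EFin \o v) (EFin \o g).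
- by move=> n; exact/measurable_EFinP.
- exact/measurable_EFinP.
- by apply: filterS uv => x H Dx; apply: cvg_EFin; [exact: nearW|exact: H].
- exact: ig.
- by apply: aeW => x n Dx; rewrite /= lee_fin ug.
apply: fine_cvg; rewrite fineK//; exact: integrable_fin_num.
Qed.

Context (P : probability T R).
Implicit Types F H : T -> R.

Lemma bmf_integrable F : bmf F -> P.-integrable setT (EFin \o F).
Proof.
move=> [mF [M FM]]; apply: measurable_bounded_integrable => //.
  by rewrite (le_lt_trans (probability_le1 _ _))// ltry.
exists M; split; first exact: num_real.
by move=> x Mx w _ /=; rewrite (le_trans (FM w))// ltW.
Qed.

Lemma Rexpectation_bound F M : bmf F -> (forall w, `|F w| <= M) ->
  `|\int[P]_w F w| <= M.
Proof.
move=> bF FM; apply: (le_trans (le_normr_Rintegral measurableT (bmf_integrable bF))).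
have bM : bmf (fun _ : T => M) by exact: bmf_cst.
have bF' : bmf (fun w => `|F w|).
  split; first by apply: measurableT_comp => //; exact: bF.1.
  by exists M => w; rewrite normr_id.
apply: (le_trans (le_Rintegral measurableT (bmf_integrable bF') (bmf_integrable bM) _)) => //.
by rewrite Rintegral_cst// [X in fine X]probability_setT mulr1.
Qed.

Lemma bounded_cvg (u : nat -> T -> R) v (M : R) : (forall n, bmf (u n)) -> bmf v ->
  {ae P, forall w, u n w @[n --> \oo] --> v w} ->
  (forall n w, `|u n w| <= M) ->
  \int[P]_w u n w @[n --> \oo] --> \int[P]_w v w.
Proof.
move=> bu bv uv uM; apply: (@Rdominated_cvg _ _ _ _ (fun=> M)) => //.
- by move=> n; exact: (bu n).1.
- exact: bv.1.
- by apply: filterS uv => w H _.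
- exact/bmf_integrable/bmf_cst.
Qed.

Lemma RexpD F H : bmf F -> bmf H ->
  \int[P]_w (F w + H w) = \int[P]_w F w + \int[P]_w H w.
Proof. by move=> bF bH; rewrite RintegralD//; exact: bmf_integrable. Qed.

Lemma RexpB F H : bmf F -> bmf H ->
  \int[P]_w (F w - H w) = \int[P]_w F w - \int[P]_w H w.
Proof. by move=> bF bH; rewrite RintegralB//; exact: bmf_integrable. Qed.

Lemma RexpZ c F : bmf F -> \int[P]_w (c * F w) = c * \int[P]_w F w.
Proof. by move=> bF; rewrite RintegralZl//; exact: bmf_integrable. Qed.

Lemma le_Rexp F H : bmf F -> bmf H -> (forall w, F w <= H w) ->
  \int[P]_w F w <= \int[P]_w H w.
Proof. by move=> bF bH FH; apply: le_Rintegral => //; exact: bmf_integrable. Qed.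

Lemma Rexp_cst c : \int[P]_w (c : R) = c.
Proof. by rewrite Rintegral_cst// [X in fine X]probability_setT mulr1. Qed.

End real_integrals.

(** * Characteristic functions of martingale arrays *)

Section martingale_arrays.
Context {R : realType} {d} {T : measurableType d} (P : probability T R).

Definition bm (G : set (set T)) (F : T -> R) := @bmf R _ (g_sigma_algebraType G) F.

Lemma bm_sub (G G' : set (set T)) F : <<s G >> `<=` <<s G' >> -> bm G F -> bm G' F.
Proof.
move=> GG' [mF bF]; split => // mD B mB; apply: GG'.
exact: mF.
Qed.

Lemma bm_bmf (G : set (set T)) F : G `<=` measurable -> bm G F -> bmf F.
Proof.
move=> Gm [mF bF]; split => // mD B mB.
have : <<s G >> `<=` measurable by apply: smallest_sub => //; exact: sigma_algebra_measurable.
by apply; exact: mF.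
Qed.

Section step.
Variables (G : set (set T)) (a v s xi : T -> R) (l th e c : R).
Hypotheses (Gm : G `<=` measurable).
Hypotheses (ba : bm G a) (bv : bm G v) (bs : bm G s) (bxi : bmf xi).
Hypotheses (xie : forall w, `|xi w| <= e) (s0e : forall w, 0 <= s w <= e ^+ 2).
Hypotheses (vsc : forall w, v w + s w <= c).
Hypotheses (xi1 : forall H, bm G H -> \int[P]_w (H w * xi w) = 0).
Hypotheses (xi2 : forall H, bm G H ->
  \int[P]_w (H w * xi w ^+ 2) = \int[P]_w (H w * s w)).

Let W w := expR (l ^+ 2 * (v w + s w) / 2).
Let C w := cos (l * a w + th).
Let S w := sin (l * a w + th).

(* Expanding [cos] and [expR] to second order, the terms in [xi] and in
   [xi ^+ 2 - s] integrate to 0. *)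
Lemma mart_step :
  `| \int[P]_w (cos (l * (a w + xi w) + th) * expR (l ^+ 2 * (v w + s w) / 2)) -
     \int[P]_w (cos (l * a w + th) * expR (l ^+ 2 * v w / 2)) | <=
  expR (l ^+ 2 * c / 2) * (2 * `|l| ^+ 3 * e + l ^+ 4 * e ^+ 2) * \int[P]_w s w.
Proof.
(* [W] contains the conditional variance of the step being taken and is still [G]-measurable. This
   predictability is what makes [C * W] and [S * W] admissible test functions. *)
have bW : bm G W.
  apply: bmf_expR; under eq_fun do rewrite mulrAC.
  by apply: bmfZ; apply: bmfD.
have ba' : measurable_fun setT (fun w : g_sigma_algebraType G => l * a w + th).
  by apply: (bmfD _ (bmf_cst _)).1; exact: bmfZ.
have bC : bm G C by exact: bmf_cos.
have bS : bm G S by exact: bmf_sin.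
have bCW : bm G (fun w => C w * W w) by exact: bmfM.
have bSW : bm G (fun w => S w * W w) by exact: bmfM.
have bW' := bm_bmf Gm bW; have bs' := bm_bmf Gm bs.
have ba'' := bm_bmf Gm ba; have bv' := bm_bmf Gm bv.
have bX : bmf (fun w => cos (l * (a w + xi w) + th) * W w).
  apply: bmfM => //; apply: bmf_cos.
  by apply: (bmfD _ (bmf_cst _)).1; apply: bmfZ; exact: bmfD.
have bY : bmf (fun w => C w * expR (l ^+ 2 * v w / 2)).
  apply: bmfM; first exact: (bm_bmf Gm bC).
  by apply: bmf_expR; under eq_fun do rewrite mulrAC; exact: bmfZ.
have b1 : bmf (fun w => C w * W w * xi w ^+ 2).
  by apply: bmfM; [exact: (bm_bmf Gm bCW)|exact: bmfX].
have b2 : bmf (fun w => C w * W w * s w).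
  by apply: bmfM; [exact: (bm_bmf Gm bCW)|].
have b3 : bmf (fun w => S w * W w * xi w).
  by apply: bmfM; [exact: (bm_bmf Gm bSW)|].
pose Br w := l ^+ 2 / 2 * (C w * W w * s w) - l ^+ 2 / 2 * (C w * W w * xi w ^+ 2)
  - l * (S w * W w * xi w).
have bBr : bmf Br by apply: bmfB; [apply: bmfB|]; exact: bmfZ.
have EBr : \int[P]_w Br w = 0.
  rewrite /Br RexpB//; [|by apply: bmfB; exact: bmfZ|exact: bmfZ].
  rewrite RexpB//; [|exact: bmfZ|exact: bmfZ].
  rewrite !RexpZ// (xi2 bCW) (xi1 bSW); lra.
pose Rm w := cos (l * (a w + xi w) + th) * W w - C w * expR (l ^+ 2 * v w / 2) - Br w.
have bRm : bmf Rm by apply: bmfB => //; exact: bmfB.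
have -> : \int[P]_w (cos (l * (a w + xi w) + th) * expR (l ^+ 2 * (v w + s w) / 2)) -
    \int[P]_w (cos (l * a w + th) * expR (l ^+ 2 * v w / 2)) = \int[P]_w Rm w.
  by rewrite /Rm RexpB ?EBr ?subr0 ?RexpB//; exact: bmfB.
pose B := expR (l ^+ 2 * c / 2).
(* Every error term keeps a factor [xi ^+ 2] or [s], both with the mean of [s]. Summed over the
   steps, the errors then cost the total variance and not the number of steps. The factor 2 counts
   the cubic remainders of [cos] and [sin]. *)
pose Bd w := B * (2 * `|l| ^+ 3 * e) * xi w ^+ 2 + B * (l ^+ 4 * e ^+ 2) * s w.
have bBd : bmf Bd by apply: bmfD; apply: bmfZ => //; exact: bmfX.
have -> : B * (2 * `|l| ^+ 3 * e + l ^+ 4 * e ^+ 2) * \int[P]_w s w = \int[P]_w Bd w.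
  rewrite /Bd RexpD ?RexpZ//; [|by exact: bmfX|by apply: bmfZ; exact: bmfX|exact: bmfZ].
  have := xi2 (bmf_cst 1); under eq_Rintegral do rewrite mul1r.
  by under [X in _ = X -> _]eq_Rintegral do rewrite mul1r; move=> ->; lra.
apply: (le_trans (le_normr_Rintegral measurableT (bmf_integrable P bRm))).
apply: le_Rexp => //.
  split; first by apply: measurableT_comp => //; exact: bRm.1.
  by have [_ [M HM]] := bRm; exists M => w; rewrite normr_id.
move=> w.
set b := l * xi w; set z := l ^+ 2 * s w / 2.
have z0 : 0 <= z by rewrite /z divr_ge0// mulr_ge0 ?sqr_ge0//; have /andP[] := s0e w.
have EW : expR (l ^+ 2 * v w / 2) = W w * expR (- z).
  by rewrite /W -expRD; congr expR; rewrite /z; lra.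
have -> : Rm w = (C w * (cos b - (1 - b ^+ 2 / 2)) - S w * (sin b - b)
     - C w * (expR (- z) - (1 - z))) * W w.
  have Eab : l * (a w + xi w) + th = (l * a w + th) + b by rewrite /b; lra.
  rewrite /Rm EW Eab cosD -/(C w) -/(S w) /Br /b /z; lra.
have WB : `|W w| <= B.
  rewrite ger0_norm ?expR_ge0// /W /B ler_expR ler_pM2r ?invr_gt0//.
  by rewrite ler_wpM2l ?sqr_ge0.
have e0 : 0 <= e by rewrite (le_trans _ (xie w)).
have C1 : `|C w| <= 1 by rewrite ler_norml cos_geN1 cos_le1.
have S1 : `|S w| <= 1 by rewrite ler_norml sin_geN1 sin_le1.
have b3e : `|b| ^+ 3 <= `|l| ^+ 3 * e * xi w ^+ 2.
  rewrite /b normrM exprMn -mulrA ler_wpM2l ?exprn_ge0// exprS -[in leRHS]real_normK ?num_real//.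
  by rewrite ler_wpM2r// sqr_ge0.
have l40 : 0 <= l ^+ 4 by exact: exprn_even_ge0.
have z2e : z ^+ 2 <= l ^+ 4 * e ^+ 2 * s w.
  have /andP[s0 se] := s0e w.
  have -> : z ^+ 2 = l ^+ 4 * (s w * s w) / 4 by rewrite /z; lra.
  have : l ^+ 4 * (s w * s w) <= l ^+ 4 * e ^+ 2 * s w.
    by rewrite -mulrA ler_wpM2l// ler_wpM2r.
  have : 0 <= l ^+ 4 * (s w * s w) by rewrite mulr_ge0// mulr_ge0.
  lra.
rewrite normrM (le_trans (ler_wpM2l _ WB))//.
have -> : Bd w = (2 * (`|l| ^+ 3 * e * xi w ^+ 2) + l ^+ 4 * e ^+ 2 * s w) * B by rewrite /Bd; lra.
rewrite ler_wpM2r ?expR_ge0//.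
have T1 : `|C w * (cos b - (1 - b ^+ 2 / 2))| <= `|b| ^+ 3.
  by rewrite normrM -[leRHS]mul1r ler_pM// cos_taylor.
have T2 : `|S w * (sin b - b)| <= `|b| ^+ 3.
  by rewrite normrM -[leRHS]mul1r ler_pM// sin_taylor.
have T3 : `|C w * (expR (- z) - (1 - z))| <= z ^+ 2.
  by rewrite normrM -[leRHS]mul1r ler_pM// expRN_taylor.
rewrite (le_trans (ler_normB _ _))//.
have := ler_normB (C w * (cos b - (1 - b ^+ 2 / 2))) (S w * (sin b - b)).
lra.
Qed.

End step.

Section array.
Variables (G : nat -> set (set T)).
Hypotheses (Gm : forall k, G k `<=` measurable).
Hypotheses (GS : forall k, <<s G k >> `<=` <<s G k.+1 >>).

(* [e] bounds the increments and [s k] is the conditional variance of [xi k];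
   conditional expectations given [G k] are expressed by integrating against
   bounded [G k]-measurable test functions. *)
Definition martingale_differences (xi s : nat -> T -> R) (e : R) :=
  [/\ forall k, bm (G k.+1) (xi k), forall k, bm (G k) (s k),
      forall k w, `|xi k w| <= e, forall k w, 0 <= s k w <= e ^+ 2 &
      forall k H, bm (G k) H -> \int[P]_w (H w * xi k w) = 0 /\
        \int[P]_w (H w * xi k w ^+ 2) = \int[P]_w (H w * s k w)].

Lemma bm_filtration j k F : (j <= k)%N -> bm (G j) F -> bm (G k) F.
Proof.
move=> jk; apply: bm_sub; elim: k jk => [|k ih]; first by rewrite leqn0 => /eqP ->.
by rewrite leq_eqVlt => /predU1P[->//|]; rewrite ltnS => /ih H A /H; exact: GS.
Qed.

Lemma bm_psum_next (F : nat -> T -> R) n : (forall k, bm (G k.+1) (F k)) ->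
  bm (G n) (fun w => \sum_(0 <= k < n) F k w).
Proof.
move=> bF; elim: n => [|n ih].
  by under eq_fun do rewrite big_nil; exact: bmf_cst.
under eq_fun do rewrite big_nat_recr//=.
by apply: bmfD; [exact: bm_filtration ih|exact: bF].
Qed.

(** Telescoping: step [k] costs a multiple of the mean of [s k], so the total is bounded through [c]
    whatever [n] is, with a factor that vanishes with [e]. *)
Lemma mart_bounded xi s e c l th n : 0 <= c -> martingale_differences xi s e ->
  (forall k w, \sum_(0 <= i < k) s i w <= c) ->
  `| \int[P]_w (cos (l * \sum_(0 <= i < n) xi i w + th) *
      expR (l ^+ 2 * (\sum_(0 <= i < n) s i w) / 2)) - cos th | <=
  expR (l ^+ 2 * c / 2) * (2 * `|l| ^+ 3 * e + l ^+ 4 * e ^+ 2) * c.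
Proof.
move=> c0 [bxi bs xie se xi12] sc.
set K := expR (l ^+ 2 * c / 2) * (2 * `|l| ^+ 3 * e + l ^+ 4 * e ^+ 2).
have e0 : 0 <= e by have := xie 0 point; exact: le_trans.
have K0 : 0 <= K.
  rewrite mulr_ge0 ?expR_ge0// addr_ge0//; last by rewrite mulr_ge0 ?sqr_ge0 ?exprn_even_ge0.
  by rewrite mulr_ge0// mulr_ge0 ?exprn_ge0.
have bs' k : bmf (s k) by exact: bm_bmf (Gm (k := k)) (bs k).
apply: (@le_trans _ _ (K * \int[P]_w \sum_(0 <= i < n) s i w)); last first.
  rewrite ler_wpM2l// -[leRHS](Rexp_cst P) le_Rexp//; last exact: bmf_cst.
  by apply: bmf_sum => i _.
elim: n => [|n ih].
  under eq_Rintegral do rewrite big_nil big_nil !mulr0 mul0r add0r expR0 mulr1.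
  under [X in _ * X]eq_Rintegral do rewrite big_nil.
  by rewrite !Rexp_cst subrr normr0 mulr0.
have bsn : bm (G n) (fun w => \sum_(0 <= i < n) s i w).
  by apply: bm_psum_next => k; apply: bm_filtration (bs k).
have vsc w : \sum_(0 <= i < n) s i w + s n w <= c by rewrite -big_nat_recr.
have := mart_step l th (@Gm n) (bm_psum_next n bxi) bsn (bs n) (bm_bmf (@Gm _) (bxi n))
  (xie n) (se n) vsc (fun H bH => (xi12 n H bH).1) (fun H bH => (xi12 n H bH).2).
rewrite -/K => step.
under eq_Rintegral do rewrite !big_nat_recr//=.
under [X in _ <= _ * X]eq_Rintegral do rewrite big_nat_recr//=.
rewrite RexpD//; last by apply: bmf_sum.
rewrite mulrDr [leRHS]addrC; apply: le_trans (lerD step ih).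
by rewrite -[X in `|X|](subrKA (\int[P]_w (cos (l * (\sum_(0 <= i < n) xi i w) + th) * expR (l ^+ 2 * (\sum_(0 <= i < n) s i w) / 2)))) ler_normD.
Qed.

(** Because the sum of the conditional variances tends to a constant, the exponential weight in
    [mart_bounded] can be replaced by its deterministic limit and divided out. *)
Lemma mart_cos (xi s : nat -> nat -> T -> R) (e : nat -> R) (v l th : R) :
  0 <= v -> e n @[n --> \oo] --> 0 ->
  (forall n, martingale_differences (xi n) (s n) (e n)) ->
  {ae P, forall w, \sum_(0 <= k < n) s n k w @[n --> \oo] --> v} ->
  \int[P]_w cos (l * \sum_(0 <= k < n) xi n k w + th) @[n --> \oo] -->
    expR (- (l ^+ 2 * v / 2)) * cos th.
Proof.
move=> v0 e0 md sv.
(* Any level strictly above [v] would do: along almost every path the stopping is then eventually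
   inactive. *)
pose c := v + 1.
have c0 : 0 <= c by rewrite addr_ge0.
(* Stopping the array just before the sum of the conditional variances exceeds
   [c] makes [mart_bounded] applicable, and changes nothing in the limit. *)
pose chi n k : T -> R := \1_[set w | \sum_(0 <= i < k.+1) s n i w <= c].
(* The sum including [s n k] is already known at time [k], so multiplying [xi n k] by [chi n k]
   preserves the martingale property. *)
have bchi n k : bm (G k) (chi n k).
  apply: (@bmf_indic _ _ (g_sigma_algebraType (G k))).
  rewrite (_ : [set _ | _] = setT `&` (fun w => \sum_(0 <= i < k.+1) s n i w) @^-1` `]-oo, c]); last first.
    by rewrite setTI; apply/seteqP; split => w /=; rewrite in_itv.
  have [_ bs _ _ _] := md n.
  have : bm (G k) (fun w => \sum_(0 <= i < k.+1) s n i w).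
    under eq_fun do rewrite big_nat_recr//=.
    apply: bmfD; last exact: bs.
    by apply: (@bm_psum_next (s n) k) => j; apply: bm_filtration (bs j).
  by move=> [m _]; apply: m => //; exact: measurableT.
have chi01 n k w : chi n k w = 0 \/ chi n k w = 1.
  by rewrite /chi indicE; case: (w \in _); [right|left].
pose xi' n k w := xi n k w * chi n k w.
pose s' n k w := s n k w * chi n k w.
have md' n : martingale_differences (xi' n) (s' n) (e n).
  have [bxi bs xie se xi12] := md n; split.
  - by move=> k; apply: bmfM; [exact: bxi|exact: (@bm_filtration k k.+1 _ (leqnSn k) (bchi n k))].
  - by move=> k; apply: bmfM; [exact: bs|exact: bchi].
  - move=> k w; rewrite /xi'; case: (chi01 n k w) => ->; rewrite ?mulr1 ?mulr0 ?normr0//.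
    exact: le_trans (xie k w).
  - move=> k w; rewrite /s'; case: (chi01 n k w) => ->; rewrite ?mulr1 ?mulr0//.
    by rewrite lexx sqr_ge0.
  - move=> k H bH; have bHc : bm (G k) (fun w => H w * chi n k w).
      by apply: bmfM; [exact: bH|exact: bchi].
    have [h1 h2] := xi12 k _ bHc; split.
      by rewrite -[RHS]h1; apply: eq_Rintegral => w _; rewrite /xi' mulrA mulrAC.
    transitivity (\int[P]_w (H w * chi n k w * xi n k w ^+ 2)).
      apply: eq_Rintegral => w _; rewrite /xi' -mulrA; congr (_ * _).
      by case: (chi01 n k w) => ->; rewrite ?mulr0 ?mul0r ?mulr1 ?mul1r ?expr0n.
    by rewrite h2; apply: eq_Rintegral => w _; rewrite /s' mulrA mulrAC.
have s_ge0 n k w : 0 <= s n k w by have [_ _ _ se _] := md n; have /andP[] := se k w.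
have sc n k w : \sum_(0 <= i < k) s' n i w <= c.
  elim: k => [|k ih]; first by rewrite big_nil.
  rewrite big_nat_recr//= {2}/s' /chi indicE.
  have [|_] := boolP (w \in _); last by rewrite mulr0 addr0.
  rewrite inE /= mulr1 => H; apply: le_trans H; rewrite big_nat_recr//= lerD2r.
  apply: ler_sum => i _; rewrite /s'; case: (chi01 n i w) => ->; by rewrite ?mulr1 ?mulr0.
have chi1 n w : \sum_(0 <= i < n) s n i w <= c -> forall k, (k < n)%N -> chi n k w = 1.
  move=> H k kn; rewrite /chi indicE mem_set//=; apply: le_trans H.
  by rewrite [leRHS](big_cat_nat (n := k.+1))//= lerDl sumr_ge0.
have bnd n := mart_bounded l th n c0 (md' n) (sc n).
pose Z n := \int[P]_w (cos (l * \sum_(0 <= i < n) xi' n i w + th) *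
      expR (l ^+ 2 * (\sum_(0 <= i < n) s' n i w) / 2)).
have Zcvg : Z n @[n --> \oo] --> cos th.
  apply: (@cvg_le_dist _ _ _ _ Z _ (fun n => expR (l ^+ 2 * c / 2) *
    (2 * `|l| ^+ 3 * e n + l ^+ 4 * e n ^+ 2) * c)); first by apply: nearW; exact: bnd.
  rewrite -[X in _ --> X](mul0r c) -[X in _ --> X * c](mulr0 (expR (l ^+ 2 * c / 2))).
  apply: cvgMl; apply: cvgMr.
  rewrite -[X in _ --> X]addr0 -[X in _ --> X + _](mulr0 (2 * `|l| ^+ 3)).
  rewrite -[X in _ --> _ + X](mulr0 (l ^+ 4)).
  apply: cvgD; first exact: cvgMr.
  apply: cvgMr; rewrite -[X in _ --> X](mulr0 0).
  by under eq_cvg do rewrite expr2; exact: cvgM.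
have bS n : bmf (fun w => \sum_(0 <= k < n) xi n k w).
  by apply: bmf_sum => k _; have [bxi _ _ _ _] := md n; exact: bm_bmf (bxi k).
have bS' n : bmf (fun w => \sum_(0 <= k < n) xi' n k w).
  by apply: bmf_sum => k _; have [bxi _ _ _ _] := md' n; exact: bm_bmf (bxi k).
have bV' n : bmf (fun w => \sum_(0 <= k < n) s' n k w).
  by apply: bmf_sum => k _; have [_ bs _ _ _] := md' n; exact: bm_bmf (bs k).
(* [D n] tends to 0 almost surely and is bounded, hence tends to 0 in mean; what it subtracts has
   mean a constant times [Z n], whose limit is known. *)
pose D n w := cos (l * \sum_(0 <= k < n) xi n k w + th) -
  expR (- (l ^+ 2 * v / 2)) * (cos (l * \sum_(0 <= i < n) xi' n i w + th) *
      expR (l ^+ 2 * (\sum_(0 <= i < n) s' n i w) / 2)).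
have b1 n : bmf (fun w => cos (l * \sum_(0 <= k < n) xi n k w + th)).
  by apply: bmf_cos; apply: (bmfD _ (bmf_cst _)).1; exact: bmfZ.
have b2 n : bmf (fun w => cos (l * \sum_(0 <= i < n) xi' n i w + th) *
      expR (l ^+ 2 * (\sum_(0 <= i < n) s' n i w) / 2)).
  apply: bmfM; first by apply: bmf_cos; apply: (bmfD _ (bmf_cst _)).1; exact: bmfZ.
  by apply: bmf_expR; under eq_fun do rewrite mulrAC; exact: bmfZ.
have bD n : bmf (D n) by apply: bmfB => //; exact: bmfZ.
have Dcvg : \int[P]_w D n w @[n --> \oo] --> (0 : R).
  rewrite -(Rexp_cst P 0).
  apply: (@bounded_cvg _ _ _ P D (fun=> 0) (1 + expR (l ^+ 2 * c / 2))) => //; first exact: bmf_cst.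
    apply: filterS sv => w /= svw.
    pose q n := expR (- (l ^+ 2 * v / 2)) * expR (l ^+ 2 * (\sum_(0 <= k < n) s n k w) / 2).
    have qcvg : `|1 - q n| @[n --> \oo] --> (0 : R).
      rewrite -[X in _ --> X](@normr0 _ R); apply: cvg_norm.
      rewrite -[X in _ --> X](subrr (1 : R)); apply: cvgB; first exact: cvg_cst.
      rewrite -[X in _ --> X](mulVf (lt0r_neq0 (expR_gt0 (l ^+ 2 * v / 2)))) -expRN.
      apply: cvgMr; apply: continuous_cvg; first exact: continuous_expR.
      by apply: cvgMl; exact: cvgMr.
    apply: cvg_le_dist qcvg.
    have : \forall n \near \oo, \sum_(0 <= k < n) s n k w < c.
      by apply: (cvgr_lt v svw); rewrite /c ltrDl.
    apply: filterS => n /ltW /chi1 c1; rewrite subr0 /D /q.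
    have -> : \sum_(0 <= k < n) xi' n k w = \sum_(0 <= k < n) xi n k w.
      by apply: eq_big_nat => k /andP[_ kn]; rewrite /xi' c1// mulr1.
    have -> : \sum_(0 <= k < n) s' n k w = \sum_(0 <= k < n) s n k w.
      by apply: eq_big_nat => k /andP[_ kn]; rewrite /s' c1// mulr1.
    rewrite mulrCA -[X in X - _]mulr1 -mulrBr normrM -[leRHS]mul1r ler_wpM2r//.
    by rewrite ler_norml cos_geN1 cos_le1.
  move=> n w; rewrite /D (le_trans (ler_normB _ _))// lerD//.
    by rewrite ler_norml cos_geN1 cos_le1.
  rewrite -[leRHS]mul1r normrM ler_pM//.
    by rewrite ger0_norm ?expR_ge0// -expR0 ler_expR oppr_le0 divr_ge0// mulr_ge0 ?sqr_ge0.
  rewrite normrM -[leRHS]mul1r ler_pM//; first by rewrite ler_norml cos_geN1 cos_le1.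
  by rewrite ger0_norm ?expR_ge0// ler_expR ler_pM2r ?invr_gt0// ler_wpM2l ?sqr_ge0.
have -> : (fun n => \int[P]_w cos (l * \sum_(0 <= k < n) xi n k w + th)) =
  (fun n => \int[P]_w D n w + expR (- (l ^+ 2 * v / 2)) * Z n).
  apply/funext => n; rewrite /D RexpB//; last exact: bmfZ.
  by rewrite RexpZ// subrK.
rewrite -[X in _ --> X]add0r; apply: cvgD => //; exact: cvgMr.
Qed.

End array.
End martingale_arrays.

(** * Conditional densities *)

Section weighted_averages.
Context {R : realType}.
Notation leb := (@lebesgue_measure R).
Implicit Types rho k : R -> R.

(** Mass at most 1, not exactly 1, so that the zero function qualifies: it is the value of
    [trunc_density] on the exceptional set. *)
Definition subdensity rho := [/\ measurable_fun setT rho, forall y, 0 <= rho y &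
  (\int[leb]_y (rho y)%:E <= 1)%E].

Definition avg rho k := \int[leb]_y (k y * rho y).

Lemma subdensity_integrable rho : subdensity rho ->
  leb.-integrable setT (EFin \o rho).
Proof.
move=> [m r0 r1]; apply/integrableP; split; first exact/measurable_EFinP.
under eq_integral do rewrite /= ger0_norm//.
by rewrite (le_lt_trans r1)// ltry.
Qed.

Lemma avg_integrable rho k : subdensity rho -> bmf k ->
  leb.-integrable setT (fun y => (k y * rho y)%:E).
Proof.
move=> sr bk; have [M M0 kM] := bmf_bound_gt0 bk; have [mr r0 _] := sr.
apply: (@le_integrable _ _ _ leb _ measurableT _ (EFin \o (fun y => (M * rho y)))).
- by apply/measurable_EFinP; apply: measurable_funM => //; exact: bk.1.
- by move=> y _; rewrite /= lee_fin !normrM (ger0_norm (ltW M0)) ler_wpM2r.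
- exact: (integrableZl measurableT M (subdensity_integrable sr)).
Qed.

Lemma mass_le1 rho : subdensity rho -> 0 <= \int[leb]_y rho y <= 1.
Proof.
move=> sr; have [_ r0 r1] := sr; apply/andP; split; first by apply: Rintegral_ge0.
rewrite /Rintegral -lee_fin fineK//; apply: integrable_fin_num => //.
exact: subdensity_integrable.
Qed.

Lemma avgD rho k k' : subdensity rho -> bmf k -> bmf k' ->
  avg rho (fun y => k y + k' y) = avg rho k + avg rho k'.
Proof.
move=> sr bk bk'; rewrite /avg -RintegralD//; [|exact: avg_integrable..].
by apply: eq_Rintegral => y _; rewrite mulrDl.
Qed.

Lemma avgZ rho k c : subdensity rho -> bmf k ->
  avg rho (fun y => c * k y) = c * avg rho k.
Proof.
move=> sr bk; rewrite /avg -RintegralZl//; last exact: avg_integrable.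
by apply: eq_Rintegral => y _; rewrite mulrA.
Qed.

Lemma avg_cst rho c : subdensity rho -> avg rho (fun=> c) = c * \int[leb]_y rho y.
Proof. by move=> sr; rewrite /avg RintegralZl//; exact: subdensity_integrable. Qed.

Lemma le_avg rho k k' : subdensity rho -> bmf k -> bmf k' ->
  (forall y, 0 < rho y -> k y <= k' y) -> avg rho k <= avg rho k'.
Proof.
move=> sr bk bk' kk'; apply: le_Rintegral => //; [exact: avg_integrable..|].
move=> y _; have [_ r0 _] := sr; have := r0 y; rewrite le_eqVlt => /predU1P[<-|ry].
  by rewrite !mulr0.
by rewrite ler_pM2r// kk'.
Qed.

Lemma avg_ge0 rho k : subdensity rho -> (forall y, 0 <= k y) -> 0 <= avg rho k.
Proof. by move=> [_ r0 _] k0; apply: Rintegral_ge0 => y _; rewrite mulr_ge0. Qed.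

Lemma avg_bound rho k M : subdensity rho -> bmf k -> 0 <= M ->
  (forall y, 0 < rho y -> `|k y| <= M) -> `|avg rho k| <= M.
Proof.
move=> sr bk M0 kM; have /andP[m0 m1] := mass_le1 sr.
have cM := bmf_cst M; have cNM := bmf_cst (- M).
have MM : M * \int[leb]_y rho y <= M by rewrite -[leRHS]mulr1 ler_wpM2l.
rewrite ler_norml; apply/andP; split.
  apply: (@le_trans _ _ (avg rho (fun=> - M))); first by rewrite avg_cst// mulNr lerN2.
  by apply: le_avg => // y /kM; rewrite ler_norml => /andP[].
apply: (@le_trans _ _ (avg rho (fun=> M))); last by rewrite avg_cst.
by apply: le_avg => // y /kM; rewrite ler_norml => /andP[].
Qed.

Lemma avg_cvg rho (u : nat -> R -> R) k M : subdensity rho -> (forall n, bmf (u n)) ->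
  bmf k -> (forall n y, `|u n y| <= M) -> (forall y, u n y @[n --> \oo] --> k y) ->
  avg rho (u n) @[n --> \oo] --> avg rho k.
Proof.
move=> sr bu bk uM uk; have [mr r0 _] := sr.
rewrite /avg; apply: (@Rdominated_cvg _ _ _ leb _ _ _ (fun y => M * rho y)) => //.
- by move=> n; apply: measurable_funM => //; exact: (bu n).1.
- by apply: measurable_funM => //; exact: bk.1.
- by apply: aeW => y _; apply: cvgMl; exact: uk.
- exact: (integrableZl measurableT M (subdensity_integrable sr)).
- by move=> n y _; rewrite normrM (ger0_norm (r0 y)) ler_wpM2r.
Qed.

(* From [avg rho ((k - avg rho k)^2) >= 0] and total mass at most 1. *)
Lemma avg_sqr_le rho k : subdensity rho -> bmf k ->
  avg rho k ^+ 2 <= avg rho (fun y => k y ^+ 2).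
Proof.
move=> sr bk; set m := avg rho k; have bm_ := bmf_cst m.
have b2 : bmf (fun y => k y ^+ 2) by exact: bmfX.
have : 0 <= avg rho (fun y => (k y - m) ^+ 2) by apply: avg_ge0 => // y; exact: sqr_ge0.
have -> : (fun y => (k y - m) ^+ 2) =
    (fun y => k y ^+ 2 + (- 2 * m * k y + m ^+ 2)) by apply/funext => y; lra.
have bz := bmfZ (- 2 * m) bk.
rewrite avgD//; last by apply: bmfD => //; exact: bmf_cst.
rewrite avgD//; last exact: bmf_cst.
rewrite avgZ// avg_cst// -/m.
have /andP[m0 m1] := mass_le1 sr; have := ler_wpM2l (sqr_ge0 m) m1; lra.
Qed.

Lemma subdensity0 : subdensity (fun=> 0).
Proof. by split => //; rewrite integral0. Qed.

Lemma avg0 k : avg (fun=> 0) k = 0.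
Proof.
rewrite /avg; under eq_Rintegral do rewrite mulr0.
by rewrite /Rintegral integral0.
Qed.

End weighted_averages.

(** * Conditional expectations read off a conditional density *)

Section conditional_density.
Context {R : realType} {d} {T : measurableType d} (P : probability T R).
Notation leb := (@lebesgue_measure R).
Notation Rp := (`[0, +oo[%classic : set R).
Variables (G : set (set T)) (U : T -> R) (g : T -> R -> R).
Hypotheses (Gm : G `<=` measurable) (mU : measurable_fun setT U).
Hypotheses (U0 : forall w, 0 <= U w) (gd : is_conditional_density P G U g).

Lemma measurable_coarser dd (T' : measurableType dd) (F : T -> T') :
  measurable_fun (setT : set (g_sigma_algebraType G)) F -> measurable_fun setT F.
Proof.
move=> mF mD B mB.
have : <<s G >> `<=` measurable by apply: smallest_sub => //; exact: sigma_algebra_measurable.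
by apply; exact: mF.
Qed.

Definition mass w := (\int[leb]_(y in Rp) (g w y)%:E)%E.
(* A conditional density has mass at most 1 only almost surely; [trunc_density]
   is set to 0 where it fails, and is restricted to [0, +oo[. *)
Definition good := [set w | (mass w <= 1)%E].
Definition trunc_density w y := \1_good w * (g w y * \1_Rp y).

Let h0 : measurable Rp. Proof. exact: measurable_itv. Qed.

Lemma mg0 : measurable_fun (setT : set (g_sigma_algebraType G * R)%type)
  (fun z => g z.1 z.2 * \1_Rp z.2).
Proof.
have [mg _ _] := gd; apply: measurable_funM => //.
by apply: measurableT_comp => //; exact: measurable_indic.
Qed.

Lemma g0_ge0 w y : 0 <= g w y * \1_Rp y.
Proof.
have [_ g0 _] := gd; rewrite indicE; have [|_] := boolP (y \in Rp); last by rewrite mulr0.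
by rewrite inE/= in_itv/= andbT mulr1 => /g0.
Qed.

Lemma massE w : mass w = (\int[leb]_y (g w y * \1_Rp y)%:E)%E.
Proof.
rewrite /mass integral_mkcond; apply: eq_integral => y _.
by rewrite epatch_indic.
Qed.

Lemma measurable_mass : measurable_fun (setT : set (g_sigma_algebraType G)) mass.
Proof.
rewrite (funext massE).
have := @measurable_fun_fubini_tonelli_F _ _ (g_sigma_algebraType G) _ R leb
  (fun z => (g z.1 z.2 * \1_Rp z.2)%:E).
apply.
  by apply/measurable_EFinP; exact: mg0.
by move=> z; rewrite lee_fin g0_ge0.
Qed.

Lemma measurable_good : <<s G >> good.
Proof.
have := measurable_mass; move=> /(_ measurableT _ (emeasurable_itv `]-oo, 1%E])).
by rewrite setTI /good; congr (<<s G >> _); apply/seteqP; split => w; rewrite /= in_itv.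
Qed.

Lemma trunc_density_subdensity w : subdensity (trunc_density w).
Proof.
have [gamma_weight|gamma_weight] := pselect (good w); last first.
  suff -> : trunc_density w = fun=> 0 by exact: subdensity0.
  by apply/funext => y; rewrite /trunc_density indicE memNset// mul0r.
have -> : trunc_density w = fun y => g w y * \1_Rp y.
  by apply/funext => y; rewrite /trunc_density indicE mem_set// mul1r.
split; last by rewrite -massE.
- exact: measurable_fun_pair2 mg0.
- by move=> y; exact: g0_ge0.
Qed.

(** The exceptional event belongs to the sigma-algebra, so the defining identity with [B] the
    half-line equates its probability with the integral of [mass] over it. As [mass] exceeds 1
    there, the event is null. *)
Lemma ae_good : {ae P, forall w, good w}.
Proof.
have [_ g0 gP] := gd.
have mA : <<s G >> (~` good).
  by rewrite -setTD; apply: sigma_algebraCD; exact: measurable_good.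
have mA' : measurable (~` good).
  have : <<s G >> `<=` measurable by apply: smallest_sub => //; exact: sigma_algebra_measurable.
  exact.
have PA : P (~` good) = (\int[P]_(w in ~` good) mass w)%E.
  have := gP (~` good) Rp mA h0 (@subset_refl _ _).
  by rewrite (_ : U @^-1` Rp = setT) ?setIT//; apply/seteqP; split => w //= _; rewrite in_itv/= andbT.
have mm : measurable_fun (~` good) mass by apply: measurable_funTS; exact: measurable_coarser measurable_mass.
have mass0 w : (0 <= mass w)%E.
  by apply: integral_ge0 => y; rewrite /= in_itv/= andbT lee_fin; exact: g0.
have im : P.-integrable (~` good) mass.
  apply/integrableP; split => //; under eq_integral do rewrite gee0_abs//.
  by rewrite -PA (le_lt_trans (probability_le1 _ _))// ltry.
have i1 : P.-integrable (~` good) (fun=> 1%:E).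
  apply: finite_measure_integrable_cst => //.
have E0 : (\int[P]_(w in ~` good) (mass w - 1) = 0)%E.
  rewrite (integralB mA' im i1) -PA integral_cst// mul1e subee//.
  by rewrite fin_num_measure.
have gt1 w : (~` good) w -> (1 < mass w)%E by move=> /negP; rewrite -ltNge.
have : (\int[P]_(w in ~` good) `|mass w - 1| = 0)%E.
  rewrite -[RHS]E0; apply: eq_integral => w; rewrite inE => Aw.
  by rewrite gee0_abs// sube_ge0// ltW// gt1.
move=> /(ae_eq_integral_abs P mA' _).1 H.
have {H}/H : measurable_fun (~` good) (fun w => mass w - 1)%E.
  by apply: emeasurable_funB => //; exact: measurable_cst.
apply: filterS => w H; apply: contrapT => nw.
have E : (mass w - 1 = 0)%E by exact: H nw.
by have := gt1 w nw; rewrite -sube_gt0 E ltxx.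
Qed.

(** An explicit version of the conditional expectation of [k (U w)], defined, bounded and measurable
    at every [w]; [cexp_bm] is its characteristic property. *)
Definition cexp k w := avg (trunc_density w) k.

Lemma measurable_integral_g k : bmf k -> (forall y, 0 <= k y) ->
  measurable_fun (setT : set (g_sigma_algebraType G))
    (fun w => \int[leb]_y (k y * (g w y * \1_Rp y))%:E)%E.
Proof.
move=> bk k0.
have := @measurable_fun_fubini_tonelli_F _ _ (g_sigma_algebraType G) _ R leb
  (fun z => (k z.2 * (g z.1 z.2 * \1_Rp z.2))%:E).
apply.
  apply/measurable_EFinP; apply: measurable_funM; last exact: mg0.
  by apply: measurableT_comp => //; exact: bk.1.
by move=> z; rewrite lee_fin mulr_ge0// g0_ge0.
Qed.

Lemma cexpE k w : cexp k w = \1_good w * fine (\int[leb]_y (k y * (g w y * \1_Rp y))%:E)%E.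
Proof.
rewrite /cexp /trunc_density indicE; have [|] := boolP (w \in _) => _.
  rewrite mul1r /avg /Rintegral; congr fine.
  by apply: eq_integral => y _; rewrite mul1r.
rewrite mul0r -[RHS](avg0 k) /avg.
by apply: eq_Rintegral => y _; rewrite mul0r.
Qed.

(** Tonelli gives measurability for nonnegative integrands only; adding the bound [M] to [k] reduces
    to that case. *)
Lemma bm_cexp k : bmf k -> bm G (cexp k).
Proof.
move=> bk; have [M M0 kM] := bmf_bound_gt0 bk.
split; last first.
  exists M => w; apply: avg_bound => //; last exact: ltW.
  exact: trunc_density_subdensity.
have pos k' : bmf k' -> (forall y, 0 <= k' y) ->
    measurable_fun (setT : set (g_sigma_algebraType G)) (cexp k').
  move=> bk' k'0; rewrite (funext (cexpE k')); apply: measurable_funM.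
    by apply: measurable_indic; exact: measurable_good.
  by apply: measurableT_comp => //; exact: measurable_integral_g.
have b1 : bmf (fun y => k y + M) by apply: bmfD => //; exact: bmf_cst.
have bM := @bmf_cst R _ R (- M).
have -> : cexp k = fun w => cexp (fun y => k y + M) w + -1 * cexp (fun=> M) w.
  apply/funext => w; rewrite /cexp; have sw := trunc_density_subdensity w.
  rewrite avgD//; [lra|exact: bmf_cst].
apply: measurable_funD; first by apply: pos => // y; have := kM y; rewrite ler_norml; lra.
apply: measurable_funM => //; apply: pos => //; first exact: bmf_cst.
by move=> y; exact: ltW.
Qed.

(** Two cuts have to be harmless: restricting [B] to the half-line does not change the event since
    [U] is nonnegative, and truncating the density does not change the integral since [good] holds
    almost surely. *)
Lemma cexp_indic A B : <<s G >> A -> measurable B ->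
  \int[P]_w (\1_A w * \1_B (U w)) = \int[P]_w (\1_A w * cexp \1_B w).
Proof.
move=> mA mB; have [_ g0 gP] := gd.
have mA' : measurable A.
  have : <<s G >> `<=` measurable by apply: smallest_sub => //; exact: sigma_algebra_measurable.
  exact.
have mUB : measurable (U @^-1` B) by rewrite -[X in measurable X]setTI; exact: mU.
have := gP A (B `&` Rp) mA (measurableI _ _ mB h0) (@subIsetr _ _ _).
rewrite (_ : U @^-1` (B `&` Rp) = U @^-1` B); last first.
  apply/seteqP; split => w /=; first by case.
  by move=> Bw; split => //; rewrite in_itv/= andbT.
move=> HP; rewrite /Rintegral; congr fine.
transitivity (P (A `&` U @^-1` B)).
  rewrite -[A `&` _]setTI setTI -(setIT (A `&` _)) -integral_indic//; last exact: measurableI.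
  by apply: eq_integral => w _; rewrite indicI.
rewrite HP [LHS]integral_mkcond; apply: ae_eq_integral => //.
- apply/(measurable_restrictT _ mA'); apply: measurable_funTS.
  rewrite (_ : (fun w => _) = (fun w => \int[leb]_y (\1_B y * (g w y * \1_Rp y))%:E)%E).
    by apply: measurable_coarser; apply: measurable_integral_g => //; exact: bmf_indic.
  apply/funext => w; rewrite [LHS]integral_mkcond; apply: eq_integral => y _.
  by rewrite epatch_indic/= indicI -EFinM; congr EFin; rewrite /=; lra.
- apply/measurable_EFinP; apply: measurable_funM; first exact: measurable_indic.
  by apply: measurable_coarser; exact: (bm_cexp (bmf_indic mB)).1.
have := ae_good; apply: filterS => w gamma_weight _.
rewrite epatch_indic/= muleC EFinM; congr (_ * _)%E.
rewrite /cexp /avg /Rintegral fineK; last first.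
  apply: integrable_fin_num => //; apply: avg_integrable; last exact: bmf_indic.
  exact: trunc_density_subdensity.
rewrite [LHS]integral_mkcond; apply: eq_integral => y _.
have g1 : (\1_good w : R) = 1 by rewrite indicE mem_set.
rewrite epatch_indic/= /trunc_density indicI g1 mul1r -EFinM.
by congr EFin; rewrite /=; lra.
Qed.

Lemma bmf_cexp k : bmf k -> bmf (cexp k).
Proof. by move=> bk; exact: bm_bmf Gm (bm_cexp bk). Qed.

Lemma bmf_compU (k : R -> R) : bmf k -> bmf (fun w => k (U w)).
Proof.
move=> [mk [M kM]]; split; first exact: measurableT_comp.
by exists M => w; exact: kM.
Qed.

Lemma cexp_set A (k : R -> R) : <<s G >> A -> bmf k ->
  \int[P]_w (\1_A w * k (U w)) = \int[P]_w (\1_A w * cexp k w).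
Proof.
move=> mA.
have mA' : measurable A.
  have : <<s G >> `<=` measurable by apply: smallest_sub => //; exact: sigma_algebra_measurable.
  exact.
have b1 := bmf_indic mA'.
have sw := trunc_density_subdensity.
move: k; apply: bmf_ind.
- by move=> B mB; exact: cexp_indic.
- move=> k k' bk bk' Ek Ek'.
  under eq_Rintegral do rewrite mulrDr.
  under [RHS]eq_Rintegral do rewrite /cexp avgD// mulrDr.
  rewrite RexpD ?RexpD ?Ek ?Ek'//; apply: bmfM => //; [exact: bmf_cexp|exact: bmf_cexp|exact: bmf_compU..].
- move=> c k bk Ek.
  under eq_Rintegral do rewrite mulrCA.
  under [RHS]eq_Rintegral do rewrite /cexp avgZ// mulrCA.
  rewrite RexpZ ?RexpZ ?Ek//; apply: bmfM => //; [exact: bmf_cexp|exact: bmf_compU].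
move=> u v M bu Eu uM bv uv.
have c1 : \int[P]_w (\1_A w * u n (U w)) @[n --> \oo] --> \int[P]_w (\1_A w * v (U w)).
  apply: (@bounded_cvg _ _ _ P _ _ M).
  - by move=> n; apply: bmfM => //; exact: bmf_compU.
  - by apply: bmfM => //; exact: bmf_compU.
  - by apply: aeW => w; apply: cvgMr; exact: uv.
  - move=> n w; rewrite normrM -[leRHS]mul1r ler_pM//.
    by rewrite indicE; case: (w \in A); rewrite ?normr1 ?normr0.
have c2 : \int[P]_w (\1_A w * cexp (u n) w) @[n --> \oo] --> \int[P]_w (\1_A w * cexp v w).
  apply: (@bounded_cvg _ _ _ P _ _ M).
  - by move=> n; apply: bmfM => //; exact: bmf_cexp.
  - by apply: bmfM => //; exact: bmf_cexp.
  - by apply: aeW => w; apply: cvgMr; exact: avg_cvg (sw w) bu bv uM uv.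
  - move=> n w; rewrite normrM -[leRHS]mul1r ler_pM//.
      by rewrite indicE; case: (w \in A); rewrite ?normr1 ?normr0.
    apply: avg_bound => //; exact: le_trans (uM n point).
move: c1; under eq_cvg do rewrite Eu; move=> c1.
by rewrite -(cvg_lim _ c1)// -(cvg_lim _ c2).
Qed.

(** A second monotone class induction, in the test function; [cexp_set] made the first one, in [k]
    with the event fixed. *)
Lemma cexp_bm (H : T -> R) (k : R -> R) : bm G H -> bmf k ->
  \int[P]_w (H w * k (U w)) = \int[P]_w (H w * cexp k w).
Proof.
move=> bH bk; have bU := bmf_compU bk; have bc := bmf_cexp bk.
apply: (@bmf_ind _ _ (g_sigma_algebraType G) (fun H : T -> R =>
  \int[P]_w (H w * k (U w)) = \int[P]_w (H w * cexp k w)) _ _ _ _ H bH) => {H bH}.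
- by move=> A mA; exact: cexp_set.
- move=> F H bF bH EF EH.
  have {}bF := bm_bmf Gm bF; have {}bH := bm_bmf Gm bH.
  under eq_Rintegral do rewrite mulrDl.
  under [RHS]eq_Rintegral do rewrite mulrDl.
  by rewrite RexpD ?RexpD ?EF ?EH//; apply: bmfM.
- move=> c F bF EF; have {}bF := bm_bmf Gm bF.
  under eq_Rintegral do rewrite -mulrA.
  under [RHS]eq_Rintegral do rewrite -mulrA.
  by rewrite RexpZ ?RexpZ ?EF//; apply: bmfM.
move=> u v M bu Eu uM bv uv.
have {}bu n := bm_bmf Gm (bu n); have {}bv := bm_bmf Gm bv.
have lim (F : T -> R) : bmf F ->
    \int[P]_w (u n w * F w) @[n --> \oo] --> \int[P]_w (v w * F w).
  move=> bF; have [N FN] := bF.2; apply: (@bounded_cvg _ _ _ P _ _ (M * N)).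
  - by move=> n; exact: bmfM.
  - exact: bmfM.
  - by apply: aeW => w; apply: cvgMl; exact: uv.
  - by move=> n w; rewrite normrM ler_pM.
have c1 := lim _ bU; have c2 := lim _ bc.
move: c1; under eq_cvg do rewrite Eu; move=> c1.
by rewrite -(cvg_lim _ c1)// -(cvg_lim _ c2).
Qed.

End conditional_density.

(** * From characteristic functions to convergence in distribution *)

Section fundamental_theorem.
Context {R : realType}.
Notation leb := (@lebesgue_measure R).
Implicit Types (f F : R -> R) (D : set R).

Lemma Rintegral_cvg_set D (A : nat -> set R) f : measurable D ->
  leb.-integrable D (EFin \o f) -> (forall n, measurable (A n)) ->
  (forall n, A n `<=` D) -> (forall y, D y -> \forall n \near \oo, A n y) ->
  \int[leb]_(y in A n) f y @[n --> \oo] --> \int[leb]_(y in D) f y.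
Proof.
move=> mD fD mA AD cA.
have mf : measurable_fun D f by have /integrableP[/measurable_EFinP] := fD.
have E n : \int[leb]_(y in A n) f y = \int[leb]_(y in D) (f y * \1_(A n) y).
  rewrite -[in LHS](setIidr (AD n)) Rintegral_mkcondr.
  by apply: eq_Rintegral => y _; rewrite patch_indic.
under eq_cvg do rewrite E.
apply: (@Rdominated_cvg _ _ _ leb _ _ _ (fun y => `|f y|)) => //.
- move=> n; apply: measurable_funM; first exact: mf.
  by apply: measurable_indic; exact: mA.
- apply: aeW => y Dy; apply: cvg_near_cst; have := cA y Dy; apply: filterS => n An.
  by rewrite indicE mem_set// mulr1.
- exact: (integrable_norm fD).
- move=> n y Dy; rewrite normrM ler_piMr// indicE.
  by case: (y \in A n); rewrite /= ?normr1 ?normr0 ?lexx ?ler01.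
Qed.

Lemma Rintegral_derive0 f F : (forall y : R, is_derive y 1 F (f y)) ->
  continuous f -> leb.-integrable setT (EFin \o f) ->
  F y @[y --> +oo] --> 0 -> F y @[y --> -oo] --> 0 ->
  \int[leb]_y f y = 0.
Proof.
move=> dF cf intf Fy FNy.
(* The endpoints use [n.+1] so that no interval is degenerate, as the fundamental theorem of
   calculus on a segment requires. *)
have h1 : \int[leb]_(y in `[- n.+1%:R, n.+1%:R]) f y @[n --> \oo] --> \int[leb]_y f y.
  apply: Rintegral_cvg_set => //= y _.
  near=> n; rewrite /= in_itv/= -ler_norml.
  apply: (@le_trans _ _ n%:R); last by rewrite ler_nat.
  by near: n; exact: nbhs_infty_ger.
have E n : \int[leb]_(y in `[- n.+1%:R, n.+1%:R]) f y = F n.+1%:R - F (- n.+1%:R).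
  have cF : continuous F.
    by move=> y; apply: differentiable_continuous; apply/derivable1_diffP; have [] := dF y.
  rewrite /Rintegral (@continuous_FTC2 _ f F)//.
  - by rewrite gtrN.
  - exact: continuous_subspaceT.
  - split; first by move=> y _; have [] := dF y.
      by apply: cvg_at_right_filter; exact: cF.
    by apply: cvg_at_left_filter; exact: cF.
  - by move=> y _; rewrite derive1E; have [_ ->] := dF y.
have nS : (n.+1%:R : R) @[n --> \oo] --> +oo.
  apply/cvgryPge => B; near=> n; apply: (@le_trans _ _ n%:R); last by rewrite ler_nat.
  by near: n; exact: nbhs_infty_ger.
have h2 : F n.+1%:R - F (- n.+1%:R) @[n --> \oo] --> 0 - 0.
  apply: cvgB; first exact: cvg_comp nS Fy.
  apply: cvg_comp FNy; exact/cvgNrNy.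
move: h1; under eq_cvg do rewrite E; move=> h1.
by rewrite -(cvg_lim _ h1)// (cvg_lim _ h2)// subr0.
Unshelve. all: by end_near. Qed.

End fundamental_theorem.

(** * The characteristic function of the normal law *)

Section gaussian.
Context {R : realType}.
Notation leb := (@lebesgue_measure R).
Variable s : R.
Hypothesis s0 : 0 < s.
Let p := normal_pdf 0 s.

Lemma normal_pdf_subdensity m t : subdensity (@normal_pdf R m t).
Proof.
split; first exact: measurable_normal_pdf.
- by move=> y; exact: normal_pdf_ge0.
- by rewrite integral_normal_pdf.
Qed.

Lemma normal_pdf0E y : p y = normal_peak s * expR (- (y ^+ 2 / (2 * s ^+ 2))).
Proof.
rewrite /p normal_pdfE ?gt_eqF// /normal_fun subr0; congr (_ * expR _).
by rewrite mulNr mulr_natl.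
Qed.

(** Half of the exponent absorbs the factor [|y|], since [u * expR (- u ^+ 2) <= 1]; the other half
    is a Gaussian of variance [2 * s ^+ 2]. *)
Lemma integrable_norm_normal_pdf : leb.-integrable setT (fun y => (`|y| * p y)%:E).
Proof.
pose t := Num.sqrt 2 * s.
have t0 : 0 < t by rewrite mulr_gt0// sqrtr_gt0.
have t2 : t ^+ 2 = 2 * s ^+ 2 by rewrite exprMn sqr_sqrtr.
pose c := 2 * s * normal_peak s / normal_peak t.
have mabs : measurable_fun [set: R] (fun y : R => `|y|).
  by apply: measurableT_comp => //; exact: measurable_id.
have c0 : 0 <= c.
  rewrite /c divr_ge0 ?normal_peak_ge0// mulr_ge0 ?normal_peak_ge0// mulr_ge0//.
  exact: ltW.
apply: (@le_integrable _ _ _ leb _ measurableT _ (EFin \o (fun y => c * normal_pdf 0 t y))).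
- apply/measurable_EFinP; apply: measurable_funM; first exact: mabs.
  exact: measurable_normal_pdf.
- move=> y _; rewrite /= lee_fin normrM normr_id [leRHS]ger0_norm; last first.
    by apply: mulr_ge0 => //; exact: normal_pdf_ge0.
  rewrite (ger0_norm (normal_pdf_ge0 _ _ _)) -/p normal_pdf0E [normal_pdf 0 t]normal_pdfE ?gt_eqF//.
  have Ee : expR (- (y ^+ 2 / (2 * s ^+ 2))) =
     expR (- (`|y| / (2 * s)) ^+ 2) * normal_fun 0 t y.
    rewrite /normal_fun -expRD t2 subr0; congr expR.
    rewrite exprMn real_normK ?num_real// -[in RHS]mulr_natr.
    by field; rewrite gt_eqF.
  set u := `|y| / (2 * s) in Ee.
  have yu : `|y| = 2 * s * u by rewrite /u; field; rewrite gt_eqF.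
  have -> : c * (normal_peak t * normal_fun 0 t y) =
      (2 * s) * (normal_peak s * normal_fun 0 t y).
    by rewrite /c; field; rewrite gt_eqF// normal_peak_gt0// gt_eqF.
  have u1 : u * expR (- u ^+ 2) <= 1.
    rewrite expRN ler_pdivrMr ?expR_gt0// mul1r; apply: le_trans (expR_ge1Dx _).
    by have := sqr_ge0 (u - 2^-1); lra.
  have -> : `|y| * (normal_peak s * expR (- (y ^+ 2 / (2 * s ^+ 2)))) =
     (2 * s) * (normal_peak s * normal_fun 0 t y) * (u * expR (- u ^+ 2)).
    by rewrite Ee yu; ring.
  rewrite ler_piMr// mulr_ge0//; first by rewrite mulr_ge0// ltW.
  by rewrite mulr_ge0 ?normal_peak_ge0 ?normal_fun_ge0.
- exact: (integrableZl measurableT c (subdensity_integrable (normal_pdf_subdensity 0 t))).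
Qed.

(** Real form of the characteristic function: the phase 0 gives its real part and the phase
    [- pi / 2] its imaginary part. *)
Definition cf (th l : R) := \int[leb]_y (cos (l * y + th) * p y).

Let bcos (l th : R) : bmf (fun y : R => cos (l * y + th)).
Proof. by apply: bmf_cos; apply: measurable_funD => //; exact: measurable_funM. Qed.

Let bsin (l th : R) : bmf (fun y : R => sin (l * y + th)).
Proof. by apply: bmf_sin; apply: measurable_funD => //; exact: measurable_funM. Qed.

Lemma is_derive_normal_pdf (y : R) : is_derive y 1 p (- (y / s ^+ 2) * p y).
Proof.
have -> : p = (fun y : R => normal_peak s * expR (- (y ^+ 2 / (2 * s ^+ 2)))).
  by apply/funext => z; exact: normal_pdf0E.
apply: is_derive_eq; rewrite /GRing.scale/=; field; exact: lt0r_neq0.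
Qed.

Let iysin l th : leb.-integrable setT (fun y => (y * sin (l * y + th) * p y)%:E).
Proof.
apply: (@le_integrable _ _ _ leb _ measurableT _ _ _ _ integrable_norm_normal_pdf).
  apply/measurable_EFinP; apply: measurable_funM; last exact: measurable_normal_pdf.
  by apply: measurable_funM; [exact: measurable_id|exact: (bsin l th).1].
move=> y _; rewrite /= lee_fin !normrM normr_id ler_wpM2r// ler_piMr//.
by rewrite ler_norml sin_geN1 sin_le1.
Qed.

(** Stein's identity for a sine: the derivative of [sin (l * y + th) * p y] integrates to 0, and [p]
    has derivative [- (y / s ^+ 2) * p y]. *)
Lemma normal_ibp l th : \int[leb]_y (y * sin (l * y + th) * p y) = s ^+ 2 * l * cf th l.
Proof.
pose F (y : R) := sin (l * y + th) * p y.
pose f (y : R) := l * (cos (l * y + th) * p y) - s ^- 2 * (y * sin (l * y + th) * p y).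
have dF (y : R) : is_derive y 1 F (f y).
  have dp := is_derive_normal_pdf y.
  apply: is_derive_eq; rewrite /GRing.scale /= /f; field; exact: lt0r_neq0.
have cp : continuous p by apply: continuous_normal_pdf; exact: lt0r_neq0.
have clin : continuous (fun y : R => l * y + th).
  by move=> y; apply: cvgD; [apply: cvgMr; exact: cvg_id|exact: cvg_cst].
have ccos : continuous (fun y : R => cos (l * y + th)).
  by move=> y; apply: continuous_comp; [exact: clin|exact: continuous_cos].
have csin : continuous (fun y : R => sin (l * y + th)).
  by move=> y; apply: continuous_comp; [exact: clin|exact: continuous_sin].
have Fle (y : R) : `|F y| <= normal_peak s * expR (- (y ^+ 2 / (2 * s ^+ 2))).
  rewrite normrM (ger0_norm (normal_pdf_ge0 _ _ _)) -/p -normal_pdf0E.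
  by rewrite ler_piMl ?normal_pdf_ge0// ler_norml sin_geN1 sin_le1.
have pcv : normal_peak s * expR (- (y ^+ 2 / (2 * s ^+ 2))) @[y --> +oo] --> (0 : R).
  rewrite -[X in _ --> X](mulr0 (normal_peak s)); apply: cvgMr.
  apply: (cvg_comp (fun y : R => y ^+ 2 / (2 * s ^+ 2)) (fun y => expR (- y))); last exact: cvgr_expR.
  apply: gt0_cvgMly; last exact: cvgr_expr2.
  by rewrite invr_gt0 mulr_gt0// exprn_gt0.
have icos := avg_integrable (normal_pdf_subdensity 0 s) (bcos l th).
have i1 := integrableZl measurableT l icos.
have i2 := integrableZl measurableT (s ^- 2) (iysin l th).
have f0 : \int[leb]_y f y = 0.
  apply: (@Rintegral_derive0 _ f F) => //.
  - move=> y; apply: cvgB; apply: cvgMr; apply: cvgM; [exact: ccos|exact: cp| |exact: cp].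
    by apply: cvgM; [exact: cvg_id|exact: csin].
  - exact: (integrableB measurableT i1 i2).
  - apply: cvg_le_dist pcv; apply: nearW => y; rewrite subr0; exact: Fle.
  - apply/cvgNy_compNP; apply: cvg_le_dist pcv; apply: nearW => y.
    by rewrite subr0 /= -[X in _ <= _ * expR (- (X / _))]sqrrN; exact: Fle.
have : \int[leb]_y f y = l * cf th l - s ^- 2 * \int[leb]_y (y * sin (l * y + th) * p y).
  rewrite /f RintegralB//.
  by rewrite RintegralZl// RintegralZl//; exact: iysin.
rewrite f0 => /eqP; rewrite eq_sym subr_eq0 => /eqP E.
rewrite -mulrA E mulrA mulfV ?mul1r// expf_neq0//; exact: lt0r_neq0.
Qed.

Lemma is_derive_cf th (l : R) : is_derive l 1 (cf th) (- (s ^+ 2 * l * cf th l)).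
Proof.
have dcos (y x : R) : is_derive x 1 (fun l : R => cos (l * y + th) * p y) (- (y * sin (x * y + th) * p y)).
  apply: is_derive_eq; rewrite /GRing.scale /=; ring.
have Il : `]l - 1, l + 1[%classic l by rewrite /= in_itv/=; apply/andP; split; lra.
have intf (x : R) : `]l - 1, l + 1[%classic x -> leb.-integrable setT (EFin \o (fun y => cos (x * y + th) * p y)).
  by move=> _; exact: avg_integrable (normal_pdf_subdensity 0 s) (bcos x th).
have derf (x y : R) : `]l - 1, l + 1[%classic x -> setT y -> derivable (fun l : R => cos (l * y + th) * p y) x 1.
  by move=> _ _; have [] := dcos y x.
have G0 (y : R) : 0 <= `|y| * p y by rewrite mulr_ge0 ?normal_pdf_ge0.
have Gub (x y : R) : `]l - 1, l + 1[%classic x -> setT y ->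
    `|partial1of2 (fun l y : R => cos (l * y + th) * p y) x y| <= `|y| * p y.
  move=> _ _; rewrite partial1of2E; have [_ ->] := dcos y x.
  rewrite normrN !normrM (ger0_norm (normal_pdf_ge0 _ _ _)) ler_wpM2r ?normal_pdf_ge0//.
  by rewrite ler_piMr// ler_norml sin_geN1 sin_le1.
have D1 := derivable_under_integral measurableT Il intf derf G0 integrable_norm_normal_pdf Gub.
have D2 := differentiation_under_integral measurableT Il intf derf G0 integrable_norm_normal_pdf Gub.
apply: DeriveDef; first exact: D1.
rewrite -derive1E D2 -normal_ibp -mulN1r -RintegralZl//; last exact: iysin.
apply: eq_Rintegral => y _; rewrite partial1of2E.
by have [_ ->] := dcos y l; rewrite mulN1r.
Qed.

(** By [is_derive_cf], [cf th] solves a linear differential equation in [l]; multiplied by the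
    inverse of the expected Gaussian factor it has derivative 0 and keeps its value at 0. *)
Lemma normal_cf th l : cf th l = expR (- (l ^+ 2 * s ^+ 2 / 2)) * cos th.
Proof.
pose H (l : R) := cf th l * expR (l ^+ 2 * s ^+ 2 / 2).
have dH (x : R) : is_derive x 1 H 0.
  have dcf := is_derive_cf th x.
  by apply: is_derive_eq; rewrite /GRing.scale /=; field.
have : H l = H 0 by apply: (@is_derive_0_is_cst R H l 0); exact: dH.
rewrite /H expr0n/= !mul0r expR0 mulr1 {2}/cf.
under [X in _ = X]eq_Rintegral do rewrite mul0r add0r.
rewrite RintegralZl//; last exact: subdensity_integrable (normal_pdf_subdensity 0 s).
have -> : \int[leb]_y p y = 1 by rewrite /Rintegral [X in fine X](integral_normal_pdf 0 s).
by rewrite mulr1 => <-; rewrite expRN mulrCA mulVf ?mulr1// lt0r_neq0// expR_gt0.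
Qed.

End gaussian.

Section normal_integrals.
Context {R : realType}.
Notation leb := (@lebesgue_measure R).

Lemma Rintegral_normal_prob (m s : R) (phi : R -> R) : bmf phi ->
  \int[normal_prob m s]_y phi y = avg (normal_pdf m s) phi.
Proof.
have sp := normal_pdf_subdensity m s.
move: phi; apply: bmf_ind.
- move=> A mA; rewrite /avg /Rintegral; congr fine.
  rewrite [LHS]integral_indic// setIT /normal_prob [LHS]integral_mkcond.
  by apply: eq_integral => y _; rewrite epatch_indic/= -EFinM mulrC.
- move=> F H bF bH EF EH.
  rewrite avgD// -EF -EH RexpD//.
- by move=> c F bF EF; rewrite avgZ// -EF RexpZ.
- move=> u v M bu Eu uM bv uv.
  have c1 : \int[normal_prob m s]_y u n y @[n --> \oo] --> \int[normal_prob m s]_y v y.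
    by apply: (@bounded_cvg _ _ _ _ _ _ M) => //; exact: aeW.
  have c2 := avg_cvg sp bu bv uM uv.
  move: c1; under eq_cvg do rewrite Eu; move=> c1.
  by rewrite -(cvg_lim _ c1)// -(cvg_lim _ c2).
Qed.

End normal_integrals.

(** * Exchanging an expectation and a mixture *)

Section mixtures.
Context {R : realType} {d} {S : measurableType d} (Q : probability S R).
Notation leb := (@lebesgue_measure R).
Variables (Z : S -> R) (omega : R -> R) (Phi : R -> R -> R) (M : R).
Hypotheses (mZ : measurable_fun setT Z) (so : subdensity omega).
Hypotheses (mPhi : measurable_fun setT (fun t : R * R => Phi t.1 t.2)).
Hypotheses (PhiM : forall z y, `|Phi z y| <= M).

Let f (t : S * R) : \bar R := (Phi t.2 (Z t.1) * omega t.2)%:E.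

Lemma bmf_Phi_y y : bmf (fun z : R => Phi z y).
Proof. by split; [exact: measurable_fun_pair1 mPhi|exists M]. Qed.

Lemma bmf_Phi_z z : bmf (fun w => Phi z (Z w)).
Proof.
split; last by exists M.
by apply: measurableT_comp mZ; exact: measurable_fun_pair2 mPhi.
Qed.

Let mf0 : measurable_fun setT (fun t : S * R => Phi t.2 (Z t.1) * omega t.2).
Proof.
apply: measurable_funM.
  apply: (@measurableT_comp _ _ _ _ _ _ (fun t : R * R => Phi t.1 t.2) _ (fun t : S * R => (t.2, Z t.1))) => //.
  by apply: measurable_fun_pair => //; exact: measurableT_comp.
by have [mo _ _] := so; exact: measurableT_comp.
Qed.

Let avg_fin w : (\int[leb]_z f (w, z) = (avg omega (fun z => Phi z (Z w)))%:E)%E.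
Proof.
rewrite /avg /Rintegral fineK//; apply: integrable_fin_num => //.
exact: avg_integrable so (bmf_Phi_y (Z w)).
Qed.

Let exp_fin z : (\int[Q]_w f (w, z) = ((\int[Q]_w Phi z (Z w)) * omega z)%:E)%E.
Proof.
rewrite /f /=; under eq_integral do rewrite mulrC EFinM.
rewrite integralZl//; last exact: bmf_integrable (bmf_Phi_z z).
rewrite mulrC EFinM /Rintegral fineK//; apply: integrable_fin_num => //.
exact: bmf_integrable (bmf_Phi_z z).
Qed.

Let intf : (Q \x leb)%E.-integrable setT f.
Proof.
apply/integrable12ltyP; first exact/measurable_EFinP.
have M0 : 0 <= M by exact: le_trans (PhiM 0 0).
apply: (@le_lt_trans _ _ (\int[Q]_w M%:E)%E); last first.
  by rewrite integral_cst//= [X in (_ * X)%E](@probability_setT _ _ _ Q) mule1 ltry.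
have [mo o0 o1] := so.
apply: ge0_le_integral => //.
- by move=> w _; exact: integral_ge0.
- apply: (@measurable_fun_fubini_tonelli_F _ _ _ _ _ leb (abse \o f)) => //=.
  by apply: measurableT_comp => //; exact/measurable_EFinP.
- move=> w _; apply: (@le_trans _ _ (\int[leb]_y (M%:E * (omega y)%:E))%E).
    apply: ge0_le_integral => //.
    + apply: measurableT_comp => //; apply/measurable_EFinP.
      exact: measurable_fun_pair2 mf0.
    + by apply/measurable_EFinP; apply: measurable_funM.
    + by move=> y _; rewrite /f /= -EFinM lee_fin normrM (ger0_norm (o0 y)) ler_wpM2r.
  rewrite ge0_integralZl//; [|exact/measurable_EFinP|by move=> y _; rewrite lee_fin].
  by rewrite -[leRHS]mule1 lee_wpmul2l// lee_fin.
Qed.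

Lemma bmf_mixture : bmf (fun w => avg omega (fun z => Phi z (Z w))).
Proof.
have M0 : 0 <= M by exact: le_trans (PhiM 0 0).
split; last by exists M => w; apply: avg_bound => //; exact: bmf_Phi_y.
apply/measurable_EFinP.
rewrite (_ : _ \o _ = (fun w => \int[leb]_z f (w, z))%E).
  exact: (measurable_fubini_F intf).
by apply/funext => w; rewrite avg_fin.
Qed.

Lemma measurable_exp_weighted : measurable_fun setT (fun z => (\int[Q]_w Phi z (Z w)) * omega z).
Proof.
apply/measurable_EFinP.
rewrite (_ : _ \o _ = (fun z => \int[Q]_w f (w, z))%E).
  exact: (measurable_fubini_G intf).
by apply/funext => z; rewrite exp_fin.
Qed.

Lemma exp_mixture : \int[Q]_w avg omega (fun z => Phi z (Z w)) =
  avg omega (fun z => \int[Q]_w Phi z (Z w)).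
Proof.
rewrite [LHS]/Rintegral [RHS]/avg [RHS]/Rintegral; congr fine.
under eq_integral do rewrite -avg_fin.
under [RHS]eq_integral do rewrite -exp_fin.
exact: Fubini intf.
Qed.

End mixtures.

(** * From cosines to all bounded continuous functions *)

Section levy.
Context {R : realType} {d} {T : measurableType d} (P : probability T R).
Notation leb := (@lebesgue_measure R).
Variables (Z : nat -> T -> R) (s : R).
Hypotheses (mZ : forall n, measurable_fun setT (Z n)) (s0 : 0 < s).
Hypothesis cos_cvg : forall l th, \int[P]_w cos (l * Z n w + th) @[n --> \oo] -->
  expR (- (l ^+ 2 * s ^+ 2 / 2)) * cos th.

Let p := @normal_pdf R 0 s.
Let sp : subdensity p := normal_pdf_subdensity 0 s.

Definition cvgE (phi : R -> R) :=
  bmf phi /\ \int[P]_w phi (Z n w) @[n --> \oo] --> avg p phi.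

Let bZ (phi : R -> R) n : bmf phi -> bmf (fun w => phi (Z n w)).
Proof.
move=> [m [M H]]; split; first exact: measurableT_comp.
by exists M => w; exact: H.
Qed.

Lemma cvgE_cos l th : cvgE (fun y => cos (l * y + th)).
Proof.
split; first by apply: bmf_cos; apply: measurable_funD => //; exact: measurable_funM.
rewrite [X in _ --> X](_ : _ = cf s th l)// normal_cf//.
Qed.

Lemma cvgEZ c phi : cvgE phi -> cvgE (fun y => c * phi y).
Proof.
move=> [bphi cphi]; split; first exact: bmfZ.
rewrite avgZ//; have -> : (fun n => \int[P]_w (c * phi (Z n w))) = (fun n => c * \int[P]_w phi (Z n w)).
  by apply/funext => n; rewrite RexpZ//; exact: bZ.
exact: cvgMr.
Qed.

(** The limit is also an expectation, that of the identity under [normal_prob 0 s]. Fubini thus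
    applies on both sides, and dominated convergence acts on the mixing variable alone. *)
Lemma cvgE_mixture omega (Phi : R -> R -> R) M : subdensity omega ->
  measurable_fun setT (fun t : R * R => Phi t.1 t.2) ->
  (forall z y, `|Phi z y| <= M) -> (forall z, cvgE (Phi z)) ->
  cvgE (fun y => avg omega (fun z => Phi z y)).
Proof.
move=> so mPhi PhiM cPhi.
have mid : measurable_fun (setT : set (measurableTypeR R)) (@id R) by exact: measurable_id.
have bm_ : bmf (fun y : R => avg omega (fun z => Phi z y)).
  exact: (bmf_mixture (normal_prob 0 s) mid so mPhi PhiM).
split => //.
under eq_cvg do rewrite (exp_mixture P (mZ _) so mPhi PhiM).
rewrite -Rintegral_normal_prob// (exp_mixture (normal_prob 0 s) mid so mPhi PhiM).
rewrite /avg; apply: (@Rdominated_cvg _ _ _ leb _ _ _ (fun y => M * omega y)) => //.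
- by move=> n; exact: (measurable_exp_weighted P (mZ n) so mPhi PhiM).
- exact: (measurable_exp_weighted (normal_prob 0 s) mid so mPhi PhiM).
- apply: aeW => z _; apply: cvgMl; rewrite Rintegral_normal_prob; first by have [] := cPhi z.
  by have [] := cPhi z.
- exact: (integrableZl measurableT M (subdensity_integrable so)).
- move=> n z _; have [_ o0 _] := so; rewrite normrM (ger0_norm (o0 z)) ler_wpM2r//.
  by apply: Rexpectation_bound => //; apply: bZ; have [] := cPhi z.
Qed.

(** A Gaussian function of [y] centred at [z] is the characteristic function of a normal law at
    [y - z]; the frequency [l] becomes the mixing variable and [- z * l] the phase. *)
Lemma cvgE_gauss sg z : 0 < sg -> cvgE (fun y => expR (- ((y - z) ^+ 2 * sg ^+ 2 / 2))).
Proof.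
move=> sg0.
have := @cvgE_mixture (normal_pdf 0 sg) (fun l y => cos (l * y + - z * l)) 1
  (normal_pdf_subdensity 0 sg).
have -> : (fun y => avg (normal_pdf 0 sg) (fun l => cos (l * y + - z * l))) =
    (fun y => expR (- ((y - z) ^+ 2 * sg ^+ 2 / 2))).
  apply/funext => y; transitivity (cf sg 0 (y - z)); last by rewrite normal_cf// cos0 mulr1.
  by apply: eq_Rintegral => l _; congr (cos _ * _); lra.
apply.
- apply: (bmf_cos _).1; apply: measurable_funD; first exact: measurable_funM.
  by apply: measurable_funM.
- by move=> l y; rewrite ler_norml cos_geN1 cos_le1.
- by move=> l; exact: cvgE_cos.
Qed.

Lemma cvgE_unif phi : bmf phi ->
  (forall e, 0 < e -> exists2 phi', cvgE phi' & forall y, `|phi y - phi' y| <= e) ->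
  cvgE phi.
Proof.
move=> bphi H; split => //; apply/cvgrPdist_le => e e0.
have e3 : 0 < e / 3 by rewrite divr_gt0.
have [phi' [bphi' cphi'] Hphi'] := H _ e3.
move/cvgrPdist_le : cphi' => /(_ _ e3); apply: filterS => n Hn.
have A1 : `|avg p phi - avg p phi'| <= e / 3.
  have -> : avg p phi - avg p phi' = avg p (fun y => phi y + -1 * phi' y).
    by rewrite avgD ?avgZ//; [lra|exact: bmfZ].
  apply: avg_bound => //; [by apply: bmfD => //; exact: bmfZ|exact: ltW|].
  by move=> y _; rewrite mulN1r.
have A2 : `|\int[P]_w phi (Z n w) - \int[P]_w phi' (Z n w)| <= e / 3.
  rewrite -RexpB; [|exact: bZ..]; apply: Rexpectation_bound => //.
  by apply: bmfB; exact: bZ.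
move: Hn A1 A2; rewrite !ler_norml => /andP[? ?] /andP[? ?] /andP[? ?].
by apply/andP; split; lra.
Qed.

Definition unif_weight (A z : R) := (2 * A)^-1 * \1_(`[- A, A]%classic) z.

Lemma unif_weight_subdensity A : 0 < A -> subdensity (unif_weight A).
Proof.
move=> A0; split.
- by apply: measurable_funM => //; exact: measurable_indic.
- by move=> y; rewrite mulr_ge0// invr_ge0 mulr_ge0// ltW.
- rewrite /unif_weight; under eq_integral do rewrite EFinM.
  rewrite ge0_integralZl//; last 2 first.
  + by apply/measurable_EFinP; exact: measurable_indic.
  + by rewrite lee_fin invr_ge0 mulr_ge0// ltW.
  rewrite integral_indic// setIT.
  rewrite [X in (_ * X)%E](@lebesgue_measure_itv R `[- A, A]%R) /= lte_fin gtrN//.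
  rewrite -EFinD -EFinM lee_fin opprK.
  have -> : (2 * A)^-1 * (A + A) = 1 by field; rewrite gt_eqF.
  exact: lexx.
Qed.

(* For [psi] supported in [[- A, A]], the convolution of [psi] with a Gaussian
   density is the average against [unif_weight A] of multiples of Gaussian
   functions. *)
Definition smoothing (psi : R -> R) (de y : R) := avg (normal_pdf y de) psi.

Lemma cvgE_smoothing (psi : R -> R) (A de : R) : bmf psi -> 0 < A -> 0 < de ->
  (forall y, A < `|y| -> psi y = 0) -> cvgE (smoothing psi de).
Proof.
move=> bpsi A0 de0 psi0; have [mpsi [M psiM]] := bpsi.
have M0 : 0 <= M by exact: le_trans (psiM 0).
have sw := unif_weight_subdensity A0.
have de10 : 0 < de^-1 by rewrite invr_gt0.
have -> : smoothing psi de = (fun y => (2 * A * normal_peak de) * avg (unif_weight A)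
    (fun z => psi z * expR (- ((y - z) ^+ 2 * de^-1 ^+ 2 / 2)))).
  apply/funext => y; rewrite /smoothing /avg -RintegralZl//; last first.
    apply: avg_integrable => //; apply: bmfM => //.
    have -> : (fun z => expR (- ((y - z) ^+ 2 * de^-1 ^+ 2 / 2))) =
      (fun z => expR (- ((z - y) ^+ 2 * de^-1 ^+ 2 / 2))).
      by apply/funext => z; rewrite -sqrrN opprB.
    exact: (cvgE_gauss y de10).1.
  apply: eq_Rintegral => z _; rewrite normal_pdfE ?gt_eqF// /normal_fun.
  have [zA|zA] := ltP A `|z|; first by rewrite psi0// !mul0r !mulr0.
  rewrite /unif_weight indicE mem_set ?mulr1; last by rewrite /= in_itv/= -ler_norml.
  have -> : - (z - y) ^+ 2 / (de ^+ 2 *+ 2) = - ((y - z) ^+ 2 * de^-1 ^+ 2 / 2).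
    by rewrite -mulr_natr; field; rewrite gt_eqF.
  by field; rewrite gt_eqF.
apply: cvgEZ.
apply: (@cvgE_mixture _ (fun z y => psi z * expR (- ((y - z) ^+ 2 * de^-1 ^+ 2 / 2))) M) => //.
- apply: measurable_funM; first exact: measurableT_comp.
  apply: measurableT_comp => //; apply: measurableT_comp => //.
  apply: measurable_funM => //; apply: measurable_funM => //.
  by apply: measurable_funX; apply: measurable_funB.
- move=> z y; rewrite normrM -[leRHS]mulr1 ler_pM// ger0_norm ?expR_ge0//.
  by rewrite -expR0 ler_expR oppr_le0 divr_ge0// mulr_ge0 ?sqr_ge0.
- by move=> z; apply: cvgEZ; exact: cvgE_gauss.
Qed.

Lemma normal_peak_sqrt2 (de : R) : 0 < de ->
  normal_peak de = Num.sqrt 2 * normal_peak (Num.sqrt 2 * de).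
Proof.
move=> de0; rewrite /normal_peak.
have -> : (Num.sqrt 2 * de) ^+ 2 * pi *+ 2 = 2 * (de ^+ 2 * pi *+ 2).
  by rewrite exprMn sqr_sqrtr// !mulr2n; ring.
by rewrite sqrtrM// invfM mulrA mulfV ?mul1r// gt_eqF// sqrtr_gt0.
Qed.

(** The exponent is split into equal halves: one is bounded through [eta], the other makes a
    Gaussian of variance [2 * de ^+ 2], and [Num.sqrt 2] is the ratio of the peaks. *)
Lemma normal_pdf_tail (y z de eta : R) : 0 < de -> 0 < eta -> eta <= `|z - y| ->
  normal_pdf y de z <=
  Num.sqrt 2 * expR (- (eta ^+ 2 / (4 * de ^+ 2))) * normal_pdf y (Num.sqrt 2 * de) z.
Proof.
move=> de0 eta0 etazy.
have s2 : 0 < Num.sqrt 2 :> R by rewrite sqrtr_gt0.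
rewrite !normal_pdfE ?gt_eqF ?mulr_gt0// normal_peak_sqrt2//.
have -> : Num.sqrt 2 * expR (- (eta ^+ 2 / (4 * de ^+ 2))) *
   (normal_peak (Num.sqrt 2 * de) * normal_fun y (Num.sqrt 2 * de) z) =
   Num.sqrt 2 * normal_peak (Num.sqrt 2 * de) *
   (expR (- (eta ^+ 2 / (4 * de ^+ 2))) * normal_fun y (Num.sqrt 2 * de) z) by ring.
rewrite ler_wpM2l//; first by rewrite mulr_ge0 ?normal_peak_ge0// ltW.
rewrite /normal_fun -expRD ler_expR exprMn sqr_sqrtr//.
have : eta ^+ 2 <= (z - y) ^+ 2.
  by rewrite -[leRHS]real_normK ?num_real// ler_pXn2r ?nnegrE//; exact: ltW.
move=> H.
have {}H : 0 <= ((z - y) ^+ 2 - eta ^+ 2) / (4 * de ^+ 2).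
  by rewrite divr_ge0 ?subr_ge0// mulr_ge0// sqr_ge0.
rewrite -subr_ge0; apply: (le_trans H); rewrite le_eqVlt; apply/orP; left; apply/eqP.
have den0 : de != 0 by rewrite gt_eqF.
have de20 : 0 < de ^+ 2 by rewrite exprn_gt0.
by rewrite !mulr2n; field; rewrite den0 andbT !gt_eqF//; lra.
Qed.

Lemma smoothing_unif (psi : R -> R) (M e eta : R) : bmf psi -> 0 < M -> (forall y, `|psi y| <= M) ->
  0 < e -> 0 < eta -> (forall y z, `|z - y| < eta -> `|psi z - psi y| <= e) ->
  exists2 de, 0 < de & forall y, `|smoothing psi de y - psi y| <= 2 * e.
Proof.
move=> bpsi M0 psiM e0 eta0 unif.
pose t := 4 * M / e.
have t0 : 0 < t by rewrite divr_gt0// mulr_gt0.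
(* With this width the exponent in [normal_pdf_tail] is [t]; as [expR (- t) <= t^-1], the points
   farther than [eta] contribute at most [2 * M * (2 / t) = e]. *)
pose de := eta / (2 * Num.sqrt t).
have st0 : 0 < Num.sqrt t by rewrite sqrtr_gt0.
have de0 : 0 < de by rewrite divr_gt0// mulr_gt0.
have Et : eta ^+ 2 / (4 * de ^+ 2) = t.
  rewrite /de exprMn exprVn exprMn sqr_sqrtr ?ltW//; field.
  by rewrite (gt_eqF t0) (gt_eqF eta0).
exists de => // y.
have sd := normal_pdf_subdensity y de.
have sd2 := normal_pdf_subdensity y (Num.sqrt 2 * de).
have bcst := @bmf_cst R _ R.
have bdiff : bmf (fun z => psi z - psi y) by exact: bmfB.
have mass1 m u : \int[leb]_z normal_pdf m u z = 1.
  by rewrite /Rintegral [X in fine X](integral_normal_pdf m u).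
have -> : smoothing psi de y - psi y = avg (normal_pdf y de) (fun z => psi z - psi y).
  by rewrite avgD//; rewrite avg_cst// mass1 mulr1.
pose kap := Num.sqrt 2 * expR (- t).
have kap0 : 0 <= kap by rewrite mulr_ge0 ?expR_ge0.
have i1 := avg_integrable sd bdiff.
have ie := integrableZl measurableT e (subdensity_integrable sd).
have ik := integrableZl measurableT (2 * M * kap) (subdensity_integrable sd2).
apply: (le_trans (le_normr_Rintegral measurableT i1)).
apply: (@le_trans _ _ (\int[leb]_z (e * normal_pdf y de z +
    2 * M * kap * normal_pdf y (Num.sqrt 2 * de) z))).
  apply: le_Rintegral => //.
  - exact: (integrable_norm i1).
  - exact: (integrableD measurableT ie ik).
  - move=> z _; rewrite normrM (ger0_norm (normal_pdf_ge0 _ _ _)).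
    have [zy|zy] := ltP `|z - y| eta.
      apply: (@le_trans _ _ (e * normal_pdf y de z)).
        by rewrite ler_wpM2r ?normal_pdf_ge0// unif.
      by rewrite lerDl mulr_ge0 ?normal_pdf_ge0// mulr_ge0// mulr_ge0// ltW.
    have h1 := normal_pdf_tail de0 eta0 zy; rewrite Et -/kap in h1.
    have h2 : `|psi z - psi y| <= 2 * M.
      by rewrite (le_trans (ler_normB _ _))// mulr_natl mulr2n lerD.
    apply: (@le_trans _ _ (2 * M * (kap * normal_pdf y (Num.sqrt 2 * de) z))).
      by rewrite ler_pM// normal_pdf_ge0.
    by rewrite mulrA lerDr mulr_ge0 ?normal_pdf_ge0// ltW.
rewrite RintegralD//.
rewrite RintegralZl//; last exact: subdensity_integrable.
rewrite RintegralZl//; last exact: subdensity_integrable.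
rewrite !mass1 !mulr1; suff : 2 * M * kap <= e by lra.
have s22 : Num.sqrt 2 <= 2 :> R.
  by rewrite -[leRHS]ger0_norm// -sqrtr_sqr ler_sqrt//; lra.
have et : expR (- t) <= t^-1.
  by rewrite expRN lef_pV2 ?posrE ?expR_gt0// (le_trans _ (expR_ge1Dx t))// lerDr.
have : kap <= 2 * t^-1 by rewrite ler_pM ?expR_ge0.
have -> : 2 * t^-1 = e / (2 * M).
  by rewrite /t; field; rewrite (gt_eqF M0) (gt_eqF e0).
by rewrite ler_pdivlMr ?mulr_gt0// mulrC.
Qed.

Lemma continuous_support_unif (psi : R -> R) (A e : R) : continuous psi -> 0 < e -> 0 < A ->
  (forall y, A < `|y| -> psi y = 0) ->
  exists2 eta, 0 < eta & forall y z, `|z - y| < eta -> `|psi z - psi y| <= e.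
Proof.
move=> cpsi e0 A0 psi0.
have cK : compact `[- (A + 1), A + 1] by exact: segment_compact.
have near0 : \forall r \near (0 : R), `[- (A + 1), A + 1] `<=` (fun y => `|psi (y + r) - psi y| <= e).
  have := (proj1 (compact_near_coveringP _)) cK _ _ (fun r y => `|psi (y + r) - psi y| <= e) (nbhs_filter (0 : R)).
  apply => x _.
  have e2 : 0 < e / 2 by rewrite divr_gt0.
  move/cvgrPdist_le : (cpsi x) => /(_ _ e2) /nbhs_ballP[b /= b0 Hb].
  have b2 : 0 < b / 2 by rewrite divr_gt0.
  exists (ball x (b / 2), ball (0 : R) (b / 2)) => /=.
    by split; exact: nbhsx_ballx.
  move=> [x' r] [/=]; rewrite /ball /= sub0r normrN => xb rb.
  have h1 : `|psi x - psi x'| <= e / 2 by apply: Hb; rewrite /ball /=; lra.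
  have h2 : `|psi x - psi (x' + r)| <= e / 2.
    apply: Hb; rewrite /ball /= opprD addrA.
    by have := ler_normB (x - x') r; lra.
  have := ler_normD (psi (x' + r) - psi x) (psi x - psi x').
  rewrite addrA subrK => h; apply: (le_trans h).
  by rewrite distrC; lra.
move/nbhs_ballP : near0 => [b /= b0 Hb].
(* The cap at 1 matters when [y] lies outside the enlarged segment: both points are then beyond [A],
   where [psi] vanishes. *)
exists (Num.min b 1); first by rewrite lt_min b0/=.
move=> y z; rewrite lt_min => /andP[zb z1].
have [yA|yA] := leP `|y| (A + 1).
  have := Hb (z - y) _ y _; rewrite (addrC y) subrK; apply.
    by rewrite /ball /= sub0r normrN.
  by rewrite /= in_itv/= -ler_norml.
have zA : A < `|z|.
  have := ler_normB z (z - y); rewrite opprB addrCA subrr addr0; lra.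
by rewrite !psi0 ?subrr ?normr0 ?ltW//; lra.
Qed.

Lemma cvgE_compact_support (psi : R -> R) (A M : R) : continuous psi -> 0 < A -> 0 < M ->
  (forall y, `|psi y| <= M) -> (forall y, A < `|y| -> psi y = 0) -> cvgE psi.
Proof.
move=> cpsi A0 M0 psiM psi0.
have bpsi : bmf psi by split; [exact: continuous_measurable_fun|exists M].
apply: cvgE_unif => // e e0.
have e2 : 0 < e / 2 by rewrite divr_gt0.
have [eta eta0 unif] := continuous_support_unif cpsi e2 A0 psi0.
have [de de0 H] := smoothing_unif bpsi M0 psiM e2 eta0 unif.
exists (smoothing psi de); first exact: (cvgE_smoothing bpsi A0).
by move=> y; rewrite distrC (le_trans (H y))//; lra.
Qed.

Definition tent (A y : R) := Num.min 1 (Num.max 0 (A + 1 - `|y|)).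

Lemma tent01 A y : 0 <= tent A y <= 1.
Proof. by rewrite /tent le_min ler01 le_max lexx/= ge_min lexx. Qed.

Lemma tent1 A y : `|y| <= A -> tent A y = 1.
Proof.
move=> yA; rewrite /tent; apply/min_idPl; rewrite le_max; apply/orP; right; lra.
Qed.

Lemma tent0 A y : A + 1 < `|y| -> tent A y = 0.
Proof.
move=> yA; rewrite /tent (max_idPl _); last by lra.
by apply/min_idPr.
Qed.

Lemma continuous_tent A : continuous (tent A).
Proof.
have c0 (c : R) : continuous (fun _ : R => c) by move=> y; exact: cst_continuous.
have c1 : continuous (fun y : R => A + 1 - `|y|).
  by move=> y; apply: cvgB; [exact: cvg_cst|exact: norm_continuous].
have c2 := max_fun_continuous (c0 0) c1.
exact: (min_fun_continuous (c0 1) c2).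
Qed.

Lemma levy (phi : R -> R) : continuous phi -> (exists M, forall y, `|phi y| <= M) ->
  bmf phi /\ \int[P]_w phi (Z n w) @[n --> \oo] --> avg p phi.
Proof.
move=> cphi [M' phiM'].
pose M := `|M'| + 1.
have M0 : 0 < M by rewrite ltr_wpDl.
have phiM y : `|phi y| <= M by rewrite (le_trans (phiM' y))// (le_trans (ler_norm _))// lerDl.
have bphi : bmf phi by split; [exact: continuous_measurable_fun|exists M].
have ctent A : 0 < A -> cvgE (tent A).
  move=> A0; apply: (@cvgE_compact_support _ (A + 1) 1) => //; [exact: continuous_tent|lra| |].
  - by move=> y; have /andP[? ?] := tent01 A y; rewrite ger0_norm.
  - by move=> y; exact: tent0.
have cphitent A : 0 < A -> cvgE (fun y => phi y * tent A y).
  move=> A0; apply: (@cvgE_compact_support _ (A + 1) M) => //.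
  - by move=> y; apply: cvgM; [exact: cphi|exact: continuous_tent].
  - by lra.
  - move=> y; have /andP[? ?] := tent01 A y; rewrite normrM -[leRHS]mulr1 ler_pM//.
    by rewrite ger0_norm.
  - by move=> y yA; rewrite tent0// mulr0.
split => //; apply/cvgrPdist_le => e e0.
(* Three errors are added: [M * e'] for the tail of the limit law, [2 * M * e'] for the tail of
   [Z n], and [e'] for the truncated function. *)
pose e' := e / (4 * (M + 1)).
have e'0 : 0 < e' by rewrite divr_gt0// mulr_gt0//; lra.
have : avg p (tent n.+1%:R) @[n --> \oo] --> avg p (fun=> 1).
  apply: (@avg_cvg _ _ _ _ 1) => //.
  - by move=> n; have [] := ctent n.+1%:R (ltr0Sn _ n).
  - exact: bmf_cst.
  - by move=> n y; have /andP[? ?] := tent01 n.+1%:R y; rewrite ger0_norm.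
  - move=> y; apply: cvg_near_cst; near=> n; rewrite tent1//.
    apply: (@le_trans _ _ n%:R); last by rewrite ler_nat.
    by near: n; exact: nbhs_infty_ger.
rewrite avg_cst// (_ : \int[leb]_y p y = 1); last first.
  by rewrite /Rintegral [X in fine X](integral_normal_pdf 0 s).
rewrite mulr1 => /cvgrPdist_le /(_ _ e'0) /filter_ex[k Hk].
set A := k.+1%:R in Hk; have A0 : 0 < A by rewrite ltr0Sn.
have [bt ct] := ctent A A0; have [bpt cpt] := cphitent A A0.
move/cvgrPdist_le : ct => /(_ _ e'0) ct; move/cvgrPdist_le : cpt => /(_ _ e'0) cpt.
near=> n.
have h1 : `|avg p (tent A) - \int[P]_w tent A (Z n w)| <= e' by near: n.
have h2 : `|avg p (fun y => phi y * tent A y) - \int[P]_w (phi (Z n w) * tent A (Z n w))| <= e' by near: n.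
have b1 : bmf (fun y => 1 + -1 * tent A y).
  by apply: bmfD; [exact: bmf_cst|exact: bmfZ].
have pt y : `|phi y + -1 * (phi y * tent A y)| <= M * (1 + -1 * tent A y).
  rewrite mulN1r -{1}(mulr1 (phi y)) -mulrBr normrM mulN1r ler_pM//.
  by have /andP[? ?] := tent01 A y; rewrite ger0_norm// subr_ge0.
have bd : bmf (fun y => phi y + -1 * (phi y * tent A y)) by apply: bmfD => //; exact: bmfZ.
have bdn : bmf (fun y => `|phi y + -1 * (phi y * tent A y)|).
  split; first by apply: measurableT_comp => //; exact: bd.1.
  by have [_ [N HN]] := bd; exists N => y; rewrite normr_id.
have h3 : `|avg p phi - avg p (fun y => phi y * tent A y)| <= M * (1 - avg p (tent A)).
  have -> : avg p phi - avg p (fun y => phi y * tent A y) = avg p (fun y => phi y + -1 * (phi y * tent A y)).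
    by rewrite avgD ?avgZ//; [lra|exact: bmfZ].
  have -> : M * (1 - avg p (tent A)) = avg p (fun y => M * (1 + -1 * tent A y)).
    rewrite avgZ// avgD ?avgZ//; [|exact: bmf_cst|exact: bmfZ].
    rewrite avg_cst// (_ : \int[leb]_y p y = 1); first by rewrite mul1r mulN1r.
    by rewrite /Rintegral [X in fine X](integral_normal_pdf 0 s).
  rewrite ler_norml; apply/andP; split.
    have bN := bmfZ (-1) bd; have bM := bmfZ M b1.
    have := @le_avg _ p _ _ sp bN bM; rewrite [avg p (fun y => -1 * _)]avgZ// mulN1r lerNl; apply.
    by move=> y _; have := pt y; rewrite ler_norml => /andP[? ?]; lra.
  apply: le_avg => //; first exact: bmfZ.
  by move=> y _; have := pt y; rewrite ler_norml => /andP[? ?]; lra.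
have h4 : `|\int[P]_w phi (Z n w) - \int[P]_w (phi (Z n w) * tent A (Z n w))| <=
    M * (1 - \int[P]_w tent A (Z n w)).
  rewrite -RexpB; [|exact: bZ|exact: (bZ n bpt)].
  have bdZ := bZ n bd; have bdnZ := bZ n bdn.
  have -> : M * (1 - \int[P]_w tent A (Z n w)) = \int[P]_w (M * (1 + -1 * tent A (Z n w))).
    rewrite RexpZ; last exact: (bZ n b1).
    rewrite RexpD; [|exact: bmf_cst|exact: (bZ n (bmfZ (-1) bt))].
    by rewrite Rexp_cst RexpZ ?mulN1r//; exact: (bZ n bt).
  have -> : \int[P]_w (phi (Z n w) - phi (Z n w) * tent A (Z n w)) =
      \int[P]_w (phi (Z n w) + -1 * (phi (Z n w) * tent A (Z n w))).
    by apply: eq_Rintegral => w _; rewrite mulN1r.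
  apply: (le_trans (le_normr_Rintegral measurableT (bmf_integrable P bdZ))).
  apply: le_Rexp => //; exact: (bZ n (bmfZ M b1)).
have Me : 4 * (M + 1) * e' = e by rewrite /e'; field; rewrite gt_eqF//; lra.
have h5 : M * (1 - avg p (tent A)) <= M * e'.
  by rewrite ler_pM2l// (le_trans (ler_norm _)).
(* Tightness: the mass that [Z n] has outside the plateau is read off the convergence of the mean of
   [tent A]. *)
have h6 : M * (1 - \int[P]_w tent A (Z n w)) <= M * (2 * e').
  rewrite ler_pM2l//; move: Hk h1; rewrite !ler_norml => /andP[? ?] /andP[? ?]; lra.
have := le_trans h3 h5; have := le_trans h4 h6; move: h2.
have Me' : 0 < M * e' by rewrite mulr_gt0.
rewrite !ler_norml => /andP[? ?] /andP[? ?] /andP[? ?].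
apply/andP; split; lra.
Unshelve. all: by end_near. Qed.

End levy.

(** * The gamma kernel *)

Section gamma_kernel.
Context {R : realType}.
Notation leb := (@lebesgue_measure R).
Notation Rp := (`[0, +oo[%classic : set R).
Implicit Types a h y : R.

(** The gamma density of shape [a + 1] and scale [h] without its normalisation; with this indexing
    the kernel at [x] has [a = x / h]. *)
Definition gamma_weight a h y := y `^ a * expR (- (y / h)) * \1_Rp y.

Lemma gamma_weight_lt0 a h y : y < 0 -> gamma_weight a h y = 0.
Proof.
move=> y0; rewrite /gamma_weight indicE memNset ?mulr0//= in_itv/= andbT.
by apply/negP; rewrite -ltNge.
Qed.

Lemma gwE a h y : 0 <= y -> gamma_weight a h y = y `^ a * expR (- (y / h)).
Proof. by move=> y0; rewrite /gamma_weight indicE mem_set ?mulr1//= in_itv/= andbT. Qed.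

Lemma gamma_weight_ge0 a h y : 0 <= gamma_weight a h y.
Proof. by rewrite /gamma_weight mulr_ge0// mulr_ge0 ?powR_ge0 ?expR_ge0. Qed.

Lemma measurable_gamma_weight a h : measurable_fun setT (gamma_weight a h).
Proof.
apply: measurable_funM; last exact: measurable_indic.
apply: measurable_funM; first exact: measurable_powR.
by apply: measurableT_comp => //; apply: measurableT_comp => //; exact: measurable_funM.
Qed.

(** The mode is [a * h]; the bound is [ln u <= u - 1] at [u = y / (a * h)], which excludes [a = 0]
    and [y = 0], treated first. *)
Lemma gamma_weight_max a h y : 0 <= a -> 0 < h -> gamma_weight a h y <= (a * h) `^ a * expR (- a).
Proof.
move=> a0 h0; have [y0|y0] := ltP y 0.
  by rewrite gamma_weight_lt0// mulr_ge0 ?powR_ge0 ?expR_ge0.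
rewrite gwE//.
move: a0; rewrite le_eqVlt => /predU1P[<-|a0].
  rewrite !powRr0 !mul1r ler_expR oppr0 oppr_le0 divr_ge0//; exact: ltW.
move: y0; rewrite le_eqVlt => /predU1P[<-|y0].
  by rewrite powR0 ?gt_eqF// mul0r mulr_ge0 ?powR_ge0 ?expR_ge0.
have ah0 : 0 < a * h by rewrite mulr_gt0.
rewrite /powR (gt_eqF y0) (gt_eqF ah0) -!expRD ler_expR.
have u0 : 0 < y / (a * h) by rewrite divr_gt0.
have : ln (y / (a * h)) <= y / (a * h) - 1.
  have := @le_ln1Dx R (y / (a * h) - 1); rewrite addrCA subrr addr0; apply.
  by rewrite ltrBDl subrr.
rewrite ln_div ?posrE// => H.
have := ler_wpM2l (ltW a0) H.
have -> : a * (y / (a * h) - 1) = y / h - a by field; rewrite !gt_eqF.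
lra.
Qed.

(** Half of the exponential is spent on bounding the power, and the other half remains as an
    integrable majorant. *)
Lemma gamma_weight_le_exp a h y : 0 <= a -> 0 < h ->
  gamma_weight a h y <= (a * (2 * h)) `^ a * expR (- a) * (expR (- (y / (2 * h))) * \1_Rp y).
Proof.
move=> a0 h0; have [y0|y0] := ltP y 0.
  by rewrite gamma_weight_lt0// mulr_ge0 ?powR_ge0 ?expR_ge0// mulr_ge0 ?expR_ge0// ?mulr_ge0 ?powR_ge0 ?expR_ge0.
have := @gamma_weight_max a (2 * h) y a0; rewrite mulr_gt0// => /(_ isT) H.
have e0 := expR_ge0 (- (y / (2 * h))).
have -> : gamma_weight a h y = gamma_weight a (2 * h) y * expR (- (y / (2 * h))).
  rewrite !gwE// -mulrA -expRD; congr (_ * expR _); field; exact: lt0r_neq0.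
by rewrite [in leRHS]indicE mem_set ?mulr1 ?ler_wpM2r//= in_itv/= andbT.
Qed.

Lemma integrable_exp0y h : 0 < h -> leb.-integrable setT (fun y => (expR (- (y / h)) * \1_Rp y)%:E).
Proof.
move=> h0; have h10 : 0 < h^-1 by rewrite invr_gt0.
have H := integrableZl measurableT h (integrable_exponential_pdf h10).
apply: (eq_integrable measurableT _ _ _ H) => y _ /=; rewrite -EFinM; congr EFin.
rewrite /exponential_pdf patch_indic /= mulrA mulrA mulfV ?gt_eqF// mul1r.
by rewrite mulNr (mulrC y).
Qed.

Lemma integrable_gw a h : 0 <= a -> 0 < h -> leb.-integrable setT (EFin \o gamma_weight a h).
Proof.
move=> a0 h0; have h20 : 0 < 2 * h by rewrite mulr_gt0.
have i := integrableZl measurableT ((a * (2 * h)) `^ a * expR (- a)) (integrable_exp0y h20).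
apply: (@le_integrable _ _ _ leb _ measurableT _ _ _ _ i).
  by apply/measurable_EFinP; exact: measurable_gamma_weight.
move=> y _; rewrite /= lee_fin (ger0_norm (gamma_weight_ge0 _ _ _)).
by rewrite (le_trans (gamma_weight_le_exp y a0 h0))// ler_norm.
Qed.

Definition gamma_mass a h := \int[leb]_y gamma_weight a h y.

Lemma gamma_mass_ge0 a h : 0 <= gamma_mass a h.
Proof. by apply: Rintegral_ge0 => y _; exact: gamma_weight_ge0. Qed.

Lemma gamma_massE a h : gamma_mass a h = \int[leb]_(y in Rp) (y `^ a * expR (- (y / h))).
Proof.
rewrite Rintegral_mkcond; apply: eq_Rintegral => y _.
by rewrite patch_indic.
Qed.

Lemma is_derive_powR_expR a h y : 0 < y ->
  is_derive y 1 (fun y => y `^ (a + 1) * expR (- (y / h)))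
   ((a + 1) * (y `^ a * expR (- (y / h))) - h^-1 * (y `^ (a + 1) * expR (- (y / h)))).
Proof.
move=> y0.
have dp : is_derive y 1 (fun y => y `^ (a + 1)) ((a + 1) * y `^ a).
  have yi : y \in `]0, +oo[ by rewrite in_itv/= y0.
  apply: DeriveDef; first exact: derivable_powR.
  by rewrite -derive1E powR_derive1// addrK.
apply: is_derive_eq; rewrite /GRing.scale /=; ring.
Qed.

Lemma powR_expR_within a h : 0 <= a ->
  {within Rp, continuous (fun y => y `^ a * expR (- (y / h)))}.
Proof.
move=> a0; have ce : continuous (fun y => expR (- (y / h))).
  move=> y; apply: continuous_comp; last exact: continuous_expR.
  by apply: cvgN; apply: cvgMl; exact: cvg_id.
apply/continuous_within_itvcyP; split.
  move=> y; rewrite in_itv/= andbT => y0; apply: cvgM; last exact: ce.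
  have : {for y, continuous (fun z : R => z `^ a)}.
    apply: differentiable_continuous; apply/derivable1_diffP; apply: derivable_powR.
    by rewrite in_itv/= y0.
  exact.
apply: cvgM; last by apply: cvg_at_right_filter; exact: ce.
move: a0; rewrite le_eqVlt => /predU1P[<-|a0].
  by rewrite powRr0; under eq_cvg do rewrite powRr0; exact: cvg_cst.
by rewrite powR0 ?gt_eqF//; exact: powR_cvg0.
Qed.

Lemma powR_expR_cvg0 a h : 0 <= a -> 0 < h ->
  y `^ a * expR (- (y / h)) @[y --> +oo] --> 0.
Proof.
move=> a0 h0; set C := (a * (2 * h)) `^ a * expR (- a).
apply: (@cvg_le_dist _ _ _ _ _ _ (fun y => C * expR (- (y / (2 * h))))).
  near=> y; have y0 : 0 <= y by near: y; exact: nbhs_pinfty_ge.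
  rewrite subr0 -gwE// ger0_norm ?gamma_weight_ge0// (le_trans (gamma_weight_le_exp y a0 h0))//.
  by rewrite indicE mem_set ?mulr1//= in_itv/= andbT.
rewrite -[X in _ --> X](mulr0 C); apply: cvgMr.
apply: (cvg_comp (fun y : R => y / (2 * h)) (fun y => expR (- y))); last exact: cvgr_expR.
by apply: gt0_cvgMly; [rewrite invr_gt0 mulr_gt0|exact: cvg_id].
Unshelve. all: by end_near. Qed.

Lemma integrable_powR_expR a h : 0 <= a -> 0 < h ->
  leb.-integrable Rp (EFin \o (fun y => y `^ a * expR (- (y / h)))).
Proof.
move=> a0 h0.
have Rpm : measurable (Rp : set (measurableTypeR R)) by exact: measurable_itv.
have H : leb.-integrable Rp (EFin \o gamma_weight a h) by apply: integrableS (integrable_gw a0 h0).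
apply: (eq_integrable _ _ _ _ H); first exact: Rpm.
by move=> y; rewrite inE/= in_itv/= andbT => y0; rewrite /= gwE.
Qed.

(** The functional equation of Gamma: [y ^ (a + 1) * exp (- y / h)] vanishes at 0 and at infinity,
    so its derivative integrates to 0. It is the source of the moments in [kernel_bias]. *)
Lemma gamma_mass_rec a h : 0 <= a -> 0 < h -> gamma_mass (a + 1) h = (a + 1) * h * gamma_mass a h.
Proof.
move=> a0 h0; have a10 : 0 <= a + 1 by rewrite addr_ge0.
have Rpm : measurable (Rp : set (measurableTypeR R)) by exact: measurable_itv.
have iW b (b0 : 0 <= b) := integrable_powR_expR b0 h0.
pose F y := y `^ (a + 1) * expR (- (y / h)).
pose f y := (a + 1) * (y `^ a * expR (- (y / h))) - h^-1 * (y `^ (a + 1) * expR (- (y / h))).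
have ic1 := integrableZl Rpm (a + 1) (iW _ a0).
have ic2 := integrableZl Rpm h^-1 (iW _ a10).
have intf : leb.-integrable Rp (EFin \o f) by exact: (integrableB Rpm ic1 ic2).
have cv : \int[leb]_(y in `[0, n.+1%:R]) f y @[n --> \oo] --> \int[leb]_(y in Rp) f y.
  apply: Rintegral_cvg_set => //.
    by move=> n; exact: subset_itvl.
  move=> y; rewrite /= in_itv/= andbT => y0; near=> n.
  rewrite /= in_itv/= y0/=; apply: (@le_trans _ _ n%:R); last by rewrite ler_nat.
  by near: n; exact: nbhs_infty_ger.
have F0 : F 0 = 0 by rewrite /F powR0 ?mul0r// gt_eqF// ltr_wpDl.
have cF : {within Rp, continuous F} by exact: powR_expR_within.
have cf : {within Rp, continuous f}.
  move=> y; apply: cvgB; apply: cvgMr; exact: powR_expR_within.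
have E n : \int[leb]_(y in `[0, n.+1%:R]) f y = F n.+1%:R.
  have n0 : 0 < n.+1%:R :> R by rewrite ltr0Sn.
  have sub : `[0, n.+1%:R] `<=` Rp by exact: subset_itvl.
  rewrite /Rintegral (@continuous_FTC2 _ f F)//.
  - by rewrite F0 sube0.
  - exact: continuous_subspaceW sub cf.
  - have := continuous_subspaceW sub cF => /(continuous_within_itvP _ n0)[_ cl cr].
    split => // y; rewrite in_itv/= => /andP[y0 _].
    by have [] := is_derive_powR_expR a h y0.
  - move=> y; rewrite in_itv/= => /andP[y0 _]; rewrite derive1E.
    by have [_ ->] := is_derive_powR_expR a h y0.
have nS : (n.+1%:R : R) @[n --> \oo] --> +oo.
  apply/cvgryPge => B; near=> n; apply: (@le_trans _ _ n%:R); last by rewrite ler_nat.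
  by near: n; exact: nbhs_infty_ger.
move: cv; under eq_cvg do rewrite E; move=> cv.
have cv0 : F n.+1%:R @[n --> \oo] --> (0 : R) by exact: cvg_comp nS (powR_expR_cvg0 a10 h0).
have : \int[leb]_(y in Rp) f y = 0 by rewrite -(cvg_lim _ cv)// (cvg_lim _ cv0).
rewrite /f RintegralB// RintegralZl ?RintegralZl//; [|exact: iW..].
rewrite -!gamma_massE => /eqP; rewrite subr_eq0 => /eqP H.
by rewrite mulrAC H mulrAC mulVf ?mul1r// gt_eqF.
Unshelve. all: by end_near. Qed.

Lemma Gamma_gamma_mass a : Gamma (a + 1) = gamma_mass a 1.
Proof.
rewrite gamma_massE /Gamma; apply: eq_Rintegral => y _.
by rewrite addrK divr1.
Qed.

Lemma gamma_mass_scale a h : 0 <= a -> 0 < h -> gamma_mass a h = h `^ (a + 1) * gamma_mass a 1.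
Proof.
move=> a0 h0; rewrite [in RHS]gamma_massE -RintegralZl//; last exact: integrable_powR_expR.
rewrite gamma_massE /Rintegral; congr fine.
pose F (t : R) := h * t.
have dF (t : R) : is_derive t 1 F h.
  by apply: is_derive_eq; rewrite /GRing.scale /=; ring.
have F' : F^`()%classic = cst h.
  by apply/funext => t; rewrite derive1E; have [_ ->] := dF t.
have F0 : F 0 = 0 by rewrite /F mulr0.
have := @increasing_ge0_integration_by_substitutiony R F (fun y => y `^ a * expR (- (y / h))) 0.
rewrite F' F0 => ->.
- apply: eq_integral => t; rewrite inE/= in_itv/= andbT => t0; congr EFin.
  change (((h * t) `^ a * expR (- (h * t / h))) * h = h `^ (a + 1) * (t `^ a * expR (- (t / 1)))).
  rewrite powRM ?(ltW h0)// powRD; last by rewrite (gt_eqF h0) implybT.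
  have -> : h * t / h = t by field; exact: lt0r_neq0.
  by rewrite powRr1 ?ltW// divr1; ring.
- by move=> y z _ _; rewrite /F ltr_pM2l.
- by move=> y _; exact: cvg_cst.
- exact: is_cvg_cst.
- exact: is_cvg_cst.
- split; first by move=> y _; have [] := dF y.
  by apply: cvg_at_right_filter; apply: cvgMr; exact: cvg_id.
- by apply: gt0_cvgMry; [|exact: cvg_id].
- exact: powR_expR_within.
- by move=> y _; rewrite mulr_ge0 ?powR_ge0 ?expR_ge0.
Qed.

(** On [1, 2] the power is at least 1 and the exponential at least [expR (- (2 / h))]. *)
Lemma gamma_mass_gt0 a h : 0 <= a -> 0 < h -> 0 < gamma_mass a h.
Proof.
move=> a0 h0; apply: (@lt_le_trans _ _ (expR (- (2 / h)))); first exact: expR_gt0.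
have H : lebesgue_measure `[(1 : R), 2]%classic = 1%E.
  by rewrite lebesgue_measure_itv /= lte_fin ltr1n -EFinD; congr EFin; lra.
have m12 : measurable (`[(1 : R), 2]%classic : set (measurableTypeR R)) by exact: measurable_itv.
have -> : expR (- (2 / h)) = \int[leb]_y (expR (- (2 / h)) * \1_(`[(1 : R), 2]%classic) y).
  rewrite RintegralZl//; last exact: integrable_indic_itv.
  by rewrite /Rintegral integral_indic// setIT [X in fine X]H /= mulr1.
apply: le_Rintegral => //.
- exact: (integrableZl measurableT (expR (- (2 / h))) (@integrable_indic_itv R 1 2 true false)).
- exact: integrable_gw.
- move=> y _; rewrite indicE; have [|_] := boolP (y \in _); last by rewrite mulr0 gamma_weight_ge0.
  rewrite inE/= in_itv/= => /andP[y1 y2]; rewrite mulr1 gwE; last by lra.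
  rewrite -[leLHS]mul1r ler_pM ?expR_ge0//.
    by rewrite -(powRr0 y) ler_powR.
  by rewrite ler_expR lerN2 ler_pM2r// invr_gt0.
Qed.

Lemma gamma_pdfE a h y : 0 <= a -> 0 < h -> gamma_pdf (a + 1) h y = (gamma_mass a h)^-1 * gamma_weight a h y.
Proof.
move=> a0 h0; rewrite /gamma_pdf Gamma_gamma_mass addrK (gamma_mass_scale a0 h0) /gamma_weight.
by rewrite (mulrC (gamma_mass a 1)) !mulrA.
Qed.

Lemma gamma_pdf_mass a h : 0 <= a -> 0 < h -> \int[leb]_y gamma_pdf (a + 1) h y = 1.
Proof.
move=> a0 h0; under eq_Rintegral do rewrite gamma_pdfE//.
by rewrite RintegralZl ?mulVf ?gt_eqF ?gamma_mass_gt0//; exact: integrable_gw.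
Qed.

Lemma integrable_gamma_pdf a h : 0 <= a -> 0 < h ->
  leb.-integrable setT (EFin \o gamma_pdf (a + 1) h).
Proof.
move=> a0 h0; have := integrableZl measurableT (gamma_mass a h)^-1 (integrable_gw a0 h0).
by rewrite (funext (fun y => gamma_pdfE y a0 h0)).
Qed.

Lemma gamma_pdf_subdensity a h : 0 <= a -> 0 < h -> subdensity (gamma_pdf (a + 1) h).
Proof.
move=> a0 h0; split.
- have /integrableP[/measurable_EFinP] := integrable_gamma_pdf a0 h0; exact.
- by move=> y; rewrite gamma_pdfE// mulr_ge0 ?gamma_weight_ge0// invr_ge0 gamma_mass_ge0.
- have /integrable_fin_num H := integrable_gamma_pdf a0 h0.
  by rewrite -[leLHS]fineK ?H// [X in X%:E](gamma_pdf_mass a0 h0).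
Qed.

Lemma gamma_pdf_max a h y : 0 <= a -> 0 < h ->
  gamma_pdf (a + 1) h y <= (a * h) `^ a * expR (- a) / gamma_mass a h.
Proof.
move=> a0 h0; rewrite gamma_pdfE// mulrC ler_wpM2r ?invr_ge0 ?gamma_mass_ge0//.
exact: gamma_weight_max.
Qed.

Lemma bmf_gamma_pdf a h : 0 <= a -> 0 < h -> bmf (gamma_pdf (a + 1) h).
Proof.
move=> a0 h0; have [m p0 _] := gamma_pdf_subdensity a0 h0; split => //.
by eexists => y; rewrite ger0_norm//; exact: gamma_pdf_max.
Qed.

Lemma gamma_weight_mul a h y : 0 <= a -> y * gamma_weight a h y = gamma_weight (a + 1) h y.
Proof.
move=> a0; have [y0|] := ltP y 0; first by rewrite !gamma_weight_lt0// mulr0.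
rewrite le_eqVlt => /predU1P[<-|y0].
  by rewrite mul0r gwE// powR0 ?mul0r// gt_eqF// ltr_wpDl.
rewrite !gwE ?ltW// powRD; last by rewrite (gt_eqF y0) implybT.
by rewrite powRr1 ?ltW//; ring.
Qed.

(** Multiplying by [y] raises the shape by one, so [gamma_mass_rec] gives the moments [x + h] and
    [(x + 2 * h) * (x + h)]; hence [h] for the mean of [y - x] and [x * h + 2 * h ^+ 2] for that of
    its square. *)
Lemma kernel_bias (u : R -> R) (x h D M : R) : 0 <= x -> 0 < h -> bmf u ->
  (forall y, 0 <= y -> `|u y - u x - D * (y - x)| <= M * (y - x) ^+ 2) ->
  `|avg (gamma_pdf (x / h + 1) h) u - u x| <= `|D| * h + M * (x * h + 2 * h ^+ 2).
Proof.
move=> x0 h0 bu Hu; set a := x / h; have a0 : 0 <= a by rewrite divr_ge0// ltW.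
have J0 := gamma_mass_gt0 a0 h0.
have sK := gamma_pdf_subdensity a0 h0.
set K := gamma_pdf (a + 1) h in sK *.
have KE y : K y = (gamma_mass a h)^-1 * gamma_weight a h y by exact: gamma_pdfE.
have a10 : 0 <= a + 1 by lra.
have a20 : 0 <= a + 1 + 1 by lra.
have E1 y : y * K y = (gamma_mass a h)^-1 * gamma_weight (a + 1) h y by rewrite KE mulrCA gamma_weight_mul.
have E2 y : y ^+ 2 * K y = (gamma_mass a h)^-1 * gamma_weight (a + 1 + 1) h y.
  by rewrite expr2 -mulrA E1 mulrCA gamma_weight_mul.
have i1 : leb.-integrable setT (fun y => (y * K y)%:E).
  have := integrableZl measurableT (gamma_mass a h)^-1 (integrable_gw a10 h0).
  by under [X in _ -> integrable _ _ X]eq_fun do rewrite E1.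
have i2 : leb.-integrable setT (fun y => (y ^+ 2 * K y)%:E).
  have := integrableZl measurableT (gamma_mass a h)^-1 (integrable_gw a20 h0).
  by under [X in _ -> integrable _ _ X]eq_fun do rewrite E2.
have i0 := subdensity_integrable sK.
have m0 : \int[leb]_y K y = 1 by exact: gamma_pdf_mass.
have ah : a * h = x by rewrite /a; field; exact: lt0r_neq0.
have m1 : \int[leb]_y (y * K y) = x + h.
  under eq_Rintegral do rewrite E1.
  rewrite RintegralZl ?[X in _ * X]gamma_mass_rec//; last exact: integrable_gw.
  by rewrite mulrCA mulVf ?mulr1 ?gt_eqF//; lra.
have m2 : \int[leb]_y (y ^+ 2 * K y) = (x + 2 * h) * (x + h).
  under eq_Rintegral do rewrite E2.
  rewrite RintegralZl ?[X in _ * X]gamma_mass_rec ?gamma_mass_rec//; last exact: integrable_gw.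
  rewrite -ah; field; exact: lt0r_neq0.
have iu := avg_integrable sK bu.
have ic c : leb.-integrable setT (fun y => (c * K y)%:E) by exact: (integrableZl measurableT c i0).
have ic1 c : leb.-integrable setT (fun y => (c * (y * K y))%:E) by exact: (integrableZl measurableT c i1).
have ic2 c : leb.-integrable setT (fun y => (c * (y ^+ 2 * K y))%:E) by exact: (integrableZl measurableT c i2).
pose rem y := (u y * K y - (u x - D * x) * K y) - D * (y * K y).
have irem0 : leb.-integrable setT (fun y => (u y * K y - (u x - D * x) * K y)%:E).
  exact: (integrableB measurableT iu (ic _)).
have irem : leb.-integrable setT (EFin \o rem) by exact: (integrableB measurableT irem0 (ic1 D)).
have Erem : \int[leb]_y rem y = avg K u - u x - D * h.
  rewrite (RintegralB measurableT irem0 (ic1 D)) (RintegralB measurableT iu (ic _)).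
  rewrite (RintegralZl _ measurableT i0) (RintegralZl _ measurableT i1) m0 m1 /avg; lra.
pose bd y := (M * (y ^+ 2 * K y) - 2 * M * x * (y * K y)) + M * x ^+ 2 * K y.
have ibd0 : leb.-integrable setT (fun y => (M * (y ^+ 2 * K y) - 2 * M * x * (y * K y))%:E).
  exact: (integrableB measurableT (ic2 _) (ic1 _)).
have ibd : leb.-integrable setT (EFin \o bd) by exact: (integrableD measurableT ibd0 (ic _)).
have Ebd : \int[leb]_y bd y = M * (x * h + 2 * h ^+ 2).
  rewrite (RintegralD measurableT ibd0 (ic _)) (RintegralB measurableT (ic2 _) (ic1 _)).
  rewrite (RintegralZl _ measurableT i0) (RintegralZl _ measurableT i1) (RintegralZl _ measurableT i2).
  by rewrite m0 m1 m2; lra.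
have Hrem : `|\int[leb]_y rem y| <= \int[leb]_y bd y.
  apply: (le_trans (le_normr_Rintegral measurableT irem)).
  apply: le_Rintegral => //; first exact: (integrable_norm irem).
  (* The Taylor bound is assumed on the half-line only; to its left the kernel vanishes. *)
  move=> y _; have [y0|y0] := ltP y 0.
    by rewrite /rem /bd KE gamma_weight_lt0// !mulr0 !subr0 normr0 add0r.
  have K0 : 0 <= K y by have [] := sK.
  have -> : rem y = (u y - u x - D * (y - x)) * K y by rewrite /rem; ring.
  have -> : bd y = M * (y - x) ^+ 2 * K y by rewrite /bd; ring.
  by rewrite normrM (ger0_norm K0) ler_wpM2r// Hu.
rewrite Erem Ebd in Hrem.
have -> : avg K u - u x = (avg K u - u x - D * h) + D * h by ring.
rewrite (le_trans (ler_normD _ _))// addrC lerD// normrM (ger0_norm (ltW h0))//.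
Qed.

(** Squaring doubles [x / h] and [1 / h], which is halving [h] with [x] kept: the square still
    concentrates at [x]. *)
Lemma gamma_pdf_sqr x h y : 0 <= x -> 0 < h ->
  gamma_pdf (x / h + 1) h y ^+ 2 =
  gamma_mass (x / (h / 2)) (h / 2) / gamma_mass (x / h) h ^+ 2 * gamma_pdf (x / (h / 2) + 1) (h / 2) y.
Proof.
move=> x0 h0; have h20 : 0 < h / 2 by rewrite divr_gt0.
have a0 : 0 <= x / h by rewrite divr_ge0// ltW.
have a20 : 0 <= x / (h / 2) by rewrite divr_ge0// ltW.
rewrite !gamma_pdfE//.
have -> : gamma_weight (x / (h / 2)) (h / 2) y = gamma_weight (x / h) h y ^+ 2.
  have [y0|y0] := ltP y 0; first by rewrite !gamma_weight_lt0// expr0n.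
  rewrite !gwE// exprMn -expRM_natl -mulr_natl -powR_mulrn ?powR_ge0// -powRrM.
  by congr (_ `^ _ * expR _); field; exact: lt0r_neq0.
field; rewrite !lt0r_neq0//; exact: gamma_mass_gt0.
Qed.

End gamma_kernel.

(** * Stirling's formula *)

Section logarithm.
Context {R : realType}.
Implicit Types v : R.

Lemma derive_ge0_le (F F' : R -> R) (b c : R) : b <= c ->
  (forall y : R, b <= y <= c -> is_derive y 1 F (F' y)) ->
  (forall y, b <= y <= c -> 0 <= F' y) -> F b <= F c.
Proof.
move=> bc dF F'0.
have dF' (y : R) : y \in `]b, c[ -> is_derive y 1 F (F' y).
  by rewrite in_itv/= => /andP[/ltW ? /ltW ?]; apply: dF; apply/andP.
have cF : {within `[b, c], continuous F}.
  by apply: derivable_within_continuous => y; rewrite in_itv/= => H; have [] := dF y H.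
have [z] := MVT_segment bc dF' cF.
rewrite in_itv/= => zbc H; rewrite -subr_ge0 H mulr_ge0 ?F'0// subr_ge0//.
Qed.

Let dln (v : R) : -1 < v -> is_derive v 1 (fun v : R => ln (1 + v)) (1 + v)^-1.
Proof.
move=> v1; have v0 : 0 < 1 + v by lra.
have d1 := is_derive1_ln v0.
have d2 : is_derive v 1 (fun v : R => 1 + v) 1.
  by apply: is_derive_eq; lra.
by have := is_derive1_comp d1 d2; rewrite mulr1.
Qed.

Let dinv (v : R) : -1 < v -> is_derive v 1 (fun v : R => (1 + v)^-1) (- (1 + v) ^- 2).
Proof.
move=> v1; have v0 : 1 + v != 0 by apply: lt0r_neq0; lra.
have d2 : is_derive v 1 (fun v : R => 1 + v) 1.
  by apply: is_derive_eq; lra.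
by have := is_deriveV v0 d2; rewrite /GRing.scale /= mulr1.
Qed.

(* [lnE] and [lnD] are nondecreasing and vanish at 0. *)
Definition lnE v := ln (1 + v) - v + v ^+ 2 / 2.
Definition lnD v := v - (v - 1 + (1 + v)^-1) / 2 - ln (1 + v).

Lemma lnE_ndecr (b c : R) : -1 < b -> b <= c -> lnE b <= lnE c.
Proof.
move=> b1 bc; apply: (@derive_ge0_le lnE (fun v => (1 + v)^-1 - 1 + v)) => //.
  move=> y /andP[yb yc]; have d := dln (lt_le_trans b1 yb).
  by apply: is_derive_eq; rewrite /GRing.scale /=; lra.
move=> y /andP[yb yc]; have y0 : 0 < 1 + y by lra.
have -> : (1 + y)^-1 - 1 + y = y ^+ 2 / (1 + y) by field; exact: lt0r_neq0.
by rewrite divr_ge0 ?sqr_ge0// ltW.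
Qed.

Lemma lnD_ndecr (b c : R) : -1 < b -> b <= c -> lnD b <= lnD c.
Proof.
move=> b1 bc; apply: (@derive_ge0_le lnD (fun v => 1 - (1 - (1 + v) ^- 2) / 2 - (1 + v)^-1)) => //.
  move=> y /andP[yb yc]; have d := dln (lt_le_trans b1 yb); have d' := dinv (lt_le_trans b1 yb).
  by apply: is_derive_eq; rewrite /GRing.scale /=; lra.
move=> y /andP[yb yc]; have y0 : 0 < 1 + y by lra.
have -> : 1 - (1 - (1 + y) ^- 2) / 2 - (1 + y)^-1 = y ^+ 2 / (1 + y) ^+ 2 / 2.
  by field; exact: lt0r_neq0.
by rewrite !divr_ge0 ?sqr_ge0.
Qed.

Let lnE0 : lnE 0 = 0. Proof. by rewrite /lnE addr0 ln1; lra. Qed.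
Let lnD0 : lnD 0 = 0. Proof. by rewrite /lnD addr0 ln1 invr1; lra. Qed.

Lemma lnD_E v : -1 < v -> lnE v + lnD v = v ^+ 2 / 2 * (v / (1 + v)).
Proof.
move=> v1; rewrite /lnE /lnD.
have -> : ln (1 + v) - v + v ^+ 2 / 2 + (v - (v - 1 + (1 + v)^-1) / 2 - ln (1 + v)) =
   v ^+ 2 / 2 - (v - 1 + (1 + v)^-1) / 2 by lra.
by field; apply: lt0r_neq0; lra.
Qed.

(** [lnE] and [lnD] have the same sign at [v], so each is at most their sum in absolute value, and
    by [lnD_E] that sum is of third order. *)
Lemma norm_lnE v : -1 < v -> `|lnE v| <= v ^+ 2 / 2 * (`|v| / (1 + v)).
Proof.
move=> v1; have v10 : 0 < 1 + v by lra.
have H := lnD_E v1.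
have [v0|v0] := leP 0 v.
  have e := lnE_ndecr (ltrN10 R) v0; have d := lnD_ndecr (ltrN10 R) v0.
  rewrite lnE0 in e; rewrite lnD0 in d; rewrite !ger0_norm// -H; lra.
have e := lnE_ndecr v1 (ltW v0); have d := lnD_ndecr v1 (ltW v0).
rewrite lnE0 in e; rewrite lnD0 in d; rewrite (ler0_norm e) (ltr0_norm v0).
rewrite mulNr mulrN -H; lra.
Qed.

Lemma ln1D_le_neg v : -1 < v -> v <= 0 -> ln (1 + v) - v <= - (v ^+ 2 / 2).
Proof. by move=> v1 v0; have := lnE_ndecr v1 v0; rewrite lnE0 /lnE; lra. Qed.

(** Purely quadratic decay fails for large [v]; the denominator [1 + v] weakens it to a linear one,
    which is enough for an integrable majorant. *)
Lemma ln1D_le_pos v : 0 <= v -> ln (1 + v) - v <= - (v ^+ 2 / (2 * (1 + v))).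
Proof.
move=> v0; have := lnD_ndecr (ltrN10 R) v0; rewrite lnD0 /lnD.
have -> : v ^+ 2 / (2 * (1 + v)) = (v - 1 + (1 + v)^-1) / 2.
  by field; apply: lt0r_neq0; lra.
lra.
Qed.

End logarithm.

(** * Laplace's method for the Gamma integral *)

Section stirling.
Context {R : realType}.
Notation leb := (@lebesgue_measure R).
Implicit Types a u : R.

(** Keeping this exact ratio turns the kernel constants into identities in which all powers cancel
    before any limit is taken. *)
Definition stirling_ratio a := gamma_mass a 1 / (a `^ a * expR (- a) * Num.sqrt a).

(* The Gamma integrand after the substitution [t = a + sqrt a * u]. *)
Definition stirling_fun a u :=
  (1 + u / Num.sqrt a) `^ a * expR (- (Num.sqrt a * u)) * \1_(`[- Num.sqrt a, +oo[%classic) u.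

Lemma stirling_funE a u : 0 < a -> - Num.sqrt a < u ->
  stirling_fun a u = expR (a * (ln (1 + u / Num.sqrt a) - u / Num.sqrt a)).
Proof.
move=> a0 ua; have s0 : 0 < Num.sqrt a by rewrite sqrtr_gt0.
rewrite /stirling_fun indicE mem_set ?mulr1; last by rewrite /= in_itv/= andbT ltW.
have v0 : 0 < 1 + u / Num.sqrt a.
  have -> : 1 + u / Num.sqrt a = (u + Num.sqrt a) / Num.sqrt a.
    by field; exact: lt0r_neq0.
  by rewrite divr_gt0//; lra.
rewrite /powR (gt_eqF v0) -expRD; congr expR; rewrite mulrBr; congr (_ - _).
rewrite -[X in _ = X * _](@sqr_sqrtr _ a) ?ltW//.
by field; exact: lt0r_neq0.
Qed.

Lemma stirling_fun_le0 a u : 0 < a -> u <= - Num.sqrt a -> stirling_fun a u = 0.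
Proof.
move=> a0; have s0 : 0 < Num.sqrt a by rewrite sqrtr_gt0.
rewrite le_eqVlt => /predU1P[->|ua].
  rewrite /stirling_fun mulNr mulfV ?gt_eqF// subrr powR0 ?gt_eqF//.
  by rewrite !mul0r.
rewrite /stirling_fun indicE memNset ?mulr0//= in_itv/= andbT.
by apply/negP; rewrite -ltNge.
Qed.

Lemma stirling_fun_ge0 a u : 0 <= stirling_fun a u.
Proof. by rewrite /stirling_fun mulr_ge0// mulr_ge0 ?powR_ge0 ?expR_ge0. Qed.

(** A majorant free of [a]. For [u >= 0], [1 <= a] gives [v <= u], and [u ^+ 2 / (2 * (1 + u))] is
    at least [(u - 1) / 2]; for [u < 0], the exponent is at most [- (u ^+ 2 / 2)], itself at most
    [(1 - |u|) / 2]. *)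
Lemma stirling_fun_le a u : 1 <= a -> stirling_fun a u <= expR (2^-1) * expR (- (`|u| / 2)).
Proof.
move=> a1; have a0 : 0 < a by lra.
have s0 : 0 < Num.sqrt a by rewrite sqrtr_gt0.
have s1 : 1 <= Num.sqrt a by rewrite -[leLHS]sqrtr1 ler_sqrt//; lra.
have aE : a = Num.sqrt a ^+ 2 by rewrite sqr_sqrtr// ltW.
have [ua|ua] := leP u (- Num.sqrt a).
  by rewrite stirling_fun_le0// mulr_ge0 ?expR_ge0.
rewrite stirling_funE// -expRD ler_expR.
set v := u / Num.sqrt a.
have uv : u = Num.sqrt a * v by rewrite /v; field; exact: lt0r_neq0.
have v1 : -1 < v by rewrite /v ltr_pdivlMr// mulN1r.
clearbody v.
have u2 : a * v ^+ 2 = u ^+ 2 by rewrite [in RHS]uv exprMn sqr_sqrtr// ltW.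
have [v0|v0] := leP 0 v.
  have u0 : 0 <= u by rewrite uv mulr_ge0// ltW.
  have vu : v <= u by rewrite uv ler_peMl.
  have h1 := ler_wpM2l (ltW a0) (ln1D_le_pos v0); apply: (le_trans h1).
  rewrite ger0_norm//.
  have -> : a * - (v ^+ 2 / (2 * (1 + v))) = - (u ^+ 2 / (2 * (1 + v))).
    by rewrite mulrN mulrA u2.
  have : u ^+ 2 / (2 * (1 + u)) <= u ^+ 2 / (2 * (1 + v)).
    rewrite ler_wpM2l ?sqr_ge0// lef_pV2 ?posrE; lra.
  have : (u - 1) / 2 <= u ^+ 2 / (2 * (1 + u)).
    by rewrite ler_pdivlMr; [have := sqr_ge0 u; lra|lra].
  lra.
have u0 : u < 0 by rewrite uv pmulr_rlt0.
have h1 := ler_wpM2l (ltW a0) (ln1D_le_neg v1 (ltW v0)); apply: (le_trans h1).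
rewrite ltr0_norm// mulrN mulrA u2.
by have := sqr_ge0 (u + 2^-1); lra.
Qed.

Lemma measurable_stirling_fun a : measurable_fun setT (stirling_fun a).
Proof.
apply: measurable_funM; last exact: measurable_indic.
apply: measurable_funM.
  apply: (measurableT_comp (measurable_powR _)).
  by apply: measurable_funD => //; exact: measurable_funM.
by apply: measurableT_comp => //; apply: measurableT_comp => //; exact: measurable_funM.
Qed.

Lemma integrable_exp_abs : leb.-integrable setT (fun u => (expR (2^-1) * expR (- (`|u| / 2)))%:E).
Proof.
suff : leb.-integrable setT (EFin \o (fun u : R => expR (- (`|u| / 2)))).
  exact: (integrableZl measurableT (expR 2^-1)).
have cont : continuous (fun u : R => expR (- (`|u| / 2))).
  move=> u; apply: continuous_comp; last exact: continuous_expR.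
  by apply: cvgN; apply: cvgMl; exact: norm_continuous.
apply/integrableP; split; first by apply/measurable_EFinP; exact: continuous_measurable_fun.
under eq_integral do rewrite /= ger0_norm ?expR_ge0//.
rewrite (@ge0_symfun_integralT R (fun u : R => expR (- (`|u| / 2))))//; last first.
  by move=> u; rewrite /= normrN.
have h20 : (0 : R) < 2 by [].
have := integrable_exp0y h20 => /integrableP[_].
under eq_integral do rewrite /= ger0_norm ?mulr_ge0 ?expR_ge0//.
move=> H; rewrite [X in (_ * X)%E](_ : _ = \int[leb]_y (expR (- (y / 2)) * \1_(`[0, +oo[%classic : set R) y)%:E)%E.
  move: H; rewrite -ge0_fin_numE; last first.
    by apply: integral_ge0 => y _; rewrite lee_fin mulr_ge0 ?expR_ge0.
  by move=> H; rewrite -(fineK H) -EFinM ltry.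
rewrite integral_mkcond; apply: eq_integral => y _.
rewrite epatch_indic/= -EFinM; congr EFin.
rewrite !indicE; have [y0|y0] := leP 0 y.
  by rewrite ger0_norm// !mem_set//= in_itv/= andbT.
by rewrite !memNset ?mulr0//= ?in_itv/= ?andbT; apply/negP; rewrite -ltNge.
Qed.

Lemma integrable_stirling_fun a : 1 <= a -> leb.-integrable setT (EFin \o stirling_fun a).
Proof.
move=> a1; apply: (@le_integrable _ _ _ leb _ measurableT _ _ _ _ integrable_exp_abs).
  by apply/measurable_EFinP; exact: measurable_stirling_fun.
move=> u _; rewrite /= lee_fin (ger0_norm (stirling_fun_ge0 _ _)).
by rewrite (le_trans (stirling_fun_le u a1))// ler_norm.
Qed.

Lemma stirling_ratioE a : 1 <= a -> stirling_ratio a = \int[leb]_u stirling_fun a u.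
Proof.
move=> a1; have a0 : 0 < a by lra.
have s0 : 0 < Num.sqrt a by rewrite sqrtr_gt0.
pose C := a `^ a * expR (- a) * Num.sqrt a.
have C0 : 0 < C by rewrite mulr_gt0// mulr_gt0 ?powR_gt0 ?expR_gt0.
suff E : gamma_mass a 1 = C * \int[leb]_u stirling_fun a u.
  by rewrite /stirling_ratio -/C E mulrC mulKf// gt_eqF.
rewrite -RintegralZl//; last exact: integrable_stirling_fun.
rewrite gamma_massE /Rintegral; congr fine.
pose F (u : R) := a + Num.sqrt a * u.
have dF (t : R) : is_derive t 1 F (Num.sqrt a).
  by apply: is_derive_eq; rewrite /GRing.scale /=; ring.
have F' : F^`()%classic = cst (Num.sqrt a).
  by apply/funext => t; rewrite derive1E; have [_ ->] := dF t.
have F0 : F (- Num.sqrt a) = 0 by rewrite /F mulrN -expr2 sqr_sqrtr ?subrr// ltW.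
have := @increasing_ge0_integration_by_substitutiony R F (fun y => y `^ a * expR (- (y / 1))) (- Num.sqrt a).
rewrite F' F0 => ->.
- rewrite [LHS]integral_mkcond; apply: eq_integral => u _.
  rewrite epatch_indic/= -EFinM; congr EFin.
  change ((a + Num.sqrt a * u) `^ a * expR (- ((a + Num.sqrt a * u) / 1)) * Num.sqrt a *
    \1_(`[- Num.sqrt a, +oo[%classic : set R) u = C * stirling_fun a u).
  have [ua|ua] := ltP u (- Num.sqrt a).
    rewrite (stirling_fun_le0 a0 (ltW ua)) indicE memNset ?mulr0//= in_itv/= andbT.
    by apply/negP; rewrite -ltNge.
  have asa : a = Num.sqrt a * Num.sqrt a by rewrite -expr2 sqr_sqrtr// ltW.
  have asu : a * (u / Num.sqrt a) = Num.sqrt a * u.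
    by rewrite {1}asa; field; exact: lt0r_neq0.
  have -> : a + Num.sqrt a * u = a * (1 + u / Num.sqrt a).
    by rewrite mulrDr mulr1 asu.
  rewrite powRM ?(ltW a0)//; last first.
    have -> : 1 + u / Num.sqrt a = (u + Num.sqrt a) / Num.sqrt a.
      by field; exact: lt0r_neq0.
    by rewrite divr_ge0//; lra.
  rewrite /stirling_fun /C.
  have -> : expR (- (a * (1 + u / Num.sqrt a) / 1)) = expR (- a) * expR (- (Num.sqrt a * u)).
    rewrite -expRD; congr expR.
    by rewrite divr1 mulrDr mulr1 opprD asu.
  ring.
- by move=> y z _ _ yz; rewrite /F ltrD2l ltr_pM2l.
- by move=> y _; exact: cvg_cst.
- exact: is_cvg_cst.
- exact: is_cvg_cst.
- split; first by move=> y _; have [] := dF y.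
  apply: cvg_at_right_filter; apply: cvgD; first exact: cvg_cst.
  by apply: cvgMr; exact: cvg_id.
- have : Num.sqrt a * y @[y --> +oo] --> +oo by apply: gt0_cvgMry; [|exact: cvg_id].
  move=> /cvgryPge Hy; apply/cvgryPge => B.
  by apply: filterS (Hy (B - a)) => y; rewrite /F lerBlDl.
- by apply: powR_expR_within; exact: ltW.
- by move=> y _; rewrite mulr_ge0 ?powR_ge0 ?expR_ge0.
Qed.

Lemma integral_exp_sqr : \int[leb]_u expR (- (u ^+ 2 / 2)) = Num.sqrt (2 * pi).
Proof.
have n1 : (1 : R) != 0 by exact: oner_neq0.
have H : \int[leb]_u normal_pdf 0 1 u = 1 by rewrite /Rintegral [X in fine X](integral_normal_pdf 0 1).
have p0 := normal_peak_gt0 n1.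
have E (u : R) : expR (- (u ^+ 2 / 2)) = (normal_peak 1)^-1 * normal_pdf 0 1 u.
  rewrite normal_pdfE// mulKf ?gt_eqF// /normal_fun; congr expR.
  by rewrite subr0 expr1n mulNr -mulr_natr mul1r.
under eq_Rintegral do rewrite E.
rewrite RintegralZl ?H ?mulr1//; last exact: integrable_normal_pdf.
by rewrite /normal_peak invrK expr1n mul1r -mulr_natl.
Qed.

(** With [v = u / Num.sqrt (a n)] the exponent is [- (u ^+ 2 / 2) + a n * lnE v], and [norm_lnE]
    bounds the last term by [u ^+ 2 / 2] times a quantity tending to 0. *)
Lemma stirling (a : nat -> R) : (forall n, 1 <= a n) ->
  (Num.sqrt (a n))^-1 @[n --> \oo] --> 0 ->
  stirling_ratio (a n) @[n --> \oo] --> Num.sqrt (2 * pi).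
Proof.
move=> a1 a0; under eq_cvg do rewrite stirling_ratioE//.
rewrite -integral_exp_sqr.
apply: (@Rdominated_cvg _ _ _ leb _ _ _ (fun u => expR (2^-1) * expR (- (`|u| / 2)))) => //.
- by move=> n; exact: measurable_stirling_fun.
- have : measurable_fun [set: R] (fun u : R => expR (- (u ^+ 2 / 2))).
    apply: measurableT_comp => //; apply: measurableT_comp => //.
    by apply: measurable_funM => //; exact: measurable_funX.
  exact.
- apply: aeW => u _.
  have v0 : u / Num.sqrt (a n) @[n --> \oo] --> (0 : R).
    by rewrite -[X in _ --> X](mulr0 u); exact: cvgMr.
  have e0 : a n * lnE (u / Num.sqrt (a n)) @[n --> \oo] --> (0 : R).
    apply: (@cvg_le_dist _ _ _ _ _ _ (fun n => u ^+ 2 / 2 * (`|u / Num.sqrt (a n)| / (1 + u / Num.sqrt (a n))))).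
      have : \forall n \near \oo, -1 < u / Num.sqrt (a n).
        by apply: (cvgr_gt 0 v0); rewrite ltrN10.
      apply: filterS => n H; rewrite subr0 normrM ger0_norm; last by have := a1 n; lra.
      have an0 : 0 < a n by have := a1 n; lra.
      have := ler_wpM2l (ltW an0) (norm_lnE H); rewrite mulrA.
      rewrite [X in _ -> _ <= X * _](_ : _ = a n * ((u / Num.sqrt (a n)) ^+ 2 / 2))//.
      rewrite exprMn exprVn sqr_sqrtr ?ltW//; field; exact: lt0r_neq0.
    rewrite -[X in _ --> X](mulr0 (u ^+ 2 / 2)); apply: cvgMr.
    rewrite -[X in _ --> X](mul0r (1 + 0)^-1); apply: cvgM.
      by rewrite -[X in _ --> X](@normr0 _ R); exact: cvg_norm.
    by apply: cvgV; [rewrite addr0 oner_neq0|apply: cvgD; [exact: cvg_cst|]].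
  have : expR (- (u ^+ 2 / 2) + a n * lnE (u / Num.sqrt (a n))) @[n --> \oo] --> expR (- (u ^+ 2 / 2)).
    apply: continuous_cvg; first exact: continuous_expR.
    by rewrite -[X in _ --> X]addr0; apply: cvgD => //; exact: cvg_cst.
  apply: cvg_trans; apply: near_eq_cvg.
  have : \forall n \near \oo, -1 < u / Num.sqrt (a n).
    by apply: (cvgr_gt 0 v0); rewrite ltrN10.
  apply: filterS => n H.
  have an0 : 0 < a n by have := a1 n; lra.
  have s0 : 0 < Num.sqrt (a n) by rewrite sqrtr_gt0.
  rewrite stirling_funE//; last by move: H; rewrite ltr_pdivlMr// mulN1r.
  congr expR; rewrite /lnE mulrDr [X in _ + (_ + X)](_ : _ = u ^+ 2 / 2); first by lra.
  rewrite exprMn exprVn sqr_sqrtr ?ltW//; field; exact: lt0r_neq0.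
- exact: integrable_exp_abs.
- move=> n u _; rewrite ger0_norm ?stirling_fun_ge0//; exact: stirling_fun_le.
Qed.

End stirling.

(** * Size of the kernel and of its square *)

Section kernel_asymptotics.
Context {R : realType}.
Implicit Types a h x : R.

Lemma gamma_mass_stirling a h : 0 < a -> 0 < h ->
  gamma_mass a h = h `^ a * h * (stirling_ratio a * (a `^ a * expR (- a) * Num.sqrt a)).
Proof.
move=> a0 h0; rewrite gamma_mass_scale ?ltW// powRD; last by rewrite (gt_eqF h0) implybT.
rewrite powRr1 ?ltW//; congr (_ * _); rewrite /stirling_ratio divfK// gt_eqF//.
by rewrite mulr_gt0 ?sqrtr_gt0// mulr_gt0 ?powR_gt0 ?expR_gt0.
Qed.

Lemma stirling_ratio_gt0 a : 0 < a -> 0 < stirling_ratio a.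
Proof.
move=> a0; rewrite /stirling_ratio divr_gt0// ?gamma_mass_gt0 ?ltW//.
by rewrite mulr_gt0 ?sqrtr_gt0// mulr_gt0 ?powR_gt0 ?expR_gt0.
Qed.

Lemma kernel_max_stirling a h : 0 < a -> 0 < h ->
  (a * h) `^ a * expR (- a) / gamma_mass a h = (h * Num.sqrt a * stirling_ratio a)^-1.
Proof.
move=> a0 h0; rewrite gamma_mass_stirling// powRM ?ltW//.
have [S0 s0] : 0 < stirling_ratio a /\ 0 < Num.sqrt a.
  by rewrite stirling_ratio_gt0 ?sqrtr_gt0.
have [p0 q0] : 0 < a `^ a /\ 0 < h `^ a by rewrite !powR_gt0.
have e0 := expR_gt0 (- a).
by field; rewrite !lt0r_neq0.
Qed.

(** The product [a * h] is the same for [(a, h)] and [(2 * a, h / 2)], so powers and exponentials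
    cancel exactly, leaving square roots and Stirling ratios. *)
Lemma kernel_sqr_stirling a h : 0 < a -> 0 < h ->
  gamma_mass (2 * a) (h / 2) / gamma_mass a h ^+ 2 =
  stirling_ratio (2 * a) * Num.sqrt 2 / (2 * h * Num.sqrt a * stirling_ratio a ^+ 2).
Proof.
move=> a0 h0; have a20 : 0 < 2 * a by rewrite mulr_gt0.
have h20 : 0 < h / 2 by rewrite divr_gt0.
rewrite !gamma_mass_stirling// sqrtrM//.
have -> : expR (- (2 * a)) = expR (- a) ^+ 2 by rewrite -expRM_natl mulrN.
have E : (h / 2) `^ (2 * a) * (2 * a) `^ (2 * a) = (h `^ a * a `^ a) ^+ 2.
  rewrite -powRM ?ltW// -(powRM _ (ltW h0) (ltW a0)) -powR_mulrn ?powR_ge0// -powRrM.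
  by congr (_ `^ _); [field|rewrite mulrC].
have [S0 s0] : 0 < stirling_ratio a /\ 0 < Num.sqrt a.
  by rewrite stirling_ratio_gt0 ?sqrtr_gt0.
have [p0 q0] : 0 < a `^ a /\ 0 < h `^ a by rewrite !powR_gt0.
have e0 := expR_gt0 (- a).
have -> : (h / 2) `^ (2 * a) * (h / 2) * (stirling_ratio (2 * a) *
    ((2 * a) `^ (2 * a) * expR (- a) ^+ 2 * (Num.sqrt 2 * Num.sqrt a))) =
  ((h / 2) `^ (2 * a) * (2 * a) `^ (2 * a)) * (h / 2) * (stirling_ratio (2 * a) *
    (expR (- a) ^+ 2 * (Num.sqrt 2 * Num.sqrt a))) by ring.
by rewrite E; field; rewrite !lt0r_neq0.
Qed.

Lemma gamma_mass0 h : 0 < h -> gamma_mass 0 h = h.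
Proof.
move=> h0; rewrite gamma_mass_scale// add0r powRr1 ?ltW//.
suff -> : gamma_mass 0 1 = 1 :> R by rewrite mulr1.
have H := @integral_exponential_pdf R 1 ltr01.
rewrite /gamma_mass /Rintegral [X in fine X](_ : _ = 1%E)//.
rewrite -[RHS]H; apply: eq_integral => y _; congr EFin.
by rewrite /gamma_weight /exponential_pdf patch_indic /= powRr0 divr1 mulN1r.
Qed.

Variable h : nat -> R.
Hypotheses (h_gt0 : forall n, 0 < h n) (h_cvg0 : h n @[n --> \oo] --> 0).

(* Maximum of the kernel, attained at [y = x], and the factor between its square
   and the kernel with half bandwidth. *)
Definition kernel_max x n := ((x / h n) * h n) `^ (x / h n) * expR (- (x / h n)) / gamma_mass (x / h n) (h n).
Definition kernel_sqr x n := gamma_mass (x / (h n / 2)) (h n / 2) / gamma_mass (x / h n) (h n) ^+ 2.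

Lemma sqrt_h_cvg0 : Num.sqrt (h n) @[n --> \oo] --> 0.
Proof.
rewrite -[X in _ --> X]sqrtr0; apply: continuous_cvg h_cvg0; exact: sqrt_continuous.
Qed.

Lemma stirling_ratio_div_cvg (x c : R) : 0 < x -> 1 <= c ->
  stirling_ratio (c * (x / h n)) @[n --> \oo] --> Num.sqrt (2 * pi).
Proof.
move=> x0 c1; have c0 : 0 < c by lra.
(* [stirling] wants a lower bound 1 for every [n], whereas [c * (x / h n)] reaches 1 only
   eventually. The constant [c] is 1 for the kernel and 2 for the half bandwidth. *)
pose a n := Num.max 1 (c * (x / h n)).
have near1 : \forall n \near \oo, 1 <= c * (x / h n).
  have cx : 0 < c * x by rewrite mulr_gt0.
  have : \forall n \near \oo, h n < c * x by apply: (cvgr_lt 0 h_cvg0).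
  apply: filterS => n hn; rewrite mulrA ler_pdivlMr// mul1r; exact: ltW.
have : stirling_ratio (a n) @[n --> \oo] --> Num.sqrt (2 * pi).
  apply: stirling; first by move=> n; rewrite /a le_max lexx.
  have : Num.sqrt (h n) * (Num.sqrt (c * x))^-1 @[n --> \oo] --> (0 : R).
    by rewrite -[X in _ --> X](mul0r (Num.sqrt (c * x))^-1); apply: cvgMl; exact: sqrt_h_cvg0.
  apply: cvg_trans; apply: near_eq_cvg; apply: filterS near1 => n H.
  have cx : 0 <= c * x by rewrite mulr_ge0// ltW.
  rewrite /a (max_idPr H) mulrA [in RHS](sqrtrM _ cx) sqrtrV ?ltW//.
  by rewrite invfM invrK mulrC.
apply: cvg_trans; apply: near_eq_cvg; apply: filterS near1 => n H.
by rewrite /a (max_idPr H).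
Qed.

Let hsa (x : R) n : 0 < x -> h n * Num.sqrt (x / h n) = Num.sqrt (h n) * Num.sqrt x.
Proof.
move=> x0; have sh : 0 < Num.sqrt (h n) by rewrite sqrtr_gt0.
rewrite sqrtrM ?ltW// sqrtrV ?ltW// -{1}(@sqr_sqrtr _ (h n)) ?ltW//.
by field; exact: lt0r_neq0.
Qed.

Lemma kernel_max_pos (x : R) : 0 < x ->
  exists B, \forall n \near \oo, kernel_max x n * Num.sqrt (h n) <= B.
Proof.
move=> x0; have sx : 0 < Num.sqrt x by rewrite sqrtr_gt0.
have p2 : 0 < Num.sqrt (2 * pi) :> R by rewrite sqrtr_gt0 mulr_gt0// pi_gt0.
exists ((Num.sqrt x * (Num.sqrt (2 * pi) / 2))^-1).
have := stirling_ratio_div_cvg x0 (lexx 1); under eq_cvg do rewrite mul1r; move=> H.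
have : \forall n \near \oo, Num.sqrt (2 * pi) / 2 < stirling_ratio (x / h n).
  by apply: (cvgr_gt _ H); lra.
apply: filterS => n Hn.
have a0 : 0 < x / h n by rewrite divr_gt0.
have sh : 0 < Num.sqrt (h n) by rewrite sqrtr_gt0.
have S0 := stirling_ratio_gt0 a0.
rewrite /kernel_max kernel_max_stirling// hsa//.
have -> : (Num.sqrt (h n) * Num.sqrt x * stirling_ratio (x / h n))^-1 * Num.sqrt (h n) =
   (Num.sqrt x * stirling_ratio (x / h n))^-1 by field; rewrite !lt0r_neq0.
have l0 : 0 < Num.sqrt x * (Num.sqrt (2 * pi) / 2) by rewrite mulr_gt0// divr_gt0.
by rewrite lef_pV2 ?posrE ?(mulr_gt0 sx S0)// ler_pM2l// ltW.
Qed.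

(** Since [h * sqrt (x / h) = sqrt h * sqrt x], the factor [sqrt h] cancels, and only the Stirling
    ratios still depend on [n]; all of them tend to [sqrt (2 * pi)]. *)
Lemma kernel_sqr_pos (x : R) : 0 < x ->
  Num.sqrt (h n) * kernel_sqr x n @[n --> \oo] --> (2 * Num.sqrt (pi * x))^-1.
Proof.
move=> x0; have sx : 0 < Num.sqrt x by rewrite sqrtr_gt0.
have spi : 0 < Num.sqrt pi :> R by rewrite sqrtr_gt0 pi_gt0.
have s2 : 0 < Num.sqrt 2 :> R by rewrite sqrtr_gt0.
have H1 := stirling_ratio_div_cvg x0 (lexx 1).
have H2 := stirling_ratio_div_cvg x0 (ler1n R 2).
have E n : Num.sqrt (h n) * kernel_sqr x n =
    stirling_ratio (2 * (x / h n)) * (stirling_ratio (1 * (x / h n)) * stirling_ratio (1 * (x / h n)))^-1 *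
    (Num.sqrt 2 / (2 * Num.sqrt x)).
  have a0 : 0 < x / h n by rewrite divr_gt0.
  have sh : 0 < Num.sqrt (h n) by rewrite sqrtr_gt0.
  have S0 := stirling_ratio_gt0 a0.
  rewrite mul1r /kernel_sqr.
  have -> : x / (h n / 2) = 2 * (x / h n) by field; exact: lt0r_neq0.
  rewrite kernel_sqr_stirling// -(mulrA 2 (h n)) hsa//.
  by field; rewrite !lt0r_neq0.
under eq_cvg do rewrite E.
have -> : (2 * Num.sqrt (pi * x))^-1 = Num.sqrt (2 * pi) * (Num.sqrt (2 * pi) * Num.sqrt (2 * pi))^-1 *
    (Num.sqrt 2 / (2 * Num.sqrt x)) :> R.
  rewrite (sqrtrM _ (pi_ge0 R)) (@sqrtrM _ 2 pi)//.
  by field; rewrite !lt0r_neq0.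
apply: cvgMl; apply: cvgM => //; apply: cvgV; last exact: cvgM.
by rewrite lt0r_neq0// -expr2 exprn_gt0// sqrtr_gt0 mulr_gt0// pi_gt0.
Qed.

(** At the boundary the kernel is the exponential density, whose maximum is the inverse of [h n];
    the convention 0^0 = 1 is what makes [kernel_max] agree. *)
Lemma kernel_max0 n : kernel_max 0 n * h n = 1.
Proof.
by rewrite /kernel_max !mul0r powRr0 oppr0 expR0 mul1r gamma_mass0// mul1r mulVf// lt0r_neq0.
Qed.

Lemma kernel_sqr0 n : h n * kernel_sqr 0 n = 2^-1.
Proof.
have hn2 : 0 < h n / 2 by rewrite divr_gt0.
by rewrite /kernel_sqr !mul0r !gamma_mass0//; field; exact: lt0r_neq0.
Qed.

End kernel_asymptotics.

(** * Regularity of the densities *)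

Section function_spaces.
Context {R : realType}.
Implicit Types u : R -> R.

Lemma C0_bmf u : C0 u -> bmf u.
Proof.
move=> [cu uy uNy]; split; first exact: continuous_measurable_fun.
move/cvgrPdist_lt : uy => /(_ _ ltr01)[A [_ HA]].
move/cvgrPdist_lt : uNy => /(_ _ ltr01)[B [_ HB]].
pose C := Num.max `|A| `|B| + 1.
have C0 : - C <= C.
  by rewrite -subr_ge0 opprK addr_ge0// addr_ge0// le_max normr_ge0.
have cuC : {within `[- C, C], continuous (fun y => `|u y|)}.
  apply: continuous_subspaceT => y; apply: continuous_comp; first exact: cu.
  exact: norm_continuous.
have [c _ Hc] := EVT_max C0 cuC.
exists (Num.max 1 `|u c|) => y; rewrite le_max.
have [yC|yC] := leP `|y| C.
  by rewrite Hc ?orbT// in_itv/= -ler_norml.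
have AC : `|A| < `|y| by rewrite (le_lt_trans _ yC)// /C ler_wpDr// le_max lexx.
have BC : `|B| < `|y| by rewrite (le_lt_trans _ yC)// /C ler_wpDr// le_max lexx orbT.
have [y0|y0] := leP 0 y.
  have /HA : A < y by rewrite -(ger0_norm y0) (le_lt_trans (ler_norm _) AC).
  by rewrite /= sub0r normrN => /ltW ->.
have /HB : y < B.
  rewrite -(opprK y) -(ltr0_norm y0) ltrNl (le_lt_trans _ BC)//.
  by rewrite -normrN ler_norm.
by rewrite /= sub0r normrN => /ltW ->.
Qed.

Lemma norm0_cvg (v : nat -> R -> R) (e : R) : norm0 (v n) @[n --> \oo] --> 0%E -> 0 < e ->
  \forall n \near \oo, forall y, `|v n y| <= e.
Proof.
move=> v0 e0.
have : \forall n \near \oo, (norm0 (v n) < e%:E)%E.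
  have : nbhs (0%E : \bar R) [set z | (z < e%:E)%E].
    by apply: open_nbhs_nbhs; split; [exact: open_ereal_lt_ereal|rewrite /= lte_fin].
  by move=> /v0.
apply: filterS => n Hn y; rewrite -lee_fin (le_trans _ (ltW Hn))//.
by apply: ereal_sup_ubound; exists y.
Qed.

Lemma cos_lipschitz (a b : R) : `|cos a - cos b| <= `|a - b|.
Proof.
wlog ab : a b / a <= b => [H|].
  have [/H//|/ltW/H] := leP a b; by rewrite distrC (distrC b).
have d (y : R) : y \in `]a, b[ -> is_derive y 1 cos (- sin y) by move=> _; exact: is_derive_cos.
have cc : {within `[a, b], continuous (cos : R -> R)}.
  by apply: continuous_subspaceT; exact: continuous_cos.
have [c _ H] := MVT_segment ab d cc.
rewrite distrC H normrM normrN (distrC a) ler_piMl//.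
by rewrite ler_norml sin_geN1 sin_le1.
Qed.

Lemma is_derive_nneg_pos u (y l : R) : 0 < y -> is_derive_nneg u y l -> is_derive y 1 u l.
Proof.
move=> y0 ul.
have H : h^-1 *: ((u \o shift y) (h *: (1 : R)) - u y) @[h --> 0^'] --> l.
  apply/cvgrPdist_lt => e e0.
  move/cvgrPdist_lt : ul => /(_ _ e0); rewrite /within /= => /nbhs_ballP[b /= b0 Hb].
  (* Increments smaller than [y] keep [h + y] in the half-line, so the relative derivative is a
     two-sided one. *)
  apply/nbhs_ballP; exists (Num.min b y); first by rewrite /= lt_min b0.
  move=> h; rewrite /ball /= sub0r normrN lt_min => /andP[hb hy] h0.
  have hy0 : 0 <= h + y.
    by have := ler_norm (- h); rewrite normrN; lra.
  have := Hb (h + y); rewrite /ball /= opprD addrCA subrr addr0 normrN => /(_ hb).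
  have hyy : h + y != y by rewrite -subr_eq0 addrK.
  move=> /(_ hyy); rewrite in_itv/= andbT => /(_ hy0).
  by rewrite addrK /GRing.scale /= mulr1 mulrC.
apply: DeriveDef; first by apply/cvg_ex; exists l.
exact/cvg_lim.
Qed.

Lemma is_derive_nneg_continuous u (u1 : R -> R) :
  (forall y, 0 <= y -> is_derive_nneg u y (u1 y)) -> {within `[0, +oo[, continuous u}.
Proof.
move=> du; apply/subspace_continuousP => y; rewrite /= in_itv/= andbT => y0.
apply/cvgrPdist_lt => e e0.
move/cvgrPdist_lt : (du y y0) => /(_ _ ltr01); rewrite /within /= => /nbhs_ballP[b /= b0 Hb].
pose c := `|u1 y| + 1; have c0 : 0 < c by rewrite ltr_wpDl.
apply/nbhs_ballP; exists (Num.min b (e / c)); first by rewrite /= lt_min b0 divr_gt0.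
move=> z; rewrite /ball /= lt_min => /andP[zb ze] z0.
have [->|zy] := eqVneq z y; first by rewrite subrr normr0.
have {}Hb := Hb z zb zy z0.
have zy0 : z - y != 0 by rewrite subr_eq0.
have -> : u y - u z = - ((u z - u y) / (z - y) * (z - y)) by field.
rewrite normrN normrM.
have : `|(u z - u y) / (z - y)| <= c.
  have := ler_normB (u1 y) (u1 y - (u z - u y) / (z - y)).
  rewrite opprB addrCA subrr addr0 /c => H; apply: (le_trans H); rewrite lerD2l; exact: ltW.
move=> H; apply: (@le_lt_trans _ _ (c * `|z - y|)); first by rewrite ler_wpM2r.
by rewrite distrC mulrC -ltr_pdivlMr.
Qed.

Lemma MVT_nneg u (u1 : R -> R) (a b : R) : 0 <= a -> a <= b ->
  (forall y, 0 <= y -> is_derive_nneg u y (u1 y)) ->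
  exists2 c, a <= c <= b & u b - u a = u1 c * (b - a).
Proof.
move=> a0 ab du.
have dF (y : R) : y \in `]a, b[ -> is_derive y 1 u (u1 y).
  rewrite in_itv/= => /andP[ay _]; have y0 := le_lt_trans a0 ay.
  by apply: is_derive_nneg_pos => //; apply: du; exact: ltW.
have cF : {within `[a, b], continuous u}.
  apply: continuous_subspaceW (is_derive_nneg_continuous du) => y.
  by rewrite /= !in_itv/= andbT => /andP[/(le_trans a0)].
have [c cab H] := MVT_segment ab dF cF; exists c => //.
Qed.

(** The mean value theorem is applied to [u], then to [u1]. This gives [M] instead of [M / 2], which
    is harmless as only the order of the bias matters. *)
Lemma C2_taylor u (x : R) : C2_bounded_nneg u -> 0 <= x ->
  exists D M, 0 <= M /\
    forall y, 0 <= y -> `|u y - u x - D * (y - x)| <= M * (y - x) ^+ 2.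
Proof.
move=> [u1 [u2 [d1 d2 _ [M HM]]]] x0.
have M0 : 0 <= M by exact: le_trans (HM 0 (lexx 0)).
exists (u1 x), M; split => // y y0.
have key (c d : R) : `|u2 d| <= M -> `|c - x| <= `|y - x| ->
    `|u2 d * (c - x) * (y - x)| <= M * (y - x) ^+ 2.
  move=> h1 h2; rewrite -[in leRHS]real_normK ?num_real// !normrM -mulrA ler_pM//.
  by rewrite expr2 ler_wpM2r.
have [xy|/ltW yx] := leP x y.
  have [c /andP[xc cy] ->] := MVT_nneg x0 xy d1.
  have [d /andP[xd dc] E] := MVT_nneg x0 xc d2.
  rewrite -mulrBl E; apply: key; first by apply: HM; lra.
  by rewrite !ger0_norm; lra.
have [c /andP[yc cx] E1] := MVT_nneg y0 yx d1.
have c0 : 0 <= c by lra.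
have [d /andP[cd dx] E2] := MVT_nneg c0 cx d2.
have -> : u y - u x - u1 x * (y - x) = u2 d * (c - x) * (y - x).
  have -> : u y - u x = u1 c * (y - x) by rewrite -opprB E1; ring.
  have -> : u2 d * (c - x) = u1 c - u1 x by rewrite -[RHS]opprB E2; ring.
  ring.
apply: key; first by apply: HM; lra.
by rewrite !ler0_norm; lra.
Qed.

End function_spaces.

(** * The central limit theorem for the kernel estimator *)

Section mixed_mean.
Context {R : realType} {d} {T : measurableType d} (P : probability T R).
Notation leb := (@lebesgue_measure R).

(** By Tonelli a bound at each fixed [y] passes to the average. It is asked only where [rho] is
    positive, because (4) speaks of [y >= 0] alone. *)
Lemma mixed_mean_le (rho : R -> R) (D : T -> R -> R) (c : R) : subdensity rho ->
  measurable_fun setT (fun z : T * R => D z.1 z.2) ->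
  (forall y, 0 < rho y -> (\int[P]_w (`|D w y|)%:E <= c%:E)%E) -> 0 <= c ->
  measurable_fun setT (fun w => \int[leb]_y (`|D w y| * rho y)%:E)%E /\
  (\int[P]_w \int[leb]_y (`|D w y| * rho y)%:E <= c%:E)%E.
Proof.
move=> sr mD Dc c0; have [mr r0 r1] := sr.
pose F (z : T * R) := (`|D z.1 z.2| * rho z.2)%:E.
have mF : measurable_fun setT F.
  apply/measurable_EFinP; apply: measurable_funM; first exact: measurableT_comp mD.
  exact: measurableT_comp mr _.
have F0 z : (0 <= F z)%E by rewrite lee_fin mulr_ge0.
split; first exact: (@measurable_fun_fubini_tonelli_F _ _ _ _ _ leb F mF F0).
rewrite (@fubini_tonelli _ _ _ _ _ P leb F mF F0)/=.
have mDy y : measurable_fun setT (fun w => (`|D w y|)%:E).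
  apply/measurable_EFinP/measurableT_comp => //.
  have mp : measurable_fun setT (fun w : T => (w, y)) by exact: measurable_fun_pair.
  exact: (measurableT_comp mD mp).
apply: (@le_trans _ _ (\int[leb]_y (c * rho y)%:E)%E).
  apply: ge0_le_integral => //.
  - by move=> y _; exact: integral_ge0.
  - exact: (@measurable_fun_fubini_tonelli_G _ _ _ _ _ P F mF F0).
  - by apply/measurable_EFinP; exact: measurable_funM.
  - move=> y _; rewrite /F/=; under eq_integral do rewrite mulrC EFinM.
    rewrite ge0_integralZl ?lee_fin ?r0//.
    rewrite [in leRHS]EFinM [leRHS]muleC.
    have := r0 y; rewrite le_eqVlt => /predU1P[<-|ry]; first by rewrite !mul0e.
    by rewrite lee_wpmul2l ?lee_fin// Dc.
under eq_integral do rewrite EFinM.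
have mr' : measurable_fun setT (fun y => (rho y)%:E) by exact/measurable_EFinP.
rewrite ge0_integralZl//; last by move=> y _; rewrite lee_fin.
by rewrite -[leRHS]mule1 lee_wpmul2l.
Qed.

Lemma mean_avg_le (rho : R -> R) (D : T -> R -> R) (c : R) (F : T -> R) : subdensity rho ->
  measurable_fun setT (fun z : T * R => D z.1 z.2) ->
  (forall y, 0 < rho y -> (\int[P]_w (`|D w y|)%:E <= c%:E)%E) -> 0 <= c ->
  (forall w, bmf (D w)) -> bmf F -> {ae P, forall w, F w = avg rho (D w)} ->
  \int[P]_w `|F w| <= c.
Proof.
move=> sr mD Dc c0 bD bF FE.
have [_ r0 _] := sr.
have [mI Ic] := mixed_mean_le sr mD Dc c0.
have bF' : bmf (fun w => `|F w|).
  have [mF [M FM]] := bF; split; first exact: measurableT_comp.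
  by exists M => w; rewrite normr_id.
rewrite /Rintegral -lee_fin fineK; last exact: integrable_fin_num (bmf_integrable P bF').
apply: le_trans Ic; apply: ae_ge0_le_integral => //.
- exact/measurable_EFinP/bF'.1.
- move=> w _; apply: integral_ge0 => y _; by rewrite lee_fin mulr_ge0.
- move: FE; apply: filterS => w Fw _; rewrite Fw.
  have i1 := avg_integrable sr (bD w).
  have := le_normr_Rintegral measurableT i1; rewrite -lee_fin => /le_trans; apply.
  rewrite /Rintegral fineK; last first.
    apply: integrable_fin_num => //.
    have := integrable_abse i1; apply: eq_integrable => //.
  rewrite le_eqVlt; apply/orP; left; apply/eqP; apply: eq_integral => y _.
  by rewrite normrM (ger0_norm (r0 y)).
Qed.

End mixed_mean.

(** * Martingale central limit theorem with a remainder *)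

Section clt.
Context {R : realType} {d} {T : measurableType d} (P : probability T R).

(** Slutsky's argument carried out on cosines: they are 1-Lipschitz, so the remainder changes their
    mean by at most [|l|] times its L^1 norm. *)
Lemma martingale_clt (G : nat -> set (set T)) (xi s : nat -> nat -> T -> R) (e : nat -> R)
    (v : R) (r : nat -> T -> R) (Z : nat -> T -> R) :
  (forall k, G k `<=` measurable) -> (forall k, <<s G k >> `<=` <<s G k.+1 >>) ->
  0 < v -> e n @[n --> \oo] --> 0 ->
  (forall n, martingale_differences P G (xi n) (s n) (e n)) ->
  {ae P, forall w, \sum_(0 <= k < n) s n k w @[n --> \oo] --> v} ->
  (forall n, bmf (r n)) -> \int[P]_w `|r n w| @[n --> \oo] --> 0 ->
  (forall n w, Z n w = \sum_(0 <= k < n) xi n k w + r n w) ->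
  cvg_in_distribution P Z (normal_prob 0 (Num.sqrt v)).
Proof.
move=> Gm Gmono v0 e0 md sv br r0 ZE.
have bxi n k : bmf (xi n k) by have [b _ _ _ _] := md n; exact: (bm_bmf (@Gm k.+1) (b k)).
have bS n : bmf (fun w => \sum_(0 <= k < n) xi n k w) by apply: bmf_sum => k _.
have bZ n : bmf (Z n) by rewrite (funext (ZE n)); exact: bmfD (bS n) (br n).
have cos_cvg l th : \int[P]_w cos (l * Z n w + th) @[n --> \oo] -->
    expR (- (l ^+ 2 * Num.sqrt v ^+ 2 / 2)) * cos th.
  rewrite sqr_sqrtr ?ltW//.
  have H1 := @mart_cos _ _ _ _ _ Gm Gmono _ _ _ _ l th (ltW v0) e0 md sv.
  have bc (F : T -> R) : bmf F -> bmf (fun w => cos (l * F w + th)).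
    by move=> bF; apply: bmf_cos; have [] := bmfD (bmfZ l bF) (bmf_cst th).
  have H2 : \int[P]_w cos (l * Z n w + th) -
      \int[P]_w cos (l * \sum_(0 <= k < n) xi n k w + th) @[n --> \oo] --> (0 : R).
    apply: (@cvg_le_dist _ _ _ _ _ _ (fun n => `|l| * \int[P]_w `|r n w|)); last first.
      have : `|l| * \int[P]_w `|r n w| @[n --> \oo] --> `|l| * 0 by exact: cvgMr.
      by rewrite mulr0.
    apply: nearW => n; rewrite subr0 -RexpB; [|exact/bc..].
    have bb := bmfB (bc _ (bZ n)) (bc _ (bS n)).
    apply: (le_trans (le_normr_Rintegral measurableT (bmf_integrable P bb))).
    have bn (F : T -> R) : bmf F -> bmf (fun w => `|F w|).
      move=> [mF [M FM]]; split; first exact: measurableT_comp.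
      by exists M => w; rewrite normr_id.
    rewrite -RexpZ; last exact: bn.
    apply: le_Rexp; [exact: bn|by apply: bmfZ; exact: bn|].
    move=> w; apply: (le_trans (cos_lipschitz _ _)).
    rewrite -normrM ZE le_eqVlt; apply/orP; left; apply/eqP; congr (`|_|); ring.
  have E n : \int[P]_w cos (l * Z n w + th) =
      (\int[P]_w cos (l * Z n w + th) -
       \int[P]_w cos (l * \sum_(0 <= k < n) xi n k w + th)) +
      \int[P]_w cos (l * \sum_(0 <= k < n) xi n k w + th) by rewrite subrK.
  have := cvgD H2 H1; rewrite add0r; under [in X in _ -> X]eq_fun do rewrite E; exact.
have sv0 : 0 < Num.sqrt v by rewrite sqrtr_gt0.
split; first by move=> n; have [] := bZ n.
move=> phi cphi phiM.
have [bphi H] := levy (fun n => (bZ n).1) sv0 cos_cvg cphi phiM.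
have -> : (\int[normal_prob 0 (Num.sqrt v)]_y (phi y)%:E =
    (\int[normal_prob 0 (Num.sqrt v)]_y phi y)%R%:E)%E.
  by rewrite fineK//; apply: integrable_fin_num => //; exact: bmf_integrable.
rewrite Rintegral_normal_prob//.
have E n : ('E_P[phi \o Z n] = (\int[P]_w phi (Z n w))%R%:E)%E.
  rewrite unlock fineK//; apply: integrable_fin_num => //; apply: bmf_integrable.
  by have [mphi [M HM]] := bphi; split; [exact: measurableT_comp mphi (bZ n).1|exists M].
under eq_fun do rewrite E.
by apply: cvg_EFin => //; exact: nearW.
Qed.

End clt.

(** In place of the Cauchy-Schwarz inequality, [|D|] is at most [D ^+ 2 / (2 * c) + c / 2], whose
    mean is at most [c]; hence the condition [0 < c]. *)
Lemma L1_le_L2 {R : realType} {d} {T : measurableType d} (P : probability T R)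
    (D : T -> R) (c : R) : measurable_fun setT D -> 0 < c ->
  ((Lnorm P 2%:E (EFin \o D)) ^+ 2 <= (c ^+ 2)%:E)%E ->
  (\int[P]_w (`|D w|)%:E <= c%:E)%E.
Proof.
move=> mD c0 H.
have E2 : (\int[P]_w ((D w) ^+ 2)%:E <= (c ^+ 2)%:E)%E.
  apply: le_trans H.
  have n2 : (2 : R) != 0 by [].
  have -> : (\int[P]_w (D w ^+ 2)%:E = Lnorm P 2%:E (EFin \o D) `^ 2)%E.
    rewrite poweR_Lnorm//; apply: eq_integral => w _ /=.
    by rewrite ?poweR_EFin powR_mulrn// real_normK ?num_real.
  have := Lnorm_ge0 P 2%:E (EFin \o D).
  case: (Lnorm P 2%:E (EFin \o D)) => [r||]//; last by move=> _; rewrite expe2 mulyy leey.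
  by rewrite lee_fin => r0; rewrite poweR_EFin powR_mulrn// expe2 -EFinM expr2.
have mD2 : measurable_fun setT (fun w => D w ^+ 2) by exact: measurable_funX.
have c20 : 0 <= (2 * c)^-1 by rewrite invr_ge0 mulr_ge0// ltW.
apply: (@le_trans _ _ (\int[P]_w (((2 * c)^-1)%:E * (D w ^+ 2)%:E + (c / 2)%:E))%E).
  apply: ge0_le_integral => //.
  - by apply/measurable_EFinP; exact: measurableT_comp.
  - apply: emeasurable_funD => //; apply: measurable_funeM; exact/measurable_EFinP.
  - move=> w _; rewrite -EFinM -EFinD lee_fin -subr_ge0.
    have -> : (2 * c)^-1 * D w ^+ 2 + c / 2 - `|D w| = (`|D w| - c) ^+ 2 / (2 * c).
      by rewrite -[D w ^+ 2]real_normK ?num_real//; field; exact: lt0r_neq0.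
    by rewrite divr_ge0 ?sqr_ge0// mulr_ge0// ltW.
rewrite ge0_integralD//; last 3 first.
- by move=> w _; rewrite -EFinM lee_fin mulr_ge0// sqr_ge0.
- by apply: measurable_funeM; exact/measurable_EFinP.
- by move=> w _; rewrite lee_fin divr_ge0// ltW.
rewrite ge0_integralZl//; [|exact/measurable_EFinP|by move=> w _; rewrite lee_fin sqr_ge0].
rewrite integral_cst//= [X in (_ + _ * X)%E](@probability_setT _ _ _ P) mule1.
apply: (@le_trans _ _ (((2 * c)^-1)%:E * (c ^+ 2)%:E + (c / 2)%:E)%E).
  by rewrite leeD2r// lee_wpmul2l// lee_fin.
rewrite -EFinM -EFinD lee_fin le_eqVlt; apply/orP; left; apply/eqP.
by field; exact: lt0r_neq0.
Qed.

Lemma avg_sum {R : realType} (rho : R -> R) n (k : nat -> R -> R) : subdensity rho ->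
  (forall i, bmf (k i)) ->
  avg rho (fun y => \sum_(0 <= i < n) k i y) = \sum_(0 <= i < n) avg rho (k i).
Proof.
move=> sr bk; elim: n => [|n ih].
  rewrite big_nil; under [X in avg _ X]eq_fun do rewrite big_nil.
  by rewrite avg_cst// mul0r.
rewrite big_nat_recr//= -ih -avgD//; last by apply: bmf_sum => i _.
by congr avg; apply/funext => y; rewrite big_nat_recr.
Qed.

(** * The kernel estimator as a martingale array *)

Section core.
Context {R : realType} {d} {T : measurableType d} (P : probability T R).
Notation leb := (@lebesgue_measure R).
Notation Rp := (`[0, +oo[%classic : set R).
Variables (X Y : int -> {RV P >-> R}) (h b : nat -> R) (g : int -> T -> R -> R) (x : R).
Hypotheses (X_ge0 : forall t w, 0 <= X t w) (h_gt0 : forall n, 0 < h n) (x_ge0 : 0 <= x).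
Hypothesis g_density : forall t : int,
  is_conditional_density P (past X Y (t - 1)) (X t) (g t).

(** Indices are shifted by one: step [k] predicts observation [k + 1] from the past up to [k], so
    observations 1 to [n] are steps 0 to [n - 1]. *)
Definition past_at (k : nat) := past X Y k%:Z.
Definition next_obs (k : nat) : T -> R := X k.+1%:Z.
Definition next_density (k : nat) := g k.+1%:Z.
Definition gkernel n := gamma_pdf (x / h n + 1) (h n).
Definition kernel_cmean n k := cexp (next_density k) (gkernel n).
Definition kernel_cmean2 n k := cexp (next_density k) (fun y => gkernel n y ^+ 2).
Definition norming (n : nat) := Num.sqrt (n%:R * b n) * n%:R^-1.
Definition increment n k w := norming n * (gkernel n (next_obs k w) - kernel_cmean n k w).
Definition increment_var n k w := norming n ^+ 2 * (kernel_cmean2 n k w - kernel_cmean n k w ^+ 2).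

Lemma past_at_measurable k : past_at k `<=` measurable.
Proof.
move=> A [t [B [_ mB ->]]]; rewrite -[X in measurable X]setTI.
have : measurable_fun setT (fun w => (X t w, Y t w)) by apply: measurable_fun_pair.
exact.
Qed.

Lemma past_at_mono k : <<s past_at k >> `<=` <<s past_at k.+1 >>.
Proof.
apply: smallest_sub; first exact: smallest_sigma_algebra.
apply: (@subset_trans _ (past_at k.+1)); last exact: sub_gen_smallest.
move=> A [t [B [tk mB ->]]]; exists t, B; split => //.
by rewrite (le_trans tk)// lez_nat.
Qed.

Lemma measurable_next_obs k : measurable_fun setT (next_obs k). Proof. by []. Qed.

Lemma next_obs_ge0 k w : 0 <= next_obs k w. Proof. exact: X_ge0. Qed.

Lemma next_density_conditional k : is_conditional_density P (past_at k) (next_obs k) (next_density k).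
Proof.
have := g_density k.+1%:Z; rewrite /past_at /next_obs /next_density.
by rewrite (_ : k.+1%:Z - 1 = k%:Z)// -addn1 PoszD addrK.
Qed.

Lemma next_obs_adapted k : measurable_fun (setT : set (g_sigma_algebraType (past_at k.+1))) (next_obs k).
Proof.
move=> _ B mB; rewrite setTI; apply: sub_gen_smallest.
exists k.+1%:Z, (B `*` setT); split => //; first exact: measurableX.
by apply/seteqP; split => w //= [].
Qed.

Let a0 n : 0 <= x / h n. Proof. by rewrite divr_ge0// ltW. Qed.

Lemma gkernel_subdensity n : subdensity (gkernel n). Proof. exact: gamma_pdf_subdensity. Qed.

Lemma gkernel_ge0 n y : 0 <= gkernel n y. Proof. by have [] := gkernel_subdensity n. Qed.

Lemma gkernel_le_max n y : gkernel n y <= kernel_max h x n. Proof. exact: gamma_pdf_max. Qed.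

Lemma bmf_gkernel n : bmf (gkernel n). Proof. exact: bmf_gamma_pdf. Qed.

Lemma bmf_gkernel_sqr n : bmf (fun y => gkernel n y ^+ 2). Proof. exact/bmfX/bmf_gkernel. Qed.

Lemma kernel_max_ge0 n : 0 <= kernel_max h x n.
Proof. exact: le_trans (gkernel_ge0 n 0) (gkernel_le_max n 0). Qed.

Lemma norming_ge0 n : 0 <= norming n.
Proof. by rewrite mulr_ge0 ?sqrtr_ge0// invr_ge0. Qed.

Lemma next_density_subdensity k w : subdensity (trunc_density (next_density k) w).
Proof. exact: (trunc_density_subdensity (next_density_conditional k)). Qed.

Lemma kernel_cmean_bounds n k w : 0 <= kernel_cmean n k w <= kernel_max h x n.
Proof.
apply/andP; split; first by apply: avg_ge0; [exact: next_density_subdensity|exact: gkernel_ge0].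
rewrite (le_trans (ler_norm _))//; apply: avg_bound; [exact: next_density_subdensity|exact: bmf_gkernel|exact: kernel_max_ge0|].
by move=> y _; rewrite ger0_norm ?gkernel_ge0// gkernel_le_max.
Qed.

Lemma kernel_cmean2_bounds n k w : kernel_cmean n k w ^+ 2 <= kernel_cmean2 n k w <= kernel_max h x n ^+ 2.
Proof.
apply/andP; split; first exact: avg_sqr_le (next_density_subdensity k w) (bmf_gkernel n).
rewrite (le_trans (ler_norm _))//; apply: avg_bound; [exact: next_density_subdensity|exact: bmf_gkernel_sqr|exact: sqr_ge0|].
move=> y _; rewrite ger0_norm ?sqr_ge0// ler_pXn2r ?nnegrE ?gkernel_ge0 ?kernel_max_ge0//.
exact: gkernel_le_max.
Qed.

Lemma bm_kernel_cmean n k : bm (past_at k) (kernel_cmean n k). Proof. exact: (bm_cexp (next_density_conditional k) (bmf_gkernel n)). Qed.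

Lemma bm_kernel_cmean2 n k : bm (past_at k) (kernel_cmean2 n k). Proof. exact: (bm_cexp (next_density_conditional k) (bmf_gkernel_sqr n)). Qed.

Lemma bm_gkernel_next_obs n k : bm (past_at k.+1) (fun w => gkernel n (next_obs k w)).
Proof.
have [mK [M KM]] := bmf_gkernel n; split; last by exists M.
exact: measurableT_comp mK (@next_obs_adapted k).
Qed.

Lemma increment_martingale n : martingale_differences P past_at (increment n) (increment_var n) (norming n * kernel_max h x n).
Proof.
split.
- move=> k; apply: bmfZ; apply: bmfB; first exact: bm_gkernel_next_obs.
  exact: (bm_filtration past_at_mono (leqnSn k) (bm_kernel_cmean n k)).
- move=> k; apply: bmfZ; apply: bmfB; first exact: bm_kernel_cmean2.
  by apply: bmfX; exact: bm_kernel_cmean.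
- move=> k w; rewrite /increment normrM (ger0_norm (norming_ge0 n)) ler_wpM2l ?norming_ge0//.
  have /andP[m0 m1] := kernel_cmean_bounds n k w.
  have := gkernel_ge0 n (next_obs k w); have := gkernel_le_max n (next_obs k w).
  by rewrite ler_norml => ? ?; apply/andP; split; lra.
- move=> k w; have /andP[q1 q2] := kernel_cmean2_bounds n k w; rewrite /increment_var; apply/andP; split.
    by rewrite mulr_ge0 ?sqr_ge0// subr_ge0.
  rewrite (exprMn _ (norming n)) ler_wpM2l ?sqr_ge0//; have := sqr_ge0 (kernel_cmean n k w); lra.
- move=> k H bH.
  have bH' := bm_bmf (@past_at_measurable k) bH.
  have bm' := bm_bmf (@past_at_measurable k) (bm_kernel_cmean n k).
  have bq' := bm_bmf (@past_at_measurable k) (bm_kernel_cmean2 n k).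
  have bKU := bm_bmf (@past_at_measurable k.+1) (bm_gkernel_next_obs n k).
  have c1 := cexp_bm (@past_at_measurable k) (@measurable_next_obs k) (@next_obs_ge0 k) (next_density_conditional k) bH (bmf_gkernel n).
  have c2 := cexp_bm (@past_at_measurable k) (@measurable_next_obs k) (@next_obs_ge0 k) (next_density_conditional k) bH (bmf_gkernel_sqr n).
  (* The cross term of the square needs [H * kernel_cmean] as test function, which is allowed since
     the conditional mean is adapted and bounded. *)
  have bHm : bm (past_at k) (fun w => H w * kernel_cmean n k w) by apply: bmfM; [exact: bH|exact: bm_kernel_cmean].
  have bHm' := bm_bmf (@past_at_measurable k) bHm.
  have c3 := cexp_bm (@past_at_measurable k) (@measurable_next_obs k) (@next_obs_ge0 k) (next_density_conditional k) bHm (bmf_gkernel n).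
  split.
    transitivity (\int[P]_w (norming n * (H w * gkernel n (next_obs k w) - H w * kernel_cmean n k w))).
      by apply: eq_Rintegral => w _; rewrite /increment; ring.
    rewrite RexpZ; last by apply: bmfB; exact: bmfM.
    by rewrite RexpB ?c1 ?subrr ?mulr0//; exact: bmfM.
  transitivity (\int[P]_w (norming n ^+ 2 * ((H w * gkernel n (next_obs k w) ^+ 2 -
      2 * (H w * kernel_cmean n k w * gkernel n (next_obs k w))) + H w * kernel_cmean n k w * kernel_cmean n k w))).
    by apply: eq_Rintegral => w _; rewrite /increment; ring.
  have b1 : bmf (fun w => H w * gkernel n (next_obs k w) ^+ 2) by apply: bmfM => //; exact: bmfX.
  have b2 : bmf (fun w => H w * kernel_cmean n k w * gkernel n (next_obs k w)) by exact: bmfM.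
  have b3 : bmf (fun w => H w * kernel_cmean n k w * kernel_cmean n k w) by exact: bmfM.
  have b4 : bmf (fun w => H w * kernel_cmean2 n k w) by exact: bmfM.
  have b2' := bmfZ 2 b2; have b12 := bmfB b1 b2'.
  rewrite RexpZ; last exact: bmfD.
  rewrite RexpD// RexpB// RexpZ// c2 c3 -/(kernel_cmean n k) -/(kernel_cmean2 n k).
  transitivity (\int[P]_w (norming n ^+ 2 * (H w * kernel_cmean2 n k w - H w * kernel_cmean n k w * kernel_cmean n k w))); last first.
    by apply: eq_Rintegral => w _; rewrite /increment_var; ring.
  rewrite RexpZ; last exact: bmfB.
  rewrite (RexpB P b4 b3); ring.
Qed.

Variable f : R -> R.
Hypotheses (f_C0 : C0 f) (f_C2 : C2_bounded_nneg f) (g_C0 : forall t w, C0 (g t w)).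
Hypothesis h_cvg0 : h n @[n --> \oo] --> 0.
Hypotheses (b_gt0 : forall n, 0 < b n) (b_cvg0 : b n @[n --> \oo] --> 0).

Let bf : bmf f. Proof. exact: C0_bmf. Qed.

Let bg t w : bmf (g t w). Proof. exact: C0_bmf. Qed.

(** The exchange of roles: the kernel vanishes on the negative half-line, so the cut of the density
    there is invisible, and the kernel becomes the weight. *)
Lemma cexp_gamma_pdf k w h' : good (next_density k) w -> 0 < h' ->
  cexp (next_density k) (gamma_pdf (x / h' + 1) h') w = avg (gamma_pdf (x / h' + 1) h') (next_density k w).
Proof.
move=> gw0 h'0; rewrite /cexp /avg; apply: eq_Rintegral => y _.
have a' : 0 <= x / h' by rewrite divr_ge0// ltW.
have E : (\1_(good (next_density k)) w : R) = 1 by rewrite indicE mem_set.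
rewrite /trunc_density E mul1r mulrC.
have [y0|y0] := ltP y 0; first by rewrite gamma_pdfE// gamma_weight_lt0// !mulr0.
by rewrite indicE mem_set ?mulr1//= in_itv/= andbT.
Qed.

Definition half_gkernel n := gamma_pdf (x / (h n / 2) + 1) (h n / 2).

Let h2 n : 0 < h n / 2. Proof. by rewrite divr_gt0. Qed.

Let sK' n : subdensity (half_gkernel n).
Proof. by apply: gamma_pdf_subdensity => //; rewrite divr_ge0// ltW. Qed.

Lemma kernel_cmean2E n k w : good (next_density k) w -> kernel_cmean2 n k w = kernel_sqr h x n * avg (half_gkernel n) (next_density k w).
Proof.
move=> gw0; rewrite -(cexp_gamma_pdf gw0 (h2 n)) /kernel_cmean2 /cexp.
rewrite -avgZ; last 2 first.
- exact: next_density_subdensity.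
- by apply: bmf_gamma_pdf => //; rewrite divr_ge0// ltW.
by congr avg; apply/funext => y; rewrite /gkernel gamma_pdf_sqr.
Qed.

Definition mean_density n w y := n%:R^-1 * \sum_(1 <= t < n.+1) g t%:Z w y.

Lemma mean_densityE n w y : mean_density n w y = n%:R^-1 * \sum_(0 <= k < n) next_density k w y.
Proof. by rewrite /mean_density big_add1. Qed.

Lemma avg_mean_density rho n w : subdensity rho ->
  n%:R^-1 * \sum_(0 <= k < n) avg rho (next_density k w) = avg rho (mean_density n w).
Proof.
move=> sr; rewrite -avg_sum//; last by move=> i; exact: bg.
rewrite -avgZ//; last by apply: bmf_sum => i _; exact: bg.
by congr avg; apply/funext => y; rewrite mean_densityE.
Qed.

Lemma bmf_mean_density n w : bmf (mean_density n w).
Proof. by apply: bmfZ; apply: bmf_sum => i _; exact: bg. Qed.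

Lemma ae_all_good : {ae P, forall w, forall k, good (next_density k) w}.
Proof. by apply/ae_foralln => k; exact: ae_good (@past_at_measurable k) (@next_obs_ge0 k) (next_density_conditional k). Qed.

(** Stated for an arbitrary bandwidth because it serves both [h n], for the centring, and [h n / 2],
    for the squared kernel. *)
Lemma kernel_bias_le : exists2 C, 0 <= C & forall h', 0 < h' -> h' <= 1 ->
  `|avg (gamma_pdf (x / h' + 1) h') f - f x| <= C * h'.
Proof.
have [D [M [M0 H]]] := C2_taylor f_C2 x_ge0.
exists (`|D| + M * (x + 2)); first by rewrite addr_ge0// mulr_ge0// addr_ge0.
move=> h' h'0 h'1; apply: (le_trans (kernel_bias x_ge0 h'0 bf H)).
have -> : (`|D| + M * (x + 2)) * h' = `|D| * h' + M * (x * h' + 2 * h') by ring.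
rewrite lerD2l ler_wpM2l// lerD2l ler_pM2l// expr2 ler_piMr//; exact: ltW.
Qed.

Lemma near_h_le1 : \forall n \near \oo, h n <= 1.
Proof.
have : \forall n \near \oo, h n < 1 by apply: (cvgr_lt 0 h_cvg0).
by apply: filterS => n /ltW.
Qed.

Lemma norming_sqr n : (0 < n)%N -> norming n ^+ 2 = b n * n%:R^-1.
Proof.
move=> n0; rewrite /norming (exprMn _ (Num.sqrt _)) sqr_sqrtr; last by rewrite mulr_ge0// ltW.
have n0' : (n%:R : R) != 0 by rewrite pnatr_eq0 -lt0n.
by field.
Qed.

Lemma variance_cvg L : b n * kernel_sqr h x n @[n --> \oo] --> L ->
  {ae P, forall w, norm0 (fun y => mean_density n w y - f y) @[n --> \oo] --> 0%E} ->
  {ae P, forall w, exists2 u : R -> R, C0 u &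
      norm0 (fun y => n%:R^-1 * \sum_(1 <= t < n.+1) (g t%:Z w y) ^+ 2 - u y)
        @[n --> \oo] --> 0%E} ->
  {ae P, forall w, \sum_(0 <= k < n) increment_var n k w @[n --> \oo] --> f x * L}.
Proof.
move=> cL g_mean g_sqr.
move: ae_all_good g_mean g_sqr; apply: filterS3 => w gw0 gm [u u0 gs].
(* A sup-norm limit controls averages against weights that move with [n], so the concentration of
   the kernel is harmless here. *)
have cA1 : avg (half_gkernel n) (mean_density n w) - avg (half_gkernel n) f @[n --> \oo] --> (0 : R).
  apply/cvgrPdist_le => e e0; have := norm0_cvg gm e0; apply: filterS => n Hn.
  have -> : avg (half_gkernel n) (mean_density n w) - avg (half_gkernel n) f = avg (half_gkernel n) (fun y => mean_density n w y + -1 * f y).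
    have b1 := bmfZ (-1) bf; have b2 := bmf_mean_density n w.
    by rewrite avgD// [avg _ (fun y => -1 * f y)]avgZ// mulN1r.
  rewrite sub0r normrN; apply: avg_bound => //; [|exact: ltW|].
    by apply: bmfD; [exact: bmf_mean_density|exact: bmfZ].
  by move=> y _; rewrite mulN1r.
have cA2 : avg (half_gkernel n) f @[n --> \oo] --> f x.
  have [C C0' HC] := kernel_bias_le.
  apply: (@cvg_le_dist _ _ _ _ _ _ (fun n => C * (h n / 2))).
    apply: filterS near_h_le1 => n hn; apply: HC => //; lra.
  have : C * (h n * 2^-1) @[n --> \oo] --> C * (0 * 2^-1) by apply: cvgMr; exact: cvgMl.
  by rewrite mul0r mulr0.
have cA : avg (half_gkernel n) (mean_density n w) @[n --> \oo] --> f x.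
  have E n : avg (half_gkernel n) (mean_density n w) =
      (avg (half_gkernel n) (mean_density n w) - avg (half_gkernel n) f) + avg (half_gkernel n) f by rewrite subrK.
  have := cvgD cA1 cA2; rewrite add0r; under [in X in _ -> X]eq_fun do rewrite E; exact.
(* Jensen bounds each squared conditional mean by the kernel average of the squared density; by (5)
   the mean of these squares is eventually at most [M + 1] uniformly in [y], and [b n] tends to
   0. *)
have cB : b n * (n%:R^-1 * \sum_(0 <= k < n) kernel_cmean n k w ^+ 2) @[n --> \oo] --> (0 : R).
  have [M M0 uM] := bmf_bound_gt0 (C0_bmf u0).
  apply: (@cvg_le_dist _ _ _ _ _ _ (fun n => b n * (M + 1))); last first.
    have : b n * (M + 1) @[n --> \oo] --> 0 * (M + 1) by exact: cvgMl.
    by rewrite mul0r.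
  have := norm0_cvg gs ltr01; apply: filterS => n Hn.
  have n0 : 0 <= n%:R^-1 :> R by rewrite invr_ge0.
  rewrite subr0 ger0_norm; last first.
    by rewrite mulr_ge0 ?(ltW (b_gt0 n))// mulr_ge0// sumr_ge0// => k _; exact: sqr_ge0.
  rewrite ler_pM2l//.
  have bs2 : bmf (fun y => n%:R^-1 * \sum_(0 <= k < n) next_density k w y ^+ 2).
    by apply: bmfZ; apply: bmf_sum => k _; apply: bmfX; exact: bg.
  apply: (@le_trans _ _ (avg (gkernel n) (fun y => n%:R^-1 * \sum_(0 <= k < n) next_density k w y ^+ 2))).
    rewrite avgZ; [|exact: gkernel_subdensity|by apply: bmf_sum => k _; apply: bmfX; exact: bg].
    rewrite avg_sum; [|exact: gkernel_subdensity|by move=> k; apply: bmfX; exact: bg].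
    rewrite ler_wpM2l//; apply: ler_sum => k _.
    by rewrite /kernel_cmean /gkernel cexp_gamma_pdf//; apply: avg_sqr_le; [exact: gkernel_subdensity|exact: bg].
  rewrite (le_trans (ler_norm _))//; apply: avg_bound; [exact: gkernel_subdensity|exact: bs2|lra|].
  move=> y _; have := Hn y; have := uM y; rewrite big_add1/= => H1 H2.
  set v := n%:R^-1 * _ in H2 *.
  have := ler_normD (v - u y) (u y); rewrite subrK; rewrite /next_density; lra.
have : (b n * kernel_sqr h x n) * avg (half_gkernel n) (mean_density n w) -
    b n * (n%:R^-1 * \sum_(0 <= k < n) kernel_cmean n k w ^+ 2) @[n --> \oo] --> L * f x - 0.
  by apply: cvgB => //; exact: cvgM.
rewrite subr0 mulrC; apply: cvg_trans; apply: near_eq_cvg; near=> n.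
have n0 : (0 < n)%N by near: n; exact: nbhs_infty_gt.
rewrite -avg_mean_density// /increment_var.
under [RHS]eq_bigr do rewrite kernel_cmean2E//.
rewrite -mulr_sumr sumrB -mulr_sumr norming_sqr//; ring.
Unshelve. all: by end_near. Qed.

Lemma measurable_conditional_density t : measurable_fun setT (fun z : T * R => g t z.1 z.2).
Proof.
have [mg _ _] := g_density t.
pose Gt := past X Y (t - 1).
have mp : measurable_fun setT (fun z : T * R => (z.1 : g_sigma_algebraType Gt, z.2)).
  apply: measurable_fun_pair => //= _ B mB; rewrite setTI.
  have Gm : <<s Gt >> `<=` measurable.
    apply: smallest_sub => //; first exact: sigma_algebra_measurable.
    move=> A [u [C [_ mC ->]]]; rewrite -[X in measurable X]setTI.
    have : measurable_fun setT (fun w => (X u w, Y u w)) by apply: measurable_fun_pair.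
    exact.
  have := @measurable_fst _ _ T R measurableT B (Gm B mB); rewrite setTI; exact.
exact: (measurableT_comp mg mp).
Qed.

Definition density_dev n w y := mean_density n w y - f y.

Lemma measurable_density_dev n : measurable_fun setT (fun z : T * R => density_dev n z.1 z.2).
Proof.
apply: measurable_funB; last exact: (measurableT_comp bf.1 (@measurable_snd _ _ T R)).
apply: measurable_funM; first exact: measurable_cst.
by apply: measurable_sum => t; exact: measurable_conditional_density.
Qed.

Definition remainder n w := Num.sqrt (n%:R * b n) * (n%:R^-1 * \sum_(0 <= k < n) kernel_cmean n k w - f x).

Lemma gamma_kde_split n w : Num.sqrt (n%:R * b n) * (gamma_kde h X n x w - f x) =
  \sum_(0 <= k < n) increment n k w + remainder n w.
Proof.
rewrite /gamma_kde big_add1/= /increment -mulr_sumr sumrB /remainder /norming /next_obs /gkernel; ring.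
Qed.

Let bm' n k : bmf (kernel_cmean n k). Proof. exact: bm_bmf (@past_at_measurable k) (bm_kernel_cmean n k). Qed.

Lemma bmf_remainder n : bmf (remainder n).
Proof.
apply: bmfZ; apply: bmfB; last exact: bmf_cst.
by apply: bmfZ; apply: bmf_sum => k _.
Qed.

Lemma gkernel_gt0_ge0 n y : 0 < gkernel n y -> 0 <= y.
Proof.
rewrite leNgt; apply: contraTN => y0.
by rewrite /gkernel gamma_pdfE// gamma_weight_lt0// mulr0 ltxx.
Qed.

Variable C : R.
Hypothesis g_L2 : \forall n \near \oo,
  (ereal_sup [set (Lnorm P 2%:E (fun w =>
       (\sum_(1 <= t < n.+1) g t%:Z w y - n%:R * f y)%R%:E)) ^+ 2
     | y in `[0%R, +oo[] <= (C * n%:R)%R%:E)%E.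

(** The constant in (4) is not known to be positive, as [L1_le_L2] requires. *)
Let C1 := Num.max C 1.
Let C10 : 0 < C1. Proof. by rewrite /C1 lt_max ltr01 orbT. Qed.

Lemma density_dev_L1 : \forall n \near \oo, forall y, 0 <= y ->
  (\int[P]_w (`|density_dev n w y|)%:E <= (n%:R^-1 * Num.sqrt (C1 * n%:R))%:E)%E.
Proof.
near=> n => y y0.
have n0 : (0 < n)%N by near: n; exact: nbhs_infty_gt.
have n0' : 0 < n%:R :> R by rewrite ltr0n.
pose D w := \sum_(1 <= t < n.+1) g t%:Z w y - n%:R * f y.
have DE w : density_dev n w y = n%:R^-1 * D w.
  by rewrite /density_dev /mean_density /D; field; exact: lt0r_neq0.
have mp : measurable_fun setT (fun w : T => (w, y)) by exact: measurable_fun_pair.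
have mD : measurable_fun setT D.
  apply: measurable_funB; last exact: measurable_cst.
  apply: measurable_sum => t; exact: (measurableT_comp (measurable_conditional_density t) mp).
have D2 : ((Lnorm P 2%:E (EFin \o D)) ^+ 2 <= ((Num.sqrt (C1 * n%:R)) ^+ 2)%:E)%E.
  rewrite sqr_sqrtr; last by rewrite mulr_ge0// ltW.
  apply: (@le_trans _ _ (C * n%:R)%:E); last first.
    by rewrite lee_fin ler_pM2r// /C1 le_max lexx.
  have : (ereal_sup [set (Lnorm P 2%:E (fun w =>
       (\sum_(1 <= t < n.+1) g t%:Z w y - n%:R * f y)%R%:E)) ^+ 2
     | y in `[0%R, +oo[] <= (C * n%:R)%R%:E)%E by near: n; exact: g_L2.
  apply: le_trans; apply: ereal_sup_ubound; exists y => //=.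
  by rewrite in_itv/= y0.
have s0 : 0 < Num.sqrt (C1 * n%:R) by rewrite sqrtr_gt0 mulr_gt0.
have := L1_le_L2 mD s0 D2 => H.
under eq_integral do rewrite DE normrM EFinM ger0_norm ?invr_ge0//.
have mD' : measurable_fun setT (fun w => (`|D w|)%:E).
  by apply/measurable_EFinP; exact: measurableT_comp.
have n1 : (0 <= (n%:R^-1)%:E :> \bar R)%E by rewrite lee_fin invr_ge0.
by rewrite ge0_integralZl// [in leRHS]EFinM lee_wpmul2l.
Unshelve. all: by end_near. Qed.

Lemma remainder_cvg : n%:R * b n * h n ^+ 2 @[n --> \oo] --> 0 ->
  \int[P]_w `|remainder n w| @[n --> \oo] --> 0.
Proof.
move=> nbh; have [B B0 HB] := kernel_bias_le.
have bn (F : T -> R) : bmf F -> bmf (fun w => `|F w|).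
  move=> [mF [M FM]]; split; first exact: measurableT_comp.
  by exists M => w; rewrite normr_id.
(* First term: [sqrt (n b)] times the mean deviation [sqrt (C1 * n) / n]. Second term: [sqrt (n b)]
   times the bias [B * h n]. *)
apply: (@cvg_le_dist _ _ _ _ _ _ (fun n => Num.sqrt C1 * Num.sqrt (b n) +
    B * Num.sqrt (n%:R * b n * h n ^+ 2))); last first.
  have s0 (u : nat -> R) : u n @[n --> \oo] --> 0 -> Num.sqrt (u n) @[n --> \oo] --> 0.
    by move=> u0; rewrite -[X in _ --> X]sqrtr0; apply: continuous_cvg u0; exact: sqrt_continuous.
  have : Num.sqrt C1 * Num.sqrt (b n) + B * Num.sqrt (n%:R * b n * h n ^+ 2) @[n --> \oo] -->
      Num.sqrt C1 * 0 + B * 0.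
    by apply: cvgD; apply: cvgMr; exact: s0.
  by rewrite !mulr0 addr0.
near=> n.
have n0 : (0 < n)%N by near: n; exact: nbhs_infty_gt.
have n0' : 0 < n%:R :> R by rewrite ltr0n.
have hn1 : h n <= 1 by near: n; exact: near_h_le1.
have gL1 : forall y, 0 <= y ->
  (\int[P]_w (`|density_dev n w y|)%:E <= (n%:R^-1 * Num.sqrt (C1 * n%:R))%:E)%E.
  by near: n; exact: density_dev_L1.
pose F w := n%:R^-1 * \sum_(0 <= k < n) kernel_cmean n k w - avg (gkernel n) f.
have bF : bmf F.
  by apply: bmfB; [apply: bmfZ; apply: bmf_sum => k _|exact: bmf_cst].
have FE : {ae P, forall w, F w = avg (gkernel n) (density_dev n w)}.
  move: ae_all_good; apply: filterS => w gw0.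
  have b1 := bmfZ (-1) bf; have b2 := bmf_mean_density n w; have sKn := gkernel_subdensity n.
  have -> : density_dev n w = (fun y => mean_density n w y + -1 * f y).
    by apply/funext => y; rewrite mulN1r.
  rewrite avgD// [avg _ (fun y => -1 * f y)]avgZ// mulN1r /F -avg_mean_density//.
  congr (_ * _ - _); apply: eq_bigr => k _.
  by rewrite /kernel_cmean /gkernel cexp_gamma_pdf.
have c0 : 0 <= n%:R^-1 * Num.sqrt (C1 * n%:R) by rewrite mulr_ge0 ?sqrtr_ge0// invr_ge0.
have FL : \int[P]_w `|F w| <= n%:R^-1 * Num.sqrt (C1 * n%:R).
  apply: (mean_avg_le (gkernel_subdensity n) (measurable_density_dev n) _ c0 _ bF FE).
  - by move=> y /gkernel_gt0_ge0; exact: gL1.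
  - by move=> w; apply: bmfB; [exact: bmf_mean_density|exact: bf].
rewrite subr0 ger0_norm; last by apply: Rintegral_ge0.
have snb0 : 0 <= Num.sqrt (n%:R * b n) by exact: sqrtr_ge0.
apply: (@le_trans _ _ (\int[P]_w (Num.sqrt (n%:R * b n) * (`|F w| + B * h n)))).
  apply: le_Rexp; [exact/bn/bmf_remainder| |].
    by apply: bmfZ; apply: bmfD; [exact: bn|exact: bmf_cst].
  move=> w; rewrite /remainder normrM (ger0_norm snb0) ler_wpM2l//.
  have -> : n%:R^-1 * \sum_(0 <= k < n) kernel_cmean n k w - f x = F w + (avg (gkernel n) f - f x).
    by rewrite /F; ring.
  by rewrite (le_trans (ler_normD _ _))// lerD2l; exact: HB.
rewrite RexpZ; last by apply: bmfD; [exact: bn|exact: bmf_cst].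
rewrite RexpD; [|exact: bn|exact: bmf_cst].
rewrite Rexp_cst mulrDr lerD//.
  apply: (@le_trans _ _ (Num.sqrt (n%:R * b n) * (n%:R^-1 * Num.sqrt (C1 * n%:R)))).
    by rewrite ler_wpM2l.
  rewrite (sqrtrM _ (ltW n0')) (sqrtrM _ (ltW C10)) -[X in _ * (X^-1 * _)](sqr_sqrtr (ltW n0')).
  have sn0 : 0 < Num.sqrt (n%:R : R) by rewrite sqrtr_gt0.
  by rewrite le_eqVlt; apply/orP; left; apply/eqP; field; exact: lt0r_neq0.
have nb0 : 0 <= n%:R * b n by rewrite mulr_ge0// ltW.
rewrite (sqrtrM (h n ^+ 2) nb0) sqrtr_sqr gtr0_norm//.
rewrite le_eqVlt; apply/orP; left; apply/eqP; ring.
Unshelve. all: by end_near. Qed.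

Lemma kde_clt (L : R) : 0 < f x -> 0 < L -> n%:R * b n @[n --> \oo] --> +oo ->
  n%:R * b n * h n ^+ 2 @[n --> \oo] --> 0 ->
  b n * kernel_sqr h x n @[n --> \oo] --> L ->
  (exists B, \forall n \near \oo, kernel_max h x n * b n <= B) ->
  {ae P, forall w, norm0 (fun y => mean_density n w y - f y) @[n --> \oo] --> 0%E} ->
  {ae P, forall w, exists2 u : R -> R, C0 u &
      norm0 (fun y => n%:R^-1 * \sum_(1 <= t < n.+1) (g t%:Z w y) ^+ 2 - u y)
        @[n --> \oo] --> 0%E} ->
  cvg_in_distribution P
    (fun n w => Num.sqrt (n%:R * b n) * (gamma_kde h X n x w - f x))
    (normal_prob 0 (Num.sqrt (f x * L))).
Proof.
move=> fx0 L0 nb nbh cL [B HB] g_mean g_sqr.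
apply: (martingale_clt past_at_measurable past_at_mono (mulr_gt0 fx0 L0) _ increment_martingale
  (variance_cvg cL g_mean g_sqr) bmf_remainder (remainder_cvg nbh) gamma_kde_split).
have nbp : \forall n \near \oo, 0 < n%:R * b n.
  near=> n; rewrite mulr_gt0// ltr0n; near: n; exact: nbhs_infty_gt.
have s0 : Num.sqrt ((n%:R * b n)^-1) @[n --> \oo] --> 0.
  rewrite -[X in _ --> X]sqrtr0; apply: continuous_cvg; first exact: sqrt_continuous.
  by have /(gtr0_cvgV0 nbp) := nb.
(* The bound on the increments equals [kernel_max * b] divided by [sqrt (n b)]. *)
apply: (@cvg_le_dist _ _ _ _ _ _ (fun n => B * Num.sqrt ((n%:R * b n)^-1))); last first.
  have : B * Num.sqrt ((n%:R * b n)^-1) @[n --> \oo] --> B * 0 by exact: cvgMr.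
  by rewrite mulr0.
near=> n.
have n0 : (0 < n)%N by near: n; exact: nbhs_infty_gt.
have n0' : 0 < n%:R :> R by rewrite ltr0n.
have Bn : kernel_max h x n * b n <= B by near: n.
rewrite subr0 ger0_norm; last exact: mulr_ge0 (norming_ge0 n) (kernel_max_ge0 n).
have nb0 : 0 < n%:R * b n by rewrite mulr_gt0.
have sp : 0 < Num.sqrt (n%:R * b n) by rewrite sqrtr_gt0.
have -> : norming n * kernel_max h x n =
    kernel_max h x n * b n * (Num.sqrt (n%:R * b n) / (Num.sqrt (n%:R * b n)) ^+ 2).
  by rewrite /norming sqr_sqrtr ?ltW//; field; rewrite !lt0r_neq0.
have -> : Num.sqrt ((n%:R * b n)^-1) = Num.sqrt (n%:R * b n) / (Num.sqrt (n%:R * b n)) ^+ 2.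
  by rewrite sqrtrV ?(ltW nb0)//; field; exact: lt0r_neq0.
by rewrite ler_pM2r// divr_gt0// exprn_gt0.
Unshelve. all: by end_near. Qed.

End core.

Theorem theorem3p3 (R : realType) (d : measure_display) (T : measurableType d)
    (P : probability T R) (X Y : int -> {RV P >-> R})
    (f Phi r : R -> R) (h : nat -> R) (g : int -> T -> R -> R) (x : R)
    (X_ge0 : forall t w, 0 <= X t w)
    (Y_ge0 : forall t w, 0 <= Y t w)
    (stationaryXY : strictly_stationary P X Y)
    (ergodicXY : ergodic P X Y)
    (f_density : forall t, is_density (distribution P (X t)) f)
    (Y_ac : forall t, distribution P (Y t) `<< lebesgue_measure)
    (Phi_measurable : measurable_fun (`[0, +oo[%classic : set R) Phi)
    (Phi_integrable : ('E_P[fun w => `|Phi (Y 1%R w)|%R] < +oo)%E)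
    (r_regression : is_regression P (X 1) (fun w => Phi (Y 1 w)) r)
    (h_gt0 : forall n, 0 < h n)
    (h_cvg0 : h n @[n --> \oo] --> 0)
    (x_ge0 : 0 <= x)
    (fx_gt0 : 0 < f x)
    (g_density : forall t : int,
      is_conditional_density P (past X Y (t - 1)) (X t) (g t))
    (g_C0 : forall t w, C0 (g t w))
    (f_C0 : C0 f)
    (g_mean : {ae P, forall w,
      norm0 (fun y => n%:R^-1 * \sum_(1 <= t < n.+1) g t%:Z w y - f y)
        @[n --> \oo] --> 0%E})
    (f_C2 : C2_bounded_nneg f)
    (r_C2 : C2_bounded_nneg r)
    (g_L2 : exists C : R, \forall n \near \oo,
      (ereal_sup [set (Lnorm P 2%:E (fun w =>
           (\sum_(1 <= t < n.+1) g t%:Z w y - n%:R * f y)%R%:E)) ^+ 2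
         | y in `[0%R, +oo[] <= (C * n%:R)%R%:E)%E)
    (g_sqr : {ae P, forall w, exists2 u : R -> R, C0 u &
      norm0 (fun y => n%:R^-1 * \sum_(1 <= t < n.+1) (g t%:Z w y) ^+ 2 - u y)
        @[n --> \oo] --> 0%E}) :
  (0 < x ->
   n%:R * Num.sqrt (h n) @[n --> \oo] --> +oo ->
   n%:R * Num.sqrt (h n ^+ 5) @[n --> \oo] --> 0 ->
   cvg_in_distribution P
     (fun n w => Num.sqrt (n%:R * Num.sqrt (h n)) *
                 (gamma_kde h X n x w - f x))
     (normal_prob 0 (Num.sqrt (f x / (2 * Num.sqrt (pi * x)))))) /\
  (x = 0 ->
   n%:R * h n @[n --> \oo] --> +oo ->
   n%:R * h n ^+ 3 @[n --> \oo] --> 0 ->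
   cvg_in_distribution P
     (fun n w => Num.sqrt (n%:R * h n) * (gamma_kde h X n 0 w - f 0))
     (normal_prob 0 (Num.sqrt (f 0 / 2)))).
Proof.
have h_sqrt0 := sqrt_h_cvg0 h_cvg0.
have [C HC] := g_L2.
split=> [x0 nh nh5|x0 nh nh3].
- have sh0 n : 0 < Num.sqrt (h n) by rewrite sqrtr_gt0.
  have L0 : 0 < (2 * Num.sqrt (pi * x))^-1 by rewrite invr_gt0 mulr_gt0// sqrtr_gt0 mulr_gt0// pi_gt0.
  apply: (kde_clt X_ge0 h_gt0 x_ge0 g_density f_C0 f_C2 g_C0 h_cvg0 sh0 h_sqrt0 HC fx_gt0 L0 nh _
    (kernel_sqr_pos h_gt0 h_cvg0 x0) (kernel_max_pos h_gt0 h_cvg0 x0) g_mean g_sqr).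
  (* The bias condition [n b h^2 -> 0] with [b = sqrt h] is the second bandwidth assumption of the
     case. *)
  have E n : n%:R * Num.sqrt (h n) * h n ^+ 2 = n%:R * Num.sqrt (h n ^+ 5).
    have -> : h n ^+ 5 = h n * (h n ^+ 2) ^+ 2 by ring.
    by rewrite (sqrtrM _ (ltW (h_gt0 n))) sqrtr_sqr ger0_norm ?sqr_ge0// mulrA.
  by under eq_fun do rewrite E.
- subst x.
  apply: (kde_clt X_ge0 h_gt0 x_ge0 g_density f_C0 f_C2 g_C0 h_cvg0 h_gt0 h_cvg0 HC fx_gt0 _ nh _
    _ _ g_mean g_sqr) => //.
  + have E n : n%:R * h n * h n ^+ 2 = n%:R * h n ^+ 3 by ring.
    by under eq_fun do rewrite E.
  + by under eq_fun do rewrite (kernel_sqr0 h_gt0); exact: cvg_cst.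
  + by exists 1; apply: nearW => n; rewrite (kernel_max0 h_gt0).
Qed.
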